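(* Every 11-dimensional manifold $P$ equipped with a coframe $(\theta^i,\Omega_\mu,A)$, $i=1,2,3,4$, $\mu=1,\dots,6$, satisfying the differential system $$\begin{aligned} d\theta^1&=(\Omega_1-\tfrac12A)\wedge\theta^1-\Omega_3\wedge\theta^3-\Omega_5\wedge\theta^4\\ d\theta^2&=(-\Omega_1-\tfrac12A)\wedge\theta^2-\Omega_2\wedge\theta^3-\Omega_4\wedge\theta^4\\ d\theta^3&=\Omega_4\wedge\theta^1+\Omega_5\wedge\theta^2+(\Omega_6-\tfrac12A)\wedge\theta^3\\ d\theta^4&=\Omega_2\wedge\theta^1+\Omega_3\wedge\theta^2+(-\Omega_6-\tfrac12A)\wedge\theta^4\\ d\Omega_1&=\Omega_2\wedge\Omega_5-\Omega_3\wedge\Omega_4\\ d\Omega_2&=\Omega_2\wedge(\Omega_1+\Omega_6)\\ d\Omega_3&=(\Omega_1-\Omega_6)\wedge\Omega_3\\ d\Omega_4&=\Omega_4\wedge(\Omega_1-\Omega_6)\\ d\Omega_5&=(\Omega_1+\Omega_6)\wedge\Omega_5\\ d\Omega_6&=\Omega_2\wedge\Omega_5+\Omega_3\wedge\Omega_4\\ dA&=0 \end{aligned}$$ is locally a principal fibre bundle $\mathbf{CO}(2,2)\to P\to\mathcal S$ (over a 4-dimensional manifold $\mathcal S$), originating from a flat para-CR manifold $(\Sigma,[\lambda,\mu_1,\mu_2,\nu_1,\nu_2,\nu_3])$ of type $(1,2,3)$; that is, $P$ is locally fibred over $\Sigma$ and the coframe on $P$ arises from the para-CR forms of $\Sigma$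 by the lifting procedure described in the context.
   Context: A para-CR structure of type $(1,2,3)$ on a 6-dimensional manifold $\Sigma$ is an equivalence class $[\lambda,\mu_1,\mu_2,\nu_1,\nu_2,\nu_3]$ of local coframes, where $(\lambda,\mu_A,\nu_\alpha)\sim(\lambda',\mu'_A,\nu'_\alpha)$ iff $\lambda'=a\lambda$, $\mu'_A=h^B{}_A\mu_B+c_A\lambda$, $\nu'_\alpha=f^\beta{}_\alpha\nu_\beta+b_\alpha\lambda$ for functions with $a\det(h)\det(f)\neq0$, such that $(\lambda,\mu_1,\mu_2)$ and $(\lambda,\nu_1,\nu_2,\nu_3)$ each generate a closed differential ideal. It is called flat if it is locally equivalent (by a local diffeomorphism pulling back the class of coframes) to the one on $\mathbb R^6\ni(x,y,a_0,\dots,a_3)$ represented by $\lambda=da_0+x\,da_1+y\,da_2+xy\,da_3$, $\mu_1=dx$, $\mu_2=dy$, $\nu_j=da_j$, $j=1,2,3$. Lifting procedure: on an 11-dimensional manifold fibred over $\Sigma$ one has $\theta^4=a\lambda$, $\theta^i=b_i\lambda+f_{i1}\nu_1+f_{i2}\nu_2+f_{i3}\nu_3$ ($i=1,2,3$), $\Omega_3=c_1\lambda+h_{11}\mu_1+h_{12}\mu_2$, $\Omega_2=c_2\lambda+h_{21}\mu_1+h_{22}\mu_2$, with functions $a,b_i,c_i,f_{ij},h_{ij}$ on it such that $a\det(f_{ij})\det(h_{ij})\neq0$, and these six forms are supplemented by the 1-forms $\Omega_1,\Omega_4,\Omega_5,\Omega_6,A$ to a coframe satisfying the displayed system; for a flat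 structure this manifold and the supplementing forms are unique. $\mathbf{CO}(2,2)$ is the 7-dimensional group of linear homothetic motions of a metric of signature $(+,+,-,-)$. *)

(* Defs.v *)
From HB Require Import structures.
From mathcomp Require Import all_boot all_order all_algebra.
From mathcomp Require Import all_classical all_reals all_analysis.

Set Implicit Arguments.
Unset Strict Implicit.
Unset Printing Implicit Defensive.

Import Order.TTheory GRing.Theory Num.Theory numFieldNormedType.Exports.

Local Open Scope classical_set_scope.
Local Open Scope ring_scope.

(* MathComp-Analysis has no manifolds or differential forms: this file sets up
   smooth manifolds modelled on the row vectors 'rV[R]_n, and differential
   1- and 2-forms given by their coefficients. *)

Section Smooth.
Context {R : realType} {V W : normedModType R}.

(* Meant for open A in a finite dimensional V: f is C^(k+1) iff it is
   differentiable and all its directional derivatives are C^k. *)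
Fixpoint Ck (k : nat) (A : set V) (f : V -> W) : Prop :=
  if k is k'.+1 then
    (forall x, A x -> differentiable f x) /\ (forall v, Ck k' A ('D_v f))
  else forall x, A x -> {for x, continuous f}.

Definition Csmooth (A : set V) (f : V -> W) : Prop := forall k, Ck k A f.

End Smooth.

Record chart (R : realType) (n : nat) (T : topologicalType) := Chart {
  cdom : set T;
  cmap : T -> 'rV[R]_n;
  cinv : 'rV[R]_n -> T;
  cdom_open : open cdom;
  cimg_open : open (cmap @` cdom);
  cmapK : forall p, cdom p -> cinv (cmap p) = p;
  cmap_continuous : forall p, cdom p -> {for p, continuous cmap};
  cinv_continuous : forall x, (cmap @` cdom) x -> {for x, continuous cinv}
}.

(* The smooth structure is the one generated by [atlas]. [chart_at p] is a
   chart around p, used to identify the tangent space at p with 'rV[R]_n. *)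
Record manifold (R : realType) (n : nat) := Manifold {
  points :> topologicalType;
  manifold_hausdorff : hausdorff_space points;
  manifold_second_countable : @second_countable points;
  atlas : set (chart R n points);
  chart_at : points -> chart R n points;
  chart_at_atlas : forall p, atlas (chart_at p);
  chart_at_dom : forall p, cdom (chart_at p) p;
  atlas_smooth : forall c d, atlas c -> atlas d ->
    Csmooth (cmap c @` (cdom c `&` cdom d)) (cmap d \o cinv c)
}.

Section Maps.
Context {R : realType}.

(* The three predicates below are meant for open U. *)
Definition smooth_fun {m} {M : manifold R m} {W : normedModType R}
    (U : set M) (f : M -> W) : Prop :=
  forall c, atlas c -> Csmooth (cmap c @` (cdom c `&` U)) (f \o cinv c).

Definition smooth_map {m n} {M : manifold R m} {N : manifold R n}
    (U : set M) (f : M -> N) : Prop :=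
  (forall p, U p -> {for p, continuous f}) /\
  forall c d, atlas c -> atlas d ->
    Csmooth (cmap c @` (cdom c `&` U `&` f @^-1` cdom d))
            (cmap d \o f \o cinv c).

(* A diffeomorphism of U onto an open subset of N. *)
Definition open_embedding {n} {M N : manifold R n}
    (U : set M) (f : M -> N) : Prop :=
  exists g : N -> M,
    [/\ smooth_map U f, open (f @` U),
        (forall p, U p -> g (f p) = p) & smooth_map (f @` U) g].

(* The tangent map of f at p, acting on row vectors from the right. *)
Definition tangent {m n} {M : manifold R m} {N : manifold R n}
    (f : M -> N) (p : M) : 'M[R]_(m, n) :=
  'J (cmap (chart_at (f p)) \o f \o cinv (chart_at p)) (cmap (chart_at p) p).

Definition dfun {m} {M : manifold R m} {W : normedModType R}
    (f : M -> W) (p : M) : 'rV[R]_m -> W :=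
  'd (f \o cinv (chart_at p)) (cmap (chart_at p) p).

Definition submersion {m n} {M : manifold R m} {N : manifold R n}
    (U : set M) (f : M -> N) : Prop :=
  smooth_map U f /\ forall p, U p -> row_full (tangent f p).

Definition fibred_over {m n} {M : manifold R m} (U : set M)
    (N : manifold R n) (f : M -> N) : Prop :=
  submersion U f /\ f @` U = setT.

End Maps.

Section Forms.
Context {R : realType} {n : nat} {M : manifold R n}.

(* The value at p is the column of coefficients in [chart_at p], so that a
   tangent vector v at p pairs with the form w as v *m w p. *)
Definition oneform : Type := M -> 'cV[R]_n.

(* Coefficients of w in an arbitrary chart. *)
Definition coefs (c : chart R n M) (w : oneform) (x : 'rV[R]_n) : 'cV[R]_n :=
  'J (cmap (chart_at (cinv c x)) \o cinv c) x *m w (cinv c x).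

Definition smooth_form (U : set M) (w : oneform) : Prop :=
  forall c, atlas c -> Csmooth (cmap c @` (cdom c `&` U)) (coefs c w).

(* 2-forms are represented by their matrix of values on the coordinate
   vectors of [chart_at p]: (w /\ w')(u, v) = w u * w' v - w v * w' u and
   dw(d_i, d_j) = d_i w_j - d_j w_i. *)
Definition wedge (w w' : 'cV[R]_n) : 'M[R]_n := w *m w'^T - w' *m w^T.

Definition dform (w : oneform) (p : M) : 'M[R]_n :=
  let c := chart_at p in
  let D i := 'D_(delta_mx 0 i) (coefs c w) (cmap c p) in
  \matrix_(i, j) (D i j 0 - D j i 0).

Definition coframe (U : set M) (s : n.-tuple oneform) : Prop :=
  (forall i, smooth_form U (tnth s i)) /\
  forall p, U p -> (\matrix_(i, j) tnth s i p j 0) \in unitmx.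

Definition closed_differential_ideal (U : set M) k (s : k.-tuple oneform) :=
  exists b : 'I_k -> 'I_k -> oneform,
    (forall i j, smooth_form U (b i j)) /\
    forall p, U p -> forall i,
      dform (tnth s i) p = \sum_j wedge (b i j p) (tnth s j p).

End Forms.

Arguments oneform {R n} M.

Definition pullback {R : realType} {m n} {M : manifold R m} {N : manifold R n}
    (f : M -> N) (w : oneform N) : oneform M :=
  fun p => tangent f p *m w (f p).

Section Euclid.
Context {R : realType} {n : nat}.
Local Notation E := 'rV[R]_n.

Lemma euclid_second_countable : @second_countable E.
Proof.
pose B (y : 'rV[rat]_n * nat) := ball (map_mx ratr y.1 : E) y.2.+1%:R^-1.
exists (range B); first by apply: card_le_trans (card_image_le _ _) (countableP _).
split=> [_ [y _ <-]|x A /nbhs_ballP[e /= e0 eA]]; first exact: ball_open.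
have [k ke] : exists k : nat, k.+1%:R^-1 < e / 2.
  exists (Num.truncn (e / 2)^-1).
  by rewrite invf_plt ?posrE ?divr_gt0 // truncnS_gt.
have k0 : (0 : R) < k.+1%:R^-1 by rewrite invr_gt0.
have qP i : exists q : rat, ball (x 0 i) k.+1%:R^-1 (ratr q).
  have [||r [xr [q _ qr]]] := @dense_rat R (ball (x 0 i) k.+1%:R^-1).
  - by exists (x 0 i); exact: ballxx.
  - exact: ball_open.
  - by exists q; rewrite qr.
have [q {}qP] := choice qP.
have xq : ball x k.+1%:R^-1 (map_mx ratr (\row_i q i) : E).
  by split=> // i j; rewrite ord1 !mxE.
exists (B (\row_i q i, k)).
  by split; [exists (\row_i q i, k)|exact: ball_sym].
move=> y qy; apply: eA.
apply: (@le_ball _ _ _ (k.+1%:R^-1 + k.+1%:R^-1)).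
  by rewrite (splitr e) lerD // ltW.
exact: ball_triangle xq qy.
Qed.
End Euclid.

Lemma Csmooth_cst {R : realType} {V W : normedModType R} (A : set V) (w : W) :
  Csmooth A (cst w).
Proof.
move=> k; elim: k w => [|k IH] w /=; first by move=> x _; exact: cst_continuous.
split=> [x _|v]; first exact: differentiable_cst.
suff -> : 'D_v (cst w : V -> W) = cst 0 by exact: IH.
by apply/funext => x; rewrite derive_cst.
Qed.

Lemma Csmooth_id {R : realType} {V : normedModType R} (A : set V) :
  Csmooth A (id : V -> V).
Proof.
case=> [|k] /=; first by move=> x _.
split=> [x _|v]; first by have [] := is_diff_id x.
suff -> : 'D_v (id : V -> V) = cst v by exact: Csmooth_cst.
by apply/funext => x; rewrite derive_id.
Qed.

Section EuclidManifold.
Context (R : realType) (n : nat).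
Local Notation E := 'rV[R]_n.

Definition euclid_chart : chart R n E.
Proof.
refine (@Chart R n E setT id id openT _ (fun _ _ => erefl)
  (fun x _ => @cvg_id _ (nbhs x)) (fun x _ => @cvg_id _ (nbhs x))).
by rewrite image_id; exact: openT.
Defined.

Definition euclid : manifold R n.
Proof.
refine (@Manifold R n E (@norm_hausdorff _ _) euclid_second_countable
  [set euclid_chart] (fun=> euclid_chart) _ _ _) => //.
by move=> c d -> ->; exact: Csmooth_id.
Defined.

(* The differential of the i-th coordinate, counted from 0. *)
Definition dcoord (i : nat) : oneform euclid :=
  fun=> \col_j ((j : nat) == i)%:R.

End EuclidManifold.

Section ParaCR.
Context {R : realType}.

Record CRcoframe (Sigma : manifold R 6) := CRCoframe {
  CRdom : set Sigma;
  lam : oneform Sigma;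
  mu : 'I_2 -> oneform Sigma;
  nu : 'I_3 -> oneform Sigma
}.

Definition para_CR_coframe (Sigma : manifold R 6) (L : CRcoframe Sigma) :=
  [/\ open (CRdom L),
      coframe (CRdom L)
        [tuple lam L; mu L 0; mu L 1; nu L 0; nu L 1; nu L 2],
      closed_differential_ideal (CRdom L) [tuple lam L; mu L 0; mu L 1] &
      closed_differential_ideal (CRdom L) [tuple lam L; nu L 0; nu L 1; nu L 2]].

(* The equivalence is required on the common domain of definition. *)
Definition CR_equiv (Sigma : manifold R 6) (L L' : CRcoframe Sigma) : Prop :=
  let U := CRdom L `&` CRdom L' in
  exists (a : Sigma -> R) (c : Sigma -> 'rV[R]_2) (b : Sigma -> 'rV[R]_3)
         (h : Sigma -> 'M[R]_2) (f : Sigma -> 'M[R]_3),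
    [/\ smooth_fun U a, smooth_fun U c, smooth_fun U b,
        smooth_fun U h & smooth_fun U f] /\
    forall p, U p ->
      [/\ a p * \det (h p) * \det (f p) != 0,
          lam L' p = a p *: lam L p,
          forall A, mu L' A p
            = \sum_B h p B A *: mu L B p + c p 0 A *: lam L p &
          forall k, nu L' k p
            = \sum_l f p l k *: nu L l p + b p 0 k *: lam L p].

(* C is a full equivalence class of local coframes whose domains cover. *)
Definition para_CR_structure (Sigma : manifold R 6)
    (C : set (CRcoframe Sigma)) : Prop :=
  [/\ forall L, C L -> para_CR_coframe L,
      forall p, exists2 L, C L & CRdom L p,
      forall L L', C L -> C L' -> CR_equiv L L' &
      forall L, para_CR_coframe L -> (forall L', C L' -> CR_equiv L' L) -> C L].

(* The coordinates of R^6 are (x, y, a0, a1, a2, a3), in this order. *)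
Definition CR_model : CRcoframe (euclid R 6) :=
  let x (p : euclid R 6) : R := (p : 'rV[R]_6) 0 0 in
  let y (p : euclid R 6) : R := (p : 'rV[R]_6) 0 1 in
  {| CRdom := setT;
     lam := fun p => dcoord 2 p + x p *: dcoord 3 p
                     + y p *: dcoord 4 p + (x p * y p) *: dcoord 5 p;
     mu := fun A => dcoord A;
     nu := fun k => dcoord (3 + k) |}.

Definition CR_pullback (Sigma Sigma' : manifold R 6) (W : set Sigma)
    (f : Sigma -> Sigma') (L : CRcoframe Sigma') : CRcoframe Sigma :=
  {| CRdom := W `&` f @^-1` CRdom L;
     lam := pullback f (lam L);
     mu := fun A => pullback f (mu L A);
     nu := fun k => pullback f (nu L k) |}.

Definition flat_CR (Sigma : manifold R 6) (C : set (CRcoframe Sigma)) : Prop :=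
  forall p, exists (W : set Sigma) (f : Sigma -> euclid R 6),
    [/\ open W, W p, open_embedding W f & C (CR_pullback W f CR_model)].

End ParaCR.

Section PrincipalBundle.
Context {R : realType} {k : nat} (G : set 'M[R]_k).

(* For matrix groups G (closed, hence embedded, in GL_k): the last two
   conditions say that (pi, tau) is a bijective immersion of the part of Q over
   V onto V x G, which is then a diffeomorphism. The equivariance of tau turns
   the action into right multiplication on the factor G, so that the action is
   smooth, free and transitive on the fibres. *)
Definition local_trivialization {m n} (Q : manifold R m) (S : manifold R n)
    (pi : Q -> S) (act : Q -> 'M[R]_k -> Q)
    (V : set S) (tau : Q -> 'M[R]_k) : Prop :=
  let W := pi @^-1` V in
  [/\ open V /\ smooth_fun W tau,
      forall q, W q -> G (tau q),
      forall q g, W q -> G g -> tau (act q g) = tau q *m g,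
      forall s g, V s -> G g -> exists! q, pi q = s /\ tau q = g &
      forall q v, W q -> v *m tangent pi q = 0 -> dfun tau q v = 0 -> v = 0].

Definition principal_bundle {m n} (Q : manifold R m) (S : manifold R n)
    (pi : Q -> S) (act : Q -> 'M[R]_k -> Q) : Prop :=
  [/\ submersion setT pi,
      forall q, act q 1%:M = q,
      forall q g h, G g -> G h -> act (act q g) h = act q (g *m h),
      forall q g, G g -> pi (act q g) = pi q &
      forall s, exists V tau, V s /\ local_trivialization pi act V tau].

(* w is the value at q of the fundamental vector field of the element xi of
   the Lie algebra of G. *)
Definition fundamental {m} (Q : manifold R m) (act : Q -> 'M[R]_k -> Q)
    (q : Q) (xi : 'M[R]_k) (w : 'rV[R]_m) : Prop :=
  exists gam : R -> 'M[R]_k,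
    [/\ forall t, G (gam t), gam 0 = 1%:M, is_derive (0 : R) (1 : R) gam xi &
        is_derive (0 : R) (1 : R)
          (fun t => cmap (chart_at q) (act q (gam t))) w].

End PrincipalBundle.

(* The linear homothetic motions of the metric with matrix eta. *)
Definition homothetic_group {R : realType} {k} (eta : 'M[R]_k) : set 'M[R]_k :=
  [set g | exists2 s, 0 < s & g^T *m eta *m g = s *: eta].

(* The metric 2 (theta^1 theta^2 + theta^3 theta^4). *)
Definition eta22 (R : realType) : 'M[R]_4 :=
  \matrix_(i, j) nth 0 (nth [::] [:: [:: 0; 1; 0; 0];
                                     [:: 1; 0; 0; 0];
                                     [:: 0; 0; 0; 1];
                                     [:: 0; 0; 1; 0]] i) j.

Lemma eta22_signature (R : realType) :
  exists2 p : 'M[R]_4, p \in unitmx &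
    p^T *m eta22 R *m p = diag_mx (\row_j (-1) ^+ (2 <= j)%N).
Proof.
pose h : R := 2^-1.
have h2 : h + h = 1 by rewrite /h [RHS]splitr mul1r.
pose p : 'M[R]_4 :=
  \matrix_(i, j) nth 0 (nth [::] [:: [:: 1; 0; 1; 0];
                                     [:: h; 0; - h; 0];
                                     [:: 0; 1; 0; 1];
                                     [:: 0; h; 0; - h]] i) j.
have pE : p^T *m eta22 R *m p = diag_mx (\row_j (-1) ^+ (2 <= j)%N).
  apply/matrixP => -[[|[|[|[|//]]]] ?] [[|[|[|[|//]]]] ?];
  rewrite !mxE !big_ord_recl big_ord0 !mxE !big_ord_recl !big_ord0 !mxE /=;
  rewrite ?(mulr0, mul0r, mulr1, mul1r, addr0, add0r, mulr0n, mulr1n, expr0,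
    expr1) //.
all: try by rewrite ?(mulN1r, mulrN1, h2, subrr, addNr) // -opprD h2.
exists p => //; rewrite unitmxE unitfE; apply/eqP => p0.
have /(congr1 determinant) := pE; rewrite !det_mulmx p0 mulr0 det_diag.
move/esym/eqP; apply/negP; rewrite prodf_seq_neq0; apply/allP => i _.
by rewrite mxE signr_eq0.
Qed.

Definition CO22 (R : realType) : set 'M[R]_4 := homothetic_group (eta22 R).
Arguments CO22 R : clear implicits.

Section Coframe11.
Context {R : realType} (P : manifold R 11).
Context (th1 th2 th3 th4 Om1 Om2 Om3 Om4 Om5 Om6 A : oneform P).

Definition structure_equations : Prop :=
  let h : R := 2^-1 in
  forall p,
  [/\ dform th1 p = wedge (Om1 p - h *: A p) (th1 p)
        - wedge (Om3 p) (th3 p) - wedge (Om5 p) (th4 p),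
      dform th2 p = wedge (- Om1 p - h *: A p) (th2 p)
        - wedge (Om2 p) (th3 p) - wedge (Om4 p) (th4 p),
      dform th3 p = wedge (Om4 p) (th1 p) + wedge (Om5 p) (th2 p)
        + wedge (Om6 p - h *: A p) (th3 p) &
      dform th4 p = wedge (Om2 p) (th1 p) + wedge (Om3 p) (th2 p)
        + wedge (- Om6 p - h *: A p) (th4 p)] /\
  [/\ dform Om1 p = wedge (Om2 p) (Om5 p) - wedge (Om3 p) (Om4 p),
      dform Om2 p = wedge (Om2 p) (Om1 p + Om6 p),
      dform Om3 p = wedge (Om1 p - Om6 p) (Om3 p),
      dform Om4 p = wedge (Om4 p) (Om1 p - Om6 p) &
      dform Om5 p = wedge (Om1 p + Om6 p) (Om5 p)] /\
  [/\ dform Om6 p = wedge (Om2 p) (Om5 p) + wedge (Om3 p) (Om4 p) &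
      dform A p = 0].

(* The matrix Gamma of 1-forms, evaluated on v, for which the first four
   structure equations read d theta^i = - Gamma^i_j /\ theta^j; it takes
   values in the Lie algebra of CO22. *)
Definition connection (p : P) (v : 'rV[R]_11) : 'M[R]_4 :=
  let h : R := 2^-1 in
  let G := [:: [:: h *: A p - Om1 p; 0; Om3 p; Om5 p];
               [:: 0; h *: A p + Om1 p; Om2 p; Om4 p];
               [:: - Om4 p; - Om5 p; h *: A p - Om6 p; 0];
               [:: - Om2 p; - Om3 p; 0; h *: A p + Om6 p]] in
  \matrix_(i, j) (v *m nth 0 (nth [::] G i) j) 0 0.

(* U is an open part of a principal CO(2,2)-bundle over a 4-manifold, in such a
   way that the fibres are the integral manifolds of theta^1 = ... = theta^4 = 0
   and that the fundamental vector fields of the action are the combinations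
   with constant coefficients of the vertical vectors of the dual frame
   prescribed by the structure equations. *)
Definition principal_CO22_bundle_on (U : set P) : Prop :=
  exists (S : manifold R 4) (Q : manifold R 11)
         (pi : Q -> S) (act : Q -> 'M[R]_4 -> Q) (iota : P -> Q),
    [/\ principal_bundle (CO22 R) pi act,
        open_embedding U iota,
        forall p (v : 'rV[R]_11), U p ->
          (v *m tangent (pi \o iota) p = 0 <->
           [/\ v *m th1 p = 0, v *m th2 p = 0, v *m th3 p = 0 & v *m th4 p = 0]) &
        forall p (v : 'rV[R]_11) xi, U p ->
          fundamental (CO22 R) act (iota p) xi (v *m tangent iota p) ->
          connection p v = xi].

Definition lifted_from (U : set P) (Sigma : manifold R 6) (q : P -> Sigma)
    (L : CRcoframe Sigma) : Prop :=
  let lam' := pullback q (lam L) in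
  let mu' B := pullback q (mu L B) in
  let nu' j := pullback q (nu L j) in
  exists (a : P -> R) (b : P -> 'rV[R]_3) (c : P -> 'rV[R]_2)
         (f : P -> 'M[R]_3) (h : P -> 'M[R]_2),
    [/\ smooth_fun U a, smooth_fun U b, smooth_fun U c,
        smooth_fun U f & smooth_fun U h] /\
    forall p, U p ->
      [/\ a p * \det (f p) * \det (h p) != 0,
          th4 p = a p *: lam' p,
          forall i, tnth [tuple th1; th2; th3] i p
            = b p 0 i *: lam' p + \sum_j f p i j *: nu' j p &
          forall i, tnth [tuple Om3; Om2] i p
            = c p 0 i *: lam' p + \sum_j h p i j *: mu' j p].

(* The representative L is defined on all of Sigma, so that C is its class. *)
Definition originates_from_flat_CR_on (U : set P) : Prop :=
  exists (Sigma : manifold R 6) (C : set (CRcoframe Sigma))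
         (L : CRcoframe Sigma) (q : P -> Sigma),
    [/\ para_CR_structure C, flat_CR C, C L /\ CRdom L = setT,
        fibred_over U q & lifted_from U q L].

End Coframe11.

(* Main.v *)
From HB Require Import structures.
Require Import Defs.
From mathcomp Require Import all_boot all_order all_algebra.
From mathcomp Require Import all_classical all_reals all_analysis.
From mathcomp Require Import ring lra.

Set Implicit Arguments.
Unset Strict Implicit.
Unset Printing Implicit Defensive.

Import Order.TTheory GRing.Theory Num.Theory numFieldNormedType.Exports.

Local Open Scope classical_set_scope.
Local Open Scope ring_scope.


(** The structure equations are the Maurer-Cartan equations of the 11-dimensional
    group of motions x |-> g x + y of R^4, with g in CO(2,2). Put the connection
    Gamma and the forms theta in the matrix of 1-forms om with the blocks
    (Gamma, theta) over (0, 0); then the equations say d om + om /\ om = 0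
    ([motion_form_flat]). Such a form has a local primitive, a matrix function
    with dg = g om ([flat_connection], [flat_form_primitive]), whose blocks C and
    y satisfy dC = C Gamma and dy = C theta. As Gamma is conformal for the metric
    eta, C eta C^T stays proportional to eta, so that C is in CO(2,2)
    ([motion_frame]).

    The map (C, y) into the group of motions is a local diffeomorphism, because
    the eleven forms are a coframe. The group of motions is a principal bundle
    over the space of translations y, on which CO(2,2) acts by right
    multiplication of C ([motions_principal]). Under the map (C, y), the fibres
    are dy = 0, that is theta = 0, and Gamma = C^-1 dC is the form that recovers
    the generators of the action ([motion_frame_bundle]).

    For the para-CR manifold, let D = C^-1, so that theta = D dy. The last row of
    D is a null vector of eta, hence a multiple of (s0, s1, - s0 s1, 1), where the
    slopes s0 and s1 are the coordinates of the corresponding null direction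
    ([null_row]). Therefore theta^4 is a multiple of the contact form
      dy_4 + s0 dy_1 + s1 dy_2 - s0 s1 dy_3,
    which is the form lambda of the flat model in the coordinates
    (x, y, a0, a1, a2, a3) = (s0, s1, y_4, y_1, y_2, - y_3). The other theta^i are
    combinations of the dy_j; and dD = - Gamma D shows that the differentials of
    the slopes are combinations of Omega_2 and Omega_3. These six functions have
    independent differentials, so that they map a neighbourhood onto an open
    subset of R^6, on which the flat model has the required lift
    ([motion_frame_CR]).

    The analysis rests on four tools: the symmetry of second derivatives
    ([schwarz]), which makes the exterior derivative independent of the chart
    ([dcoefs_transition]); the inverse function theorem ([inverse_function]),
    from a contraction; linear differential equations, by Picard iteration
    ([linear_ode]), which give the primitive along rays; and smooth structures on
    embedded submanifolds ([submanifold]), which are applied to the group of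
    motions with the charts given by the Cayley transform ([cayley_slice]). *)

(** * Calculus of C^k maps *)

(** Completeness of the spaces of matrices, for Banach's fixed point theorem. *)
HB.instance Definition _ (K : realType) (a b : nat) := Complete.on (matrix K a b).

Lemma cvg_shift0 {R : realType} {V : normedModType R} (x : V) :
  h + x @[h --> (0 : V)] --> x.
Proof.
by rewrite -[X in _ --> X]add0r; apply: cvgD; [exact: cvg_id|exact: cvg_cst].
Qed.

Section DifferentialEstimates.
Context {R : realType} {V W : normedModType R}.

Lemma diff_near_le (f : V -> W) x : differentiable f x -> forall e, 0 < e ->
  \forall h \near (0 : V), `|f (h + x) - f x - 'd f x h| <= e * `|h|.
Proof.
move=> fx e e0; have [_ /eqaddoP/(_ e e0)] := (diff_locallyP x f).1 fx.
by apply: filterS => h; rewrite /= !fctE /= opprD addrA.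
Qed.

Lemma diff_near_intro (f : V -> W) (df : {linear V -> W}) x :
  continuous df ->
  (forall e, 0 < e ->
    \forall h \near (0 : V), `|f (h + x) - f x - df h| <= e * `|h|) ->
  differentiable f x /\ 'd f x = df :> (V -> W).
Proof.
move=> dfc fE; have ffE : f \o shift x = cst (f x) + df +o_ 0 id.
  apply/eqaddoP => e e0; apply: filterS (fE e e0) => h.
  by rewrite /= !fctE /= opprD addrA.
have dE : 'd f x = df :> (V -> W) by exact: diff_unique.
by split=> //; apply/diff_locallyP; rewrite dE.
Qed.

Lemma near_eq_diff (f g : V -> W) x : (\near x, f x = g x) ->
  differentiable f x -> differentiable g x /\ 'd g x = 'd f x :> (V -> W).
Proof.
move=> fg fx; apply: diff_near_intro; first exact: diff_continuous.
move=> e e0; have fgx := nbhs_singleton fg.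
have fg0 : \forall h \near (0 : V), f (h + x) = g (h + x).
  exact: cvg_shift0 fg.
apply: filterS2 (diff_near_le fx e0) fg0 => h.
by rewrite fgx => + <-.
Qed.

End DifferentialEstimates.

Section Coordinates.
Context {R : realType}.

Lemma mx_norm_le m n (A : 'M[R]_(m, n)) e : 0 <= e ->
  (`|A| <= e) <-> (forall i j, `|A i j| <= e).
Proof.
move=> e0; rewrite /Num.Def.normr /= mx_normrE; split.
  by move=> Ae i j; apply: le_trans Ae; exact: (le_bigmax _ _ (i, j)).
by move=> Ae; apply: bigmax_le => // -[i j] _; exact: Ae.
Qed.

Lemma mx_entry_le m n (A : 'M[R]_(m, n)) i j : `|A i j| <= `|A|.
Proof. exact: ((mx_norm_le A (normr_ge0 A)).1 (lexx _)). Qed.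

Lemma cvg_mx {T} (F : set_system T) {FF : Filter F} m n (f : T -> 'M[R]_(m, n)) (M : 'M[R]_(m, n)) :
  (forall i j, (fun x => f x i j) @ F --> M i j) -> f @ F --> M.
Proof.
move=> fM; apply/cvgrPdist_le => e e0; near=> x.
apply/mx_norm_le; first exact: ltW.
suff H : forall ij : 'I_m * 'I_n, `|M ij.1 ij.2 - f x ij.1 ij.2| <= e.
  by move=> i j; rewrite !mxE; exact: (H (i, j)).
near: x; apply: filter_forall => -[i j] /=.
exact: ((cvgrPdist_le _ _).1 (fM i j)).
Unshelve. all: by end_near. Qed.

Lemma continuous_mx {T : topologicalType} m n (f : T -> 'M[R]_(m, n)) x :
  {for x, continuous f} <-> forall i j, {for x, continuous (fun y => f y i j)}.
Proof.
split=> [fx i j|fx]; last exact: cvg_mx.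
by apply: (@continuous_comp _ _ _ f (fun A => A i j)) => //; exact: coord_continuous.
Qed.

Lemma continuous_mulmx {T : topologicalType} m n p (f : T -> 'M[R]_(m, n))
    (g : T -> 'M[R]_(n, p)) x : {for x, continuous f} -> {for x, continuous g} ->
  {for x, continuous (fun y => f y *m g y)}.
Proof.
move=> /continuous_mx fx /continuous_mx gx; apply/continuous_mx => i j.
rewrite [X in prop_for _ (inPhantom (continuous X))](_ : _ = fun y => \sum_k f y i k * g y k j).
  apply: cvg_big => [|k _]; first exact: add_continuous.
  by apply: cvgM; [exact: fx|exact: gx].
by apply/funext => y; rewrite mxE.
Qed.

Lemma differentiable_mx {V : normedModType R} m n (f : V -> 'M[R]_(m, n)) x :
  differentiable f x <-> forall i j, differentiable (fun y => f y i j) x.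
Proof.
split=> [fx i j|fx].
  by apply: (@differentiable_comp _ _ _ _ f (fun A => A i j)) => //; exact: differentiable_coord.
have -> : f = \sum_i \sum_j (fun y => f y i j *: delta_mx i j).
  apply/funext => y; rewrite [LHS]matrix_sum_delta fct_sumE.
  by apply: eq_bigr => i _; rewrite fct_sumE.
apply: differentiable_sum => i; apply: differentiable_sum => j.
exact: differentiableZl.
Qed.

Lemma derive_entry {V : normedModType R} m n (f : V -> 'M[R]_(m, n)) x v i j :
  derivable f x v -> 'D_v f x i j = 'D_v (fun y => f y i j) x.
Proof. by move=> fx; rewrite derive_mx // mxE. Qed.

Lemma linear_mx_continuous (n : nat) {W : normedModType R} (L : {linear 'rV[R]_n -> W}) :
  continuous L.
Proof.
have -> : (L : _ -> _) = \sum_i (fun u : 'rV_n => u 0 i *: L (delta_mx 0 i)).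
  apply/funext => u; rewrite fct_sumE {1}[u]row_sum_delta linear_sum.
  by apply: eq_bigr => i _; rewrite linearZ.
move=> x; elim/big_ind : _ => [|f g fx gx|i _]; first exact: cst_continuous.
  exact: continuousD.
exact: (cvgZr_tmp (@coord_continuous R 1 n 0 i x)).
Qed.

Lemma diff_coordE (n : nat) {W : normedModType R} (g : 'rV[R]_n -> W) x v :
  differentiable g x -> 'd g x v = \sum_i v 0 i *: 'D_(delta_mx 0 i) g x.
Proof.
move=> gx; rewrite {1}[v]row_sum_delta linear_sum.
by apply: eq_bigr => i _; rewrite linearZ deriveE.
Qed.

Lemma derive_coordE (n : nat) {W : normedModType R} (g : 'rV[R]_n -> W) x v :
  differentiable g x -> 'D_v g x = \sum_i v 0 i *: 'D_(delta_mx 0 i) g x.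
Proof. by move=> gx; rewrite (deriveE _ gx) (diff_coordE _ gx). Qed.

Lemma derive_comp {U V W : normedModType R} (f : U -> V) (g : V -> W) x v :
  differentiable f x -> differentiable g (f x) ->
  'D_v (g \o f) x = 'D_('D_v f x) g (f x).
Proof.
move=> fx gx; rewrite deriveE; last exact: differentiable_comp.
by rewrite diff_comp //= !deriveE.
Qed.

End Coordinates.

Section CkTheory.
Context {R : realType} {V : normedModType R}.
Implicit Types (A : set V) (W : normedModType R).

Lemma Ck_ext W k A (f g : V -> W) : open A ->
  (forall x, A x -> f x = g x) -> Ck k A f -> Ck k A g.
Proof.
move=> oA; elim: k f g => [|k IH] f g fg /=.
  move=> fc x Ax; have := fc x Ax; rewrite /prop_for /continuous_at -fg // => fx.
  apply: cvg_trans fx; apply: near_eq_cvg.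
  by near=> y; rewrite fg //; near: y; exact: open_nbhs_nbhs.
move=> [fd fD]; have nfg x : A x -> \near x, f x = g x.
  by move=> Ax; near=> y; apply: fg; near: y; exact: open_nbhs_nbhs.
split=> [x Ax|v]; first by have [] := near_eq_diff (nfg x Ax) (fd x Ax).
by apply: IH (fD v) => x Ax; apply: near_eq_derive; exact: nfg.
Unshelve. all: by end_near. Qed.

Lemma CkW W k A (f : V -> W) : Ck k.+1 A f -> Ck k A f.
Proof.
elim: k f => [|k IH] f [fd fD].
  by move=> x /fd; exact: differentiable_continuous.
by split=> // v; exact: IH.
Qed.

Lemma Ck_open_preimage W A B (f : V -> W) : open A -> open B -> Ck 0 A f ->
  open (A `&` (f @^-1` B)).
Proof.
move=> oA oB fc; rewrite openE => x [Ax Bx]; rewrite /interior.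
have fB : nbhs (f x) B by exact: open_nbhs_nbhs.
exact: filterI (open_nbhs_nbhs (conj oA Ax)) (fc x Ax _ fB).
Qed.

Lemma Ck_sub W k A B (f : V -> W) : B `<=` A -> Ck k A f -> Ck k B f.
Proof.
move=> BA; elim: k f => [|k IH] f /= => [fc x /BA|[fd fD]]; first exact: fc.
by split=> [x /BA|v]; [exact: fd|exact/IH].
Qed.

Lemma CkD W k A (f g : V -> W) : open A ->
  Ck k A f -> Ck k A g -> Ck k A (fun x => f x + g x).
Proof.
move=> oA; elim: k f g => [|k IH] f g /=.
  by move=> fc gc x Ax; apply: cvgD; [exact: fc|exact: gc].
move=> [fd fD] [gd gD]; split=> [x Ax|v].
  by apply: differentiableD; [exact: fd|exact: gd].
apply: Ck_ext (IH _ _ (fD v) (gD v)) => // x Ax.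
by rewrite -[RHS]/('D_v (f + g) x) deriveD //; apply: diff_derivable; [exact: fd|exact: gd].
Qed.

Lemma Ck_cst W k A (w : W) : Ck k A (fun=> w).
Proof. exact: Csmooth_cst. Qed.

Lemma Ck_sum W k A I (r : seq I) (P : pred I) (f : I -> V -> W) : open A ->
  (forall i, P i -> Ck k A (f i)) -> Ck k A (fun x => \sum_(i <- r | P i) f i x).
Proof.
move=> oA fA; elim: r => [|i r IH].
  by under eq_fun do rewrite big_nil; exact: Ck_cst.
under eq_fun do rewrite big_cons.
by case: (boolP (P i)) => // Pi; apply: CkD => //; exact: fA.
Qed.

Lemma CkM k A (f g : V -> R) : open A ->
  Ck k A f -> Ck k A g -> Ck k A (fun x => f x * g x).
Proof.
move=> oA; elim: k f g => [|k IH] f g.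
  by move=> fc gc x Ax; apply: cvgM; [exact: fc|exact: gc].
move=> fk gk; have [fd fD] := fk; have [gd gD] := gk; split=> [x Ax|v].
  by apply: (@differentiableM _ _ f g); [exact: fd|exact: gd].
apply: (@Ck_ext _ _ _ (fun x => f x * 'D_v g x + g x * 'D_v f x)) => // [x Ax|].
  rewrite -[RHS]/('D_v (f * g) x) deriveM //; apply: diff_derivable.
    exact: fd.
  exact: gd.
by apply: CkD => //; apply: IH => //; first [exact: (CkW fk)|exact: (CkW gk)|exact: gD|exact: fD].
Qed.

Lemma CkN W k A (f : V -> W) : open A -> Ck k A f -> Ck k A (fun x => - f x).
Proof.
move=> oA; elim: k f => [|k IH] f /=.
  by move=> fc x Ax; apply: cvgN; exact: fc.
move=> [fd fD]; split=> [x Ax|v].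
  by apply: differentiableN; exact: fd.
apply: Ck_ext (IH _ (fD v)) => // x Ax.
by rewrite -[RHS]/('D_v (- f) x) deriveN //; apply: diff_derivable; exact: fd.
Qed.

(** The derivative of 1/f is a product of copies of 1/f and of the derivative of
    f, which lowers the order by one. *)
Lemma CkV k A (f : V -> R) : open A -> (forall x, A x -> f x != 0) ->
  Ck k A f -> Ck k A (fun x => (f x)^-1).
Proof.
move=> oA f0; elim: k => [|k IH].
  by move=> fc x Ax; apply: cvgV; [exact: f0|exact: fc].
move=> fk; have [fd fD] := fk; split=> [x Ax|v].
  by apply: differentiableV; [exact: fd|exact: f0].
have Vk : Ck k A (fun x => (f x)^-1) by apply: IH; exact: CkW.
apply: (@Ck_ext _ _ _ (fun x => - ((f x)^-1 * (f x)^-1 * 'D_v f x))) => // [x Ax|].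
  rewrite -[RHS]/('D_v (fun x => (f x)^-1) x) deriveV ?f0//; last first.
    by apply: diff_derivable; exact: fd.
  by rewrite -invfM -expr2 scaleNr.
by apply: CkN => //; apply: CkM => //; [exact: CkM|exact: fD].
Qed.

Lemma Ck_sqrt k A (f : V -> R) : open A -> (forall x, A x -> 0 < f x) ->
  Ck k A f -> Ck k A (fun x => Num.sqrt (f x)).
Proof.
move=> oA f0; have ds x : A x -> differentiable (Num.sqrt : R -> R) (f x).
  by move=> Ax; apply/derivable1_diffP; have [] := is_derive1_sqrt (f0 x Ax).
elim: k => [|k IH].
  move=> fc x Ax; apply: (continuous_comp (fc x Ax)).
  by apply: differentiable_continuous; exact: ds.
move=> fk; have [fd fD] := fk; split=> [x Ax|v].
  by apply: (@differentiable_comp _ _ _ _ f Num.sqrt); [exact: fd|exact: ds].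
have sk : Ck k A (fun x => Num.sqrt (f x)) by apply: IH; exact: CkW.
apply: (@Ck_ext _ _ _ (fun x => (2 * Num.sqrt (f x))^-1 * 'D_v f x)) => // [x Ax|].
  rewrite -[RHS]/('D_v (Num.sqrt \o f) x) (derive_comp _ (fd x Ax) (ds x Ax)).
  have -> : 'D_('D_v f x) (Num.sqrt : R -> R) (f x) =
      'D_v f x *: 'D_1 (Num.sqrt : R -> R) (f x).
    by rewrite !(deriveE _ (ds x Ax)) -linearZ /= [_ *: 1]mulr1.
  have -> := @derive_val _ _ _ _ _ _ _ (is_derive1_sqrt (f0 x Ax)).
  by rewrite [RHS]mulrC.
apply: CkM => //; last exact: fD.
apply: CkV => //; last by apply: CkM => //; exact: Ck_cst.
by move=> x Ax; rewrite mulf_neq0 // gt_eqF // sqrtr_gt0; exact: f0.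
Qed.

Lemma Ck_mx m n k A (f : V -> 'M[R]_(m, n)) : open A ->
  Ck k A f <-> forall i j, Ck k A (fun x => f x i j).
Proof.
move=> oA; elim: k f => [|k IH] f /=.
  split=> [fA i j x Ax|fA x Ax]; last by apply/continuous_mx => i j; exact: fA.
  by have /continuous_mx := fA x Ax; exact.
have fD v : (forall x, A x -> differentiable f x) ->
    Ck k A ('D_v f) <-> forall i j, Ck k A ('D_v (fun x => f x i j)).
  move=> fd; apply: iff_trans (IH _) _; split=> fA i j; apply: Ck_ext (fA i j) => // x Ax;
    by rewrite derive_entry //; apply: diff_derivable; exact: fd.
split=> [[fd fA] i j|fA].
  split=> [x Ax|v]; first by have /differentiable_mx := fd x Ax; exact.
  by apply: (fD v fd).1 => //; exact: fA.
have fd x : A x -> differentiable f x.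
  by move=> Ax; apply/differentiable_mx => i j; have [+ _] := fA i j; exact.
by split=> // v; apply/(fD v fd) => i j; have [_ +] := fA i j; exact.
Qed.

Lemma Ck_mulmx m n p k A (f : V -> 'M[R]_(m, n)) (g : V -> 'M[R]_(n, p)) : open A ->
  Ck k A f -> Ck k A g -> Ck k A (fun x => f x *m g x).
Proof.
move=> oA /(Ck_mx _ _ oA) fA /(Ck_mx _ _ oA) gA; apply/Ck_mx => // i j.
under eq_fun do rewrite mxE.
by apply: Ck_sum => // l _; exact: CkM.
Qed.

Lemma Ck_scale m n k A (a : V -> R) (f : V -> 'M[R]_(m, n)) : open A ->
  Ck k A a -> Ck k A f -> Ck k A (fun x => a x *: f x).
Proof.
move=> oA aA /(Ck_mx _ _ oA) fA; apply/Ck_mx => // i j.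
by under eq_fun do rewrite mxE; exact: CkM.
Qed.

Lemma Ck_trmx m n k A (f : V -> 'M[R]_(m, n)) : open A ->
  Ck k A f -> Ck k A (fun x => (f x)^T).
Proof.
move=> oA /(Ck_mx _ _ oA) fA; apply/Ck_mx => // i j.
by under eq_fun do rewrite mxE; exact: fA.
Qed.

Lemma Ck_prod k A I (r : seq I) (P : pred I) (f : I -> V -> R) : open A ->
  (forall i, P i -> Ck k A (f i)) -> Ck k A (fun x => \prod_(i <- r | P i) f i x).
Proof.
move=> oA fA; elim: r => [|i r IH].
  by under eq_fun do rewrite big_nil; exact: Ck_cst.
under eq_fun do rewrite big_cons.
by case: (boolP (P i)) => // Pi; apply: CkM => //; exact: fA.
Qed.

Lemma Ck_det n k A (f : V -> 'M[R]_n) : open A ->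
  Ck k A f -> Ck k A (fun x => \det (f x)).
Proof.
move=> oA /(Ck_mx _ _ oA) fA; apply: Ck_sum => // s _.
by apply: CkM => //; [exact: Ck_cst|exact: Ck_prod].
Qed.

(** Cramer's rule: the inverse is rational in the entries. *)
Lemma Ck_invmx n k A (f : V -> 'M[R]_n) : open A ->
  (forall x, A x -> f x \in unitmx) ->
  Ck k A f -> Ck k A (fun x => invmx (f x)).
Proof.
move=> oA fu fA; apply: (@Ck_ext _ _ _ (fun x => (\det (f x))^-1 *: \adj (f x))) => //.
  by move=> x /fu fx; rewrite /invmx fx.
apply: Ck_scale => //; first apply: CkV => //.
- by move=> x /fu; rewrite unitmxE unitfE.
- exact: Ck_det.
apply/Ck_mx => // i j; under eq_fun do rewrite mxE.
apply: CkM => //; first exact: Ck_cst.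
apply: Ck_det => //; apply/Ck_mx => // a b; under eq_fun do rewrite !mxE.
by move/(Ck_mx _ _ oA) : fA; exact.
Qed.

End CkTheory.

Section CkComp.
Context {R : realType} {V : normedModType R} {n : nat}.

(** In coordinates the chain rule writes the derivative of the composite as a sum
    of products of functions of one order less. *)
Lemma Ck_comp_real k (A : set V) (B : set 'rV[R]_n) (f : V -> 'rV[R]_n) (g : 'rV[R]_n -> R) :
  open A -> (forall x, A x -> B (f x)) -> Ck k A f -> Ck k B g -> Ck k A (g \o f).
Proof.
move=> oA AB; elim: k g => [|k IH] g.
  by move=> fc gc x Ax; apply: continuous_comp; [exact: fc|apply: gc; exact: AB].
move=> fk [gd gD]; have fk' := CkW fk; have [fd fD] := fk; split=> [x Ax|v].
  by apply: differentiable_comp; [exact: fd|apply: gd; exact: AB].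
apply: (@Ck_ext _ _ _ _ _ (fun x => \sum_i ('D_v f x) 0 i *
    ('D_(delta_mx 0 i) g \o f) x)) => // [x Ax|].
  have fx := fd x Ax; have gx := gd _ (AB x Ax).
  by rewrite [RHS](derive_comp v fx gx) (deriveE _ gx) (diff_coordE _ gx).
apply: Ck_sum => // i _; apply: CkM => //; last exact: (IH _ fk' (gD _)).
by move: (fD v) => /(Ck_mx _ _ oA); exact.
Qed.

Lemma Ck_comp m p k (A : set V) (B : set 'rV[R]_n) (f : V -> 'rV[R]_n)
    (g : 'rV[R]_n -> 'M[R]_(m, p)) :
  open A -> open B -> (forall x, A x -> B (f x)) ->
  Ck k A f -> Ck k B g -> Ck k A (g \o f).
Proof.
move=> oA oB AB fk /(Ck_mx _ _ oB) gk; apply/Ck_mx => // i j.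
exact: (Ck_comp_real oA AB fk (gk i j)).
Qed.

End CkComp.

(** * Mean value estimates and the symmetry of second derivatives *)

Section MeanValue.
Context {R : realType}.

Lemma mulmx_norm_le m n p (A : 'M[R]_(m, n)) (B : 'M[R]_(n, p)) :
  `|A *m B| <= n%:R * (`|A| * `|B|).
Proof.
apply/mx_norm_le => [|i j]; first by rewrite !mulr_ge0.
rewrite mxE; apply: le_trans (ler_norm_sum _ _ _) _.
rewrite -[n in n%:R]card_ord mulr_natl -sumr_const; apply: ler_sum => l _.
by rewrite normrM ler_pM ?mx_entry_le.
Qed.

(** The norm of a matrix is its largest entry, so the real mean value theorem can
    be used entry by entry. *)
Lemma mean_value_le m n (f df : R -> 'M[R]_(m, n)) (a b K : R) : a < b ->
  (forall t, t \in `]a, b[ -> is_derive t 1 f (df t)) ->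
  (forall t, t \in `[a, b] -> {for t, continuous f}) ->
  (forall t, t \in `]a, b[ -> `|df t| <= K) ->
  `|f b - f a| <= K * (b - a).
Proof.
move=> ab fd fc dfK.
have K0 : 0 <= K.
  apply: le_trans (dfK ((a + b) / 2) _) => //.
  by rewrite in_itv /= !midf_lt.
have ba0 : 0 <= b - a by rewrite subr_ge0 ltW.
apply/mx_norm_le => [|i j]; first exact: mulr_ge0.
have [||c cab fE] := @MVT R (fun t => f t i j) (fun t => df t i j) a b ab.
- move=> t /fd [ft fE].
  split; first by move/derivable_mxP : ft; exact.
  by rewrite -derive_entry // fE.
- apply: continuous_in_subspaceT => t /set_mem /= tab.
  by have /continuous_mx := fc t tab; exact.
rewrite !mxE fE normrM (ger0_norm ba0) ler_wpM2r //.
exact: le_trans (mx_entry_le _ _ _) (dfK c cab).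
Qed.

Lemma is_derive_line {V W : normedModType R} (g : V -> W) x v (t : R) :
  differentiable g (x + t *: v) ->
  is_derive t 1 (fun t => g (x + t *: v)) ('D_v g (x + t *: v)).
Proof.
move=> gx; pose l (t : R) := x + t *: v.
have [lt lE] : is_derive t 1 l v.
  have : is_derive t (1 : R) (fun t : R => t *: v) (1 *: v).
    have [d1 d2] := is_diff_scalel t v.
    by apply: DeriveDef; [exact: diff_derivable|rewrite deriveE // d2].
  rewrite scale1r -[X in is_derive _ _ l X]add0r => ?; exact: is_deriveD.
have dl : differentiable l t by exact/derivable1_diffP.
split; first by apply: diff_derivable; exact: (@differentiable_comp _ _ _ _ l g).
by rewrite -[LHS]/('D_1 (g \o l) t) derive_comp // lE.
Qed.

Lemma mean_value_segment_le m n p (g : 'rV[R]_p -> 'M[R]_(m, n)) x v K :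
  (forall t : R, t \in `[0, 1] -> differentiable g (x + t *: v)) ->
  (forall t : R, t \in `[0, 1] -> `|'D_v g (x + t *: v)| <= K) ->
  `|g (x + v) - g x| <= K.
Proof.
move=> gd gK.
suff : `|g (x + (1 : R) *: v) - g (x + (0 : R) *: v)| <= K * (1 - 0).
  by rewrite scale1r scale0r addr0 subr0 mulr1.
apply: (mean_value_le (f := fun t : R => g (x + t *: v)) ltr01).
- move=> t tI; apply: is_derive_line; apply: gd.
  exact: subset_itv_oo_cc tI.
- move=> t tI; apply: differentiable_continuous.
  by apply/derivable1_diffP; have [] := is_derive_line (gd t tI).
- by move=> t tI; apply: gK; exact: subset_itv_oo_cc tI.
Qed.

Lemma ball_segment m (x0 p q : 'rV[R]_m) r (t : R) : ball x0 r p -> ball x0 r (p + q) ->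
  t \in `[0, 1] -> ball x0 r (p + t *: q).
Proof.
rewrite -ball_normE /= => pr qr; rewrite in_itv /= => /andP[t0 t1].
have -> : x0 - (p + t *: q) = (1 - t) *: (x0 - p) + t *: (x0 - (p + q)).
  by apply/rowP => j; rewrite !mxE; ring.
apply: le_lt_trans (ler_normD _ _) _; rewrite !normrZ !ger0_norm ?subr_ge0 //.
have [->|tn] := eqVneq t 0; first by rewrite subr0 mul1r mul0r addr0.
have tp : 0 < t by rewrite lt_def tn.
have -> : r = (1 - t) * r + t * r by rewrite -mulrDl subrK mul1r.
by rewrite ler_ltD ?ltr_pM2l // ler_wpM2l ?subr_ge0 // ltW.
Qed.

End MeanValue.

Section Schwarz.
Context {R : realType} {V : normedModType R}.

(** The mean value theorem is applied first to the difference in the direction v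
    as a function along u, and then along v. *)
Lemma second_difference (f : V -> R) x u v (h : R) : 0 < h ->
  (forall s t : R, s \in `[0, h] -> t \in `[0, h] ->
    differentiable f (x + s *: u + t *: v) /\
    differentiable ('D_u f) (x + s *: u + t *: v)) ->
  exists s t, [/\ s \in `[0, h], t \in `[0, h] &
    f (x + h *: u + h *: v) - f (x + h *: u) - f (x + h *: v) + f x =
    h ^+ 2 * 'D_v ('D_u f) (x + s *: u + t *: v)].
Proof.
move=> h0 fd.
have h0I : 0 \in `[0, h] by rewrite in_itv /= lexx ltW.
have hhI : h \in `[0, h] by rewrite in_itv /= lexx ltW.
pose phi s := f (x + h *: v + s *: u) - f (x + s *: u).
pose dphi s := 'D_u f (x + h *: v + s *: u) - 'D_u f (x + s *: u).
have phid s : s \in `[0, h] -> is_derive s 1 phi (dphi s).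
  move=> sI; apply: is_deriveB; apply: is_derive_line.
    by rewrite addrAC; have [] := fd s h sI hhI.
  by have [+ _] := fd s 0 sI h0I; rewrite scale0r addr0.
have [|s sI] := MVT h0 (fun s sI => phid s (subset_itv_oo_cc sI)).
  apply: continuous_in_subspaceT => s /set_mem /= /phid[sd _].
  by apply: differentiable_continuous; exact/derivable1_diffP.
rewrite subr0 {1 2}/phi scale0r !addr0 => phiE.
pose psi t := 'D_u f (x + s *: u + t *: v).
have psid t : t \in `[0, h] -> is_derive t 1 psi ('D_v ('D_u f) (x + s *: u + t *: v)).
  by move=> tI; apply: is_derive_line; have [] := fd s t (subset_itv_oo_cc sI) tI.
have [|t tI] := MVT h0 (fun t tI => psid t (subset_itv_oo_cc tI)).
  apply: continuous_in_subspaceT => t /set_mem /= /psid[td _].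
  by apply: differentiable_continuous; exact/derivable1_diffP.
rewrite subr0 {1 2}/psi scale0r addr0 => psiE.
exists s, t; split; [exact: subset_itv_oo_cc|exact: subset_itv_oo_cc|].
rewrite expr2 -mulrA [h * (h * _)]mulrC [h * _]mulrC -psiE.
rewrite -[x + s *: u + h *: v]addrAC -/(dphi s) -phiE.
rewrite [x + h *: u + _]addrAC opprD opprK !addrA.
by rewrite -!addrA; congr (_ + _); rewrite [f x - _]addrC.
Qed.

(** Both mixed derivatives are limits of the same second difference
    quotient, by two applications of the mean value theorem. *)
Lemma schwarz (f : V -> R) (A : set V) x u v : open A -> A x -> Ck 2 A f ->
  'D_u ('D_v f) x = 'D_v ('D_u f) x.
Proof.
move=> oA Ax [fd fD]; apply/eqP; rewrite -subr_eq0; apply/negP => /negP ne0.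
pose e := `|'D_u ('D_v f) x - 'D_v ('D_u f) x| / 2.
have e0 : 0 < e by rewrite divr_gt0 // normr_gt0.
have near_x w w' : \forall z \near x, A z /\
    `|'D_w ('D_w' f) x - 'D_w ('D_w' f) z| < e.
  have [_ /(_ w) fc] := fD w'; have := fc x Ax.
  move=> /cvgrPdist_lt/(_ e e0) => H; near=> z; split; last by near: z.
  by near: z; exact: open_nbhs_nbhs.
have [d /= d0 dP] := (nbhs_ballP _ _).1 (filterI (near_x u v) (near_x v u)).
pose h := d / (2 * (`|u| + `|v| + 1)).
have N0 : 0 < `|u| + `|v| + 1 by rewrite ltr_wpDl // addr_ge0.
have h0 : 0 < h by rewrite divr_gt0 // mulr_gt0.
have inB s t : s \in `[0, h] -> t \in `[0, h] -> ball x d (x + s *: u + t *: v).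
  rewrite !in_itv /= => /andP[s0 sh] /andP[t0 th].
  rewrite -ball_normE /= -addrA opprD addrA subrr add0r normrN.
  apply: le_lt_trans (ler_normD _ _) _; rewrite !normrZ !ger0_norm //.
  apply: (@le_lt_trans _ _ (h * (`|u| + `|v| + 1))).
    rewrite -addrA mulrDr mulrDr addrA; apply: (@le_trans _ _ (h * `|u| + h * `|v|)).
      by rewrite lerD // ler_wpM2r.
    by rewrite lerDl mulr1 ltW.
  rewrite /h invfM mulrA -mulrA mulVf ?gt_eqF // mulr1.
  by rewrite ltr_pdivrMr // ltr_pMr // ltr1n.
have fdiff w z : ball x d z -> differentiable f z /\ differentiable ('D_w f) z.
  move=> /dP[[Az _] _]; split; first exact: fd.
  by have [+ _] := fD w; exact.
have [|s [t [sI tI uvE]]] := @second_difference f x u v h h0.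
  by move=> s t sI tI; apply: fdiff; exact: inB.
have [|t' [s' [tI' sI' vuE]]] := @second_difference f x v u h h0.
  by move=> t' s' tI' sI'; apply: fdiff; rewrite addrAC; exact: inB.
have E : 'D_v ('D_u f) (x + s *: u + t *: v) = 'D_u ('D_v f) (x + t' *: v + s' *: u).
  have h2 : h ^+ 2 != 0 by rewrite expf_neq0 // gt_eqF.
  apply: (mulfI h2); apply: etrans (esym uvE) (etrans _ vuE).
  have -> : x + h *: v + h *: u = x + h *: u + h *: v by exact: addrAC.
  set a := f (x + h *: u + h *: v); set b := f (x + h *: u); set c := f (x + h *: v).
  by rewrite (addrAC a).
have [_ [_ E1]] := dP _ (inB _ _ sI tI).
have := inB _ _ sI' tI'; rewrite addrAC => /dP [[_ E2] _].
move: E1 E2; rewrite -E /e /=.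
move: ('D_u ('D_v f) x) ('D_v ('D_u f) x) ('D_v _ _) => p q r; rewrite distrC => rq pr.
have := lt_le_trans (ltrD pr rq) (lexx _); rewrite -splitr ltNge => /negP; apply.
exact: ler_distD.
Unshelve. all: by end_near. Qed.

End Schwarz.

(** * The inverse function theorem *)

Section Jacobian.
Context {R : realType}.

Lemma jacobian_entry m n (f : 'rV[R]_m -> 'rV[R]_n) x i j : differentiable f x ->
  ('J f x) i j = ('D_(delta_mx 0 i) f x) 0 j.
Proof. by move=> fx; rewrite deriveEjacobian // -rowE [RHS]mxE. Qed.

Lemma Ck_jacobian k m n (A : set 'rV[R]_m) (f : 'rV[R]_m -> 'rV[R]_n) : open A ->
  Ck k.+1 A f -> Ck k A (jacobian f).
Proof.
move=> oA [fd fD]; apply/Ck_mx => // i j.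
apply: (@Ck_ext _ _ _ _ _ (fun x => ('D_(delta_mx 0 i) f x) 0 j)) => // [x Ax|].
  by rewrite jacobian_entry //; exact: fd.
by move: (fD (delta_mx 0 i)) => /(Ck_mx _ _ oA); exact.
Qed.

Lemma jacobian_unique m n (f : 'rV[R]_m -> 'rV[R]_n) x A : differentiable f x ->
  (forall v, 'D_v f x = v *m A) -> 'J f x = A.
Proof.
move=> fx fA; have rowsE i : (delta_mx 0 i : 'rV_m) *m 'J f x = delta_mx 0 i *m A.
  exact: etrans (esym (deriveEjacobian _ fx)) (fA _).
by apply/row_matrixP => i; apply: etrans (rowE _ _) (etrans (rowsE i) (esym (rowE _ _))).
Qed.

Lemma jacobian_comp m n p (f : 'rV[R]_m -> 'rV[R]_n) (g : 'rV[R]_n -> 'rV[R]_p) x :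
  differentiable f x -> differentiable g (f x) ->
  'J (g \o f) x = 'J f x *m 'J g (f x).
Proof.
move=> fx gx; apply: jacobian_unique; first exact: differentiable_comp.
move=> v; rewrite (derive_comp v fx gx) (deriveEjacobian _ fx) mulmxA.
exact: deriveEjacobian.
Qed.

Lemma jacobian_id n (x : 'rV[R]_n) : 'J id x = 1%:M.
Proof. by apply: jacobian_unique => // v; rewrite mulmx1 derive_id. Qed.

Lemma near_eq_jacobian m n (f g : 'rV[R]_m -> 'rV[R]_n) x :
  (\near x, f x = g x) -> differentiable f x -> 'J g x = 'J f x.
Proof.
move=> fg fx; have [gx _] := near_eq_diff fg fx.
apply: jacobian_unique => // v.
by rewrite -(near_eq_derive v fg); exact: deriveEjacobian.
Qed.

End Jacobian.

Section InverseFunction.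
Context {R : realType} {n : nat}.
Local Notation E := 'rV[R]_n.

(** The derivative of F - id vanishes at x0 and is continuous, so it is small near
    x0; the mean value theorem turns this into a Lipschitz bound. *)
Lemma near_identity_contraction (F : E -> E) (A : set E) x0 :
  open A -> A x0 -> Ck 1 A F -> (forall v, 'D_v F x0 = v) ->
  exists2 r : R, 0 < r & ball x0 r `<=` A /\
    forall x y, ball x0 r x -> ball x0 r y ->
      `|(F x - x) - (F y - y)| <= 2^-1 * `|x - y|.
Proof.
move=> oA Ax0 [Fd FD] Fx0.
(* n partial derivatives, each off by at most e, add up to at most 1/2 *)
pose e : R := (2 * n.+1%:R)^-1.
have e0 : 0 < e by rewrite invr_gt0 mulr_gt0 // ltr0n.
have near_e i : \forall x \near x0,
    `|'D_(delta_mx 0 i) F x0 - 'D_(delta_mx 0 i) F x| < e.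
  exact: ((cvgrPdist_lt _ _).1 (FD (delta_mx 0 i) x0 Ax0)).
have [r /= r0 rP] : nbhs_ball x0 (fun x => A x /\
    forall i, `|'D_(delta_mx 0 i) F x0 - 'D_(delta_mx 0 i) F x| < e).
  apply/nbhs_ballP; apply: filterI; first exact: open_nbhs_nbhs.
  by near=> x; near: x; apply: filter_forall => i; exact: near_e.
exists r => //; split=> [x /rP[]//|x y xr yr].
pose G z := F z - z.
have seg (t : R) : t \in `[0, 1] -> ball x0 r (y + t *: (x - y)).
  by apply: ball_segment => //; rewrite addrC subrK.
have Gd t : t \in `[0, 1] -> differentiable G (y + t *: (x - y)).
  by move=> /seg /rP[Az _]; apply: differentiableB => //; exact: Fd.
have := @mean_value_segment_le _ _ _ _ G y (x - y) (2^-1 * `|x - y|) Gd.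
rewrite [y + _]addrC subrK; apply=> t tI.
have [Az zP] := rP _ (seg t tI); set z := y + _ in Az zP *.
set v := x - y; have Fz := Fd z Az.
rewrite deriveB; [|exact: diff_derivable|exact: derivable_id].
rewrite derive_id deriveE // diff_coordE // {2}[v]row_sum_delta -sumrB.
apply: le_trans (ler_norm_sum _ _ _) _.
apply: (@le_trans _ _ (\sum_(i < n) (`|v| * e))).
  apply: ler_sum => i _; rewrite -scalerBr normrZ ler_pM ?mx_entry_le//.
  by rewrite -[X in _ - X]Fx0 distrC ltW.
rewrite sumr_const card_ord -/v -[_ *+ n]mulr_natl mulrCA mulrC ler_wpM2r //.
rewrite /e invfM mulrCA ler_piMr // ler_pdivrMr ?ltr0n//.
by rewrite mul1r ler_nat.
Unshelve. all: by end_near.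
Qed.

(** F z = y is the fixed point equation of z |-> z - F z + y, which is a
    contraction. *)
Lemma near_identity_open (F : E -> E) (x0 : E) (r : R) : 0 < r ->
  (forall x y, ball x0 r x -> ball x0 r y ->
      `|(F x - x) - (F y - y)| <= 2^-1 * `|x - y|) ->
  open (F @` ball x0 r).
Proof.
move=> r0 FP; rewrite openE => _ [x xr <-].
have [d /= d0 dP] := (nbhs_ballP _ _).1 (open_nbhs_nbhs (conj (ball_open x0 r) xr)).
pose rho := d / 2; have rho0 : 0 < rho by rewrite divr_gt0.
pose K := closed_ball x rho.
have KE z : K z <-> `|x - z| <= rho by rewrite /K closed_ballE.
have Kr : K `<=` ball x0 r.
  move=> z /KE zr; apply: dP; rewrite -ball_normE /=.
  by rewrite (le_lt_trans zr) // /rho ltr_pdivrMr // mulr_natr mulr2n ltrDl.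
have Kx : K x by apply/KE; rewrite subrr normr0 ltW.
apply/nbhs_ballP; exists (rho / 2) => /=; first by rewrite divr_gt0.
move=> y; rewrite -ball_normE /= => yF.
pose T z := z - F z + y.
have TK : {homo T : z / K z >-> K z}.
  move=> z Kz; apply/KE.
  have -> : x - T z = (F z - z - (F x - x)) + (F x - y).
    by apply/rowP => j; rewrite !mxE; ring.
  apply: le_trans (ler_normD _ _) _.
  rewrite (splitr rho) lerD //; last exact: ltW.
  apply: le_trans (FP _ _ (Kr _ Kz) (Kr _ Kx)) _.
  by rewrite mulrC ler_wpM2r // distrC; exact/KE.
pose Tf := mkfun_fun TK.
have [|||z Kz zE] := @banach_fixed_point R E K Tf.
- exists (2^-1)%:nng; split; first by rewrite /= invf_lt1 // ltr1n.
  move=> [a b] [/= Ka Kb].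
  have -> : T a - T b = - ((F a - a) - (F b - b)).
    by apply/rowP => j; rewrite !mxE; ring.
  by rewrite normrN; apply: FP; exact: Kr.
- exact: closed_ball_closed.
- by exists x.
exists z; first by have := Kr z Kz; rewrite -ball_normE.
have Tz : z - F z + y = z by rewrite [RHS]zE.
by apply/rowP => j; move/rowP/(_ j) : Tz; rewrite !mxE => Tz; lra.
Qed.

End InverseFunction.

Section InverseFunctionTheorem.
Context {R : realType} {n : nat}.
Local Notation E := 'rV[R]_n.

(** The inverse of a smooth map is as smooth as its derivative, which is the
   inverse of the Jacobian matrix composed with the inverse map itself. *)
Lemma inverse_smooth (f g : E -> E) (U W : set E) : open U -> open W ->
  Csmooth U f -> (forall y, W y -> U (g y)) ->
  (forall x, U x -> 'J f x \in unitmx) ->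
  (forall y, W y -> differentiable g y /\
     forall v, 'D_v g y = v *m invmx ('J f (g y))) ->
  Csmooth W g.
Proof.
move=> oU oW fU gU Ju gD; elim=> [|k IH].
  by move=> y /gD[gy _]; exact: differentiable_continuous.
split=> [y /gD[]//|v].
apply: (@Ck_ext _ _ _ _ _ (fun y => v *m invmx (jacobian f (g y)))) => // [y /gD[_ ->]//|].
apply: Ck_mulmx => //; first exact: Ck_cst.
apply: Ck_invmx => //; first by move=> y /gU /Ju.
apply: (@Ck_comp _ _ _ _ _ _ _ U g (jacobian f)) => //.
exact: Ck_jacobian (fU k.+1).
Qed.

(** Composed with the inverse of its Jacobian matrix at x0, the map is close to
    the identity; it is then injective and open on a ball, with a Lipschitz
    inverse. The Lipschitz bound also shows that the Jacobian matrix stays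
    invertible on the ball and that the inverse is differentiable there. *)
Theorem inverse_function (f : E -> E) (A : set E) x0 :
  open A -> A x0 -> Csmooth A f -> (forall v, 'D_v f x0 = 0 -> v = 0) ->
  exists (U : set E) (g : E -> E),
    [/\ open U, U x0, U `<=` A, forall x, U x -> g (f x) = x & Csmooth (f @` U) g] /\
    forall B, open B -> B `<=` U -> open (f @` B).
Proof.
move=> oA Ax0 fA f0; have fd x : A x -> differentiable f x.
  by move=> Ax; have [+ _] := fA 1%N; exact.
have unit_inj x : A x -> (forall v, 'D_v f x = 0 -> v = 0) -> 'J f x \in unitmx.
  move=> Ax fx; rewrite -row_free_unit -kermx_eq0; apply/eqP/row_matrixP => i.
  apply: etrans (esym (row0 _ _ _)); apply: fx.
  rewrite (deriveEjacobian _ (fd x Ax)); apply/sub_kermxP; exact: row_sub.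
have Ju := unit_inj x0 Ax0 f0; pose M := invmx ('J f x0).
pose F x := f x *m M.
have FD x v : A x -> differentiable F x /\ 'D_v F x = 'D_v f x *m M.
  move=> Ax; have dM y : differentiable (mulmxr M : E -> E) y.
    by apply: linear_differentiable; exact: linear_mx_continuous.
  have FE : F = mulmxr M \o f by [].
  split; first by rewrite FE; apply: differentiable_comp => //; exact: fd.
  rewrite FE (derive_comp v (fd x Ax) (dM _)) (deriveE _ (dM _)).
  rewrite diff_lin //; exact: linear_mx_continuous.
have FA : Ck 1 A F.
  by apply: Ck_mulmx => //; exact: Ck_cst.
have [|r r0 [rA rP]] := near_identity_contraction oA Ax0 FA.
  move=> v; have [_ ->] := FD x0 v Ax0.
  by rewrite (deriveEjacobian _ (fd x0 Ax0)) mulmxK.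
have dist x y : ball x0 r x -> ball x0 r y -> `|x - y| <= 2 * `|F x - F y|.
  move=> xr yr; have := rP x y xr yr.
  have : `|x - y| <= `|F x - F y| + `|(F x - x) - (F y - y)|.
    have -> : x - y = (F x - F y) - ((F x - x) - (F y - y)).
      by apply/rowP => j; rewrite !mxE; ring.
    exact: ler_normB.
  move: `|x - y| `|F x - F y| `|_ - _| => a b c; lra.
have openF B : open B -> B `<=` ball x0 r -> open (F @` B).
  move=> oB Br; rewrite openE => _ [x Bx <-].
  have [d /= d0 dB] := (nbhs_ballP _ _).1 (open_nbhs_nbhs (conj oB Bx)).
  have : open (F @` ball x d).
    by apply: near_identity_open => // y z yd zd; apply: rP; apply/Br/dB.
  rewrite openE => /(_ (F x)); rewrite /interior /=.
  case; first by exists x => //; exact: ballxx.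
  by move=> e e0 eP; exists e => // y /eP [z zd <-]; exists z => //; exact: dB.
pose U : set E := ball x0 r.
have openf B : open B -> B `<=` U -> open (f @` B).
  move=> oB BU; have -> : f @` B = mulmxr M @^-1` (F @` B).
    apply/seteqP; split=> [_ [x Bx <-]|y [x Bx /= FE]]; first by exists x.
    exists x => //; move: FE; rewrite /F /= => /(congr1 (mulmx^~ ('J f x0))).
    by rewrite /M !mulmxKV.
  apply: open_comp; last exact: openF.
  by move=> y _; exact: linear_mx_continuous.
pose g y := xget x0 [set x | U x /\ f x = y].
have gU y : (f @` U) y -> U (g y) /\ f (g y) = y.
  by move=> [x Ux fxy]; rewrite /g; case: xgetP => [_ -> []//|/(_ x)]; case.
have gf x : U x -> g (f x) = x.
  move=> Ux; have [|Ugx fgx] := gU (f x); first by exists x.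
  apply/eqP; rewrite -subr_eq0 -normr_le0.
  by apply: le_trans (dist _ _ Ugx Ux) _; rewrite /F fgx subrr normr0 mulr0.
have oU : open U by exact: ball_open.
have ofU : open (f @` U) by exact: openf.
(* a kernel vector of the Jacobian matrix would violate the bound [dist] *)
have JuU x : U x -> 'J f x \in unitmx.
  move=> Ux; apply: unit_inj; first exact: rA.
  move=> v fv; have [Fx Fv] := FD x v (rA _ Ux).
  apply: contrapT => /eqP v0; have vp : 0 < `|v| by rewrite normr_gt0.
  have e0 : 0 < (4^-1 : R) by rewrite invr_gt0.
  have [d /= d0 dP] := (nbhs_ballP _ _).1 (diff_near_le Fx e0).
  have [d' /= d'0 d'P] := (nbhs_ballP _ _).1 (open_nbhs_nbhs (conj oU Ux)).
  pose s := Num.min d d' / (2 * `|v|).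
  have dd0 : 0 < Num.min d d' by rewrite lt_min d0.
  have s0 : 0 < s by rewrite divr_gt0 // mulr_gt0.
  have sv : `|s *: v| < Num.min d d'.
    rewrite normrZ gtr0_norm //.
    have -> : s * `|v| = Num.min d d' / 2 by rewrite /s; field; rewrite gt_eqF.
    by rewrite ltr_pdivrMr // ltr_pMr // ltr1n.
  have : `|F (s *: v + x) - F x - 'd F x (s *: v)| <= 4^-1 * `|s *: v|.
    apply: dP; rewrite -ball_normE /= sub0r normrN.
    by rewrite (lt_le_trans sv) // ge_min lexx.
  rewrite linearZ /= -(deriveE _ Fx) Fv fv mul0mx scaler0 subr0.
  have : `|s *: v + x - x| <= 2 * `|F (s *: v + x) - F x|.
    apply: dist => //; apply: d'P; rewrite -ball_normE /= opprD addrCA subrr addr0 normrN.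
    by rewrite (lt_le_trans sv) // ge_min lexx orbT.
  rewrite addrK; have : 0 < `|s *: v| by rewrite normrZ mulr_gt0 // gtr0_norm.
  move: `|s *: v| `|_ - _| => a b; lra.
exists U, g; split=> //; split=> //; first exact: ballxx.
apply: (@inverse_smooth f g U (f @` U)) => //.
- by move=> k; apply: Ck_sub (fA k).
- by move=> y /gU[].
move=> _ [x Ux <-]; rewrite gf //; have Ax := rA _ Ux; have fx := fd x Ax.
have Jx := JuU x Ux; set N := invmx ('J f x).
have Nc : continuous (mulmxr N : E -> E) by exact: linear_mx_continuous.
have [] : differentiable g (f x) /\ 'd g (f x) = mulmxr N :> (E -> E).
  apply: diff_near_intro => // e e0.
  (* c bounds the expansion of the inverse, c' that of its linear part *)
  pose c : R := 2 * (n%:R * `|M|) + 1; pose c' : R := n%:R * `|N| + 1.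
  have c0 : 0 < c by rewrite ltr_wpDl // !mulr_ge0.
  have c'0 : 0 < c' by rewrite ltr_wpDl // mulr_ge0.
  have e'0 : 0 < e / (c * c') by rewrite divr_gt0 // mulr_gt0.
  have [d /= d0 dP] := (nbhs_ballP _ _).1 (diff_near_le fx e'0).
  have W0 : \forall k \near (0 : E), (f @` U) (k + f x).
    have fUx : open_nbhs (f x) (f @` U) by split=> //; exists x.
    exact: cvg_shift0 (open_nbhs_nbhs fUx).
  have D0 : \forall k \near (0 : E), `|k| < d / c.
    by apply: nbhs0_lt; rewrite divr_gt0.
  near=> k; rewrite gf //.
  have [|Uk fk] := gU (k + f x); first by near: k.
  set h := g (k + f x) - x; have hE : g (k + f x) = h + x by rewrite subrK.
  have hk : `|h| <= c * `|k|.
    apply: le_trans (dist _ _ Uk Ux) _; rewrite /F fk -mulmxBl addrK.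
    have kM := mulmx_norm_le k M.
    have -> : c * `|k| = 2 * (n%:R * (`|k| * `|M|)) + `|k| by rewrite /c; ring.
    by apply: ler_wpDr => //; rewrite ler_wpM2l.
  have : `|f (h + x) - f x - 'd f x h| <= e / (c * c') * `|h|.
    apply: dP; rewrite -ball_normE /= sub0r normrN (le_lt_trans hk) //.
    by rewrite mulrC -ltr_pdivlMr //; near: k.
  rewrite -hE fk addrK -(deriveE _ fx) (deriveEjacobian _ fx) => kh.
  have -> : h - mulmxr N k = - ((k - h *m 'J f x) *m N).
    by rewrite mulmxBl mulmxK // opprB.
  rewrite normrN; apply: le_trans (mulmx_norm_le _ _) _.
  apply: (@le_trans _ _ (c' * (e / (c * c') * (c * `|k|)))).
    rewrite [`|_| * `|N|]mulrC mulrA ler_pM ?mulr_ge0 //.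
      by rewrite /c' lerDl.
    by rewrite (le_trans kh) // ler_wpM2l // ltW.
  rewrite le_eqVlt; apply/orP; left; apply/eqP; field.
  by rewrite !gt_eqF.
move=> gd gE; split=> // v; by rewrite deriveE // gE.
Unshelve. all: by end_near. Qed.

End InverseFunctionTheorem.

(** * Linear differential equations on the unit interval *)

Section LinearODE.
Context {R : realType}.

Let clamp (t : R) : R := Num.max 0 (Num.min 1 t).

Let clamp_itv t : clamp t \in `[0, 1].
Proof. by rewrite in_itv /= /clamp le_max lexx /= ge_max ler01 /= ge_min lexx. Qed.

Let clamp_id t : t \in `[0, 1] -> clamp t = t.
Proof. by rewrite in_itv /= => /andP[t0 t1]; rewrite /clamp min_r // max_r. Qed.

Let clamp_continuous : continuous clamp.
Proof.
move=> t; have := @continuous_max R R (cst 0) (cst 1 \min id) t.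
apply; first exact: cst_continuous.
have := @continuous_min R R (cst 1) id t; apply; first exact: cst_continuous.
exact: cvg_id.
Qed.

(** The clamped integrand is continuous on the whole line, so that its
   integral from -1 is differentiable on a neighbourhood of the unit interval. *)
Lemma antiderivative (u : R -> R) :
  (forall t : R, t \in `[0, 1] -> {for t, continuous u}) ->
  exists F : R -> R, F 0 = 0 /\
    forall t : R, t \in `[0, 1] -> is_derive t 1 F (u t).
Proof.
move=> uc; pose v := u \o clamp.
have vc : continuous v.
  by move=> t; apply: continuous_comp; [exact: clamp_continuous|exact: uc].
pose F x := (\int[lebesgue_measure]_(t in `[(-1)%R, x]) v t)%R.
exists (fun x => F x - F 0); split; first by rewrite subrr.
move=> t tI; have := tI; rewrite in_itv /= => /andP[t0 t1].
have vi : lebesgue_measure.-integrable `[(-1)%R, 2%R] (EFin \o v).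
  apply: continuous_compact_integrable; first exact: segment_compact.
  by apply: continuous_subspaceT => x; exact: vc.
have [||Fd FE] := continuous_FTC1_closed _ vi _ (vc t).
- by rewrite (le_lt_trans t1) // ltr1n.
- by rewrite (lt_le_trans _ t0) // ltrN10.
have Fdt : is_derive t 1 F (u t).
  by split; [exact: Fd|rewrite -derive1E FE /v /= clamp_id].
by rewrite -[u t]subr0; apply: is_deriveB.
Qed.

Lemma is_derive_mx {V : normedModType R} m n (F : V -> 'M[R]_(m, n)) (D : 'M[R]_(m, n)) x v :
  (forall i j, is_derive x v (fun y => F y i j) (D i j)) -> is_derive x v F D.
Proof.
move=> FD; have dF : derivable F x v.
  by apply/derivable_mxP => i j; have [] := FD i j.
split=> //; rewrite derive_mx //; apply/matrixP => i j; rewrite mxE.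
by have [] := FD i j.
Qed.

Lemma is_derive_entry {V : normedModType R} m n (F : V -> 'M[R]_(m, n)) (D : 'M[R]_(m, n)) x v i j :
  is_derive x v F D -> is_derive x v (fun y => F y i j) (D i j).
Proof.
by move=> [dF <-]; split; [move/derivable_mxP : dF; exact|rewrite derive_entry].
Qed.

Lemma is_derive_mulmx {V : normedModType R} m n p (F : V -> 'M[R]_(m, n))
    (G : V -> 'M[R]_(n, p)) (dF : 'M[R]_(m, n)) (dG : 'M[R]_(n, p)) x v :
  is_derive x v F dF -> is_derive x v G dG ->
  is_derive x v (fun y => F y *m G y) (dF *m G x + F x *m dG).
Proof.
move=> FD GD; apply: is_derive_mx => i j.
under eq_fun do rewrite mxE.
have -> : (fun y => \sum_k F y i k * G y k j) = \sum_k (fun y => F y i k) * (fun y => G y k j).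
  by apply/funext => y; rewrite fct_sumE.
have H k : is_derive x v ((fun y => F y i k) * (fun y => G y k j))
    (F x i k *: dG k j + G x k j *: dF i k).
  by apply: is_deriveM; exact: is_derive_entry.
have -> : (dF *m G x + F x *m dG) i j = \sum_k (F x i k *: dG k j + G x k j *: dF i k).
  rewrite !mxE -big_split /=; apply: eq_bigr => k _.
  by rewrite addrC [dF i k * _]mulrC.
exact: is_derive_sum.
Qed.

Lemma antiderivative_mx m n (u : R -> 'M[R]_(m, n)) :
  (forall t : R, t \in `[0, 1] -> {for t, continuous u}) ->
  exists F : R -> 'M[R]_(m, n), F 0 = 0 /\
    forall t : R, t \in `[0, 1] -> is_derive t 1 F (u t).
Proof.
move=> uc.
have /choice[F FP] : forall ij : 'I_m * 'I_n, exists F : R -> R, F 0 = 0 /\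
    forall t : R, t \in `[0, 1] -> is_derive t 1 F (u t ij.1 ij.2).
  by move=> [i j]; apply: antiderivative => t /uc /continuous_mx; exact.
exists (fun t => \matrix_(i, j) F (i, j) t); split.
  by apply/matrixP => i j; rewrite !mxE; have [] := FP (i, j).
move=> t tI; apply: is_derive_mx => i j; under eq_fun do rewrite mxE.
by have [_] := FP (i, j); exact.
Qed.

(** The explicit rate makes the convergence of the Picard iterates uniform in the
    time variable. *)
Lemma geometric_limit m n (u : nat -> 'M[R]_(m, n)) K :
  (forall k, `|u k.+1 - u k| <= K * 2^-1 ^+ k) ->
  exists l, forall k, `|l - u k| <= 2 * K * 2^-1 ^+ k.
Proof.
move=> uK; have K0 : 0 <= K by have := le_trans (normr_ge0 _) (uK 0%N); rewrite mulr1.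
have h0 j : 0 <= (2^-1 : R) ^+ j by rewrite exprn_ge0 // invr_ge0.
have dist k j : `|u (k + j)%N - u k| <= 2 * K * (2^-1 ^+ k - 2^-1 ^+ (k + j)).
  elim: j => [|j IH]; first by rewrite addn0 !subrr normr0 mulr0.
  rewrite -(subrK (u (k + j)%N) (u (k + j.+1)%N)) -addrA addnS.
  apply: le_trans (ler_normD _ _) _; have := uK (k + j)%N; rewrite exprS.
  by move: IH; move: `|_| `|_| (2^-1 ^+ k) (2^-1 ^+ (k + j)) => a b c d; lra.
have distW k j : (k <= j)%N -> `|u j - u k| <= 2 * K * 2^-1 ^+ k.
  move=> /subnKC <-; apply: le_trans (dist _ _) _.
  by rewrite ler_wpM2l ?mulr_ge0 // gerBl.
have ucvg : cvg (u @ \oo).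
  apply/cauchy_cvgP/cauchy_exP => e e0.
  have /cvgrPdist_lt/(_ e e0) : (geometric (2 * K) 2^-1 k) @[k --> \oo] --> 0.
    by apply: cvg_geometric; rewrite ger0_norm ?invr_ge0 // invf_lt1 // ltr1n.
  move=> [N _ NP]; exists (u N); exists N => // j /= Nj.
  rewrite -ball_normE /= distrC; apply: le_lt_trans (distW _ _ Nj) _.
  have := NP N (leqnn N); rewrite /geometric /= sub0r normrN.
  exact: le_lt_trans (ler_norm _).
exists (lim (u @ \oo)) => k; apply/ler_addgt0Pr => e e0.
have [N _ NP] := (cvgrPdist_lt _ _).1 ucvg e e0.
rewrite -(subrK (u (maxn N k)) (lim _)) -addrA addrC; apply: le_trans (ler_normD _ _) _.
apply: lerD; first by apply: distW; exact: leq_maxr.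
by apply: ltW; apply: NP; exact: leq_maxl.
Qed.

Lemma is_derive_continuous {W : normedModType R} (F : R -> W) (dF : W) (t : R) :
  is_derive t 1 F dF -> {for t, continuous F}.
Proof. by move=> [Fd _]; apply: differentiable_continuous; exact/derivable1_diffP. Qed.

Lemma unit_mean_value_le m n (f df : R -> 'M[R]_(m, n)) (K : R) (t : R) :
  t \in `[0, 1] -> (forall s : R, s \in `[0, 1] -> is_derive s 1 f (df s)) ->
  (forall s : R, s \in `[0, 1] -> `|df s| <= K) -> `|f t - f 0| <= K.
Proof.
rewrite in_itv /= => /andP[t0 t1] fd fK.
have K0 : 0 <= K by apply: le_trans (fK 0 _) => //; rewrite in_itv /= lexx ler01.
have sub s : s \in `[0, t] -> s \in `[0, 1].
  by rewrite !in_itv /= => /andP[-> st]; exact: le_trans t1.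
have [->|tn0] := eqVneq t 0; first by rewrite subrr normr0.
have tp : 0 < t by rewrite lt_def tn0.
have fd' s : s \in `]0, t[ -> is_derive s 1 f (df s).
  by move=> sI; apply: fd; apply: sub; exact: subset_itv_oo_cc.
have fc s : s \in `[0, t] -> {for s, continuous f}.
  by move=> /sub sI; apply: is_derive_continuous (fd s sI).
have fK' s : s \in `]0, t[ -> `|df s| <= K.
  by move=> sI; apply: fK; apply: sub; exact: subset_itv_oo_cc.
apply: le_trans (mean_value_le tp fd' fc fK') _.
by rewrite subr0 ler_piMr.
Qed.

Lemma half_bound n (A B : 'M[R]_n) (c : R) : n%:R * `|B| <= 2^-1 -> `|A| <= c ->
  `|A *m B| <= 2^-1 * c.
Proof.
move=> nB Ac; apply: le_trans (mulmx_norm_le _ _) _.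
rewrite mulrCA mulrC ler_pM // mulr_ge0 //.
Qed.

(** Picard iteration: the smallness of [b] makes the integral operator a
    contraction by 1/2 for the uniform norm on the unit interval. *)
Lemma linear_ode n (b : R -> 'M[R]_n) :
  (forall t : R, t \in `[0, 1] -> {for t, continuous b}) ->
  (forall t : R, t \in `[0, 1] -> n%:R * `|b t| <= 2^-1) ->
  exists h : R -> 'M[R]_n, h 0 = 1%:M /\
    forall t : R, t \in `[0, 1] -> is_derive t 1 h (h t *m b t).
Proof.
move=> bc bn.
have /choice[P PP] : forall u : R -> 'M[R]_n, exists F : R -> 'M[R]_n,
    (forall t : R, t \in `[0, 1] -> {for t, continuous u}) -> F 0 = 0 /\
    forall t : R, t \in `[0, 1] -> is_derive t 1 F (u t *m b t).
  move=> u.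
  have [uc|] := pselect (forall t : R, t \in `[0, 1] -> {for t, continuous u}); last first.
    by exists u.
  have [|F FP] := @antiderivative_mx n n (fun t => u t *m b t); last by exists F.
  by move=> t tI; apply: continuous_mulmx; [exact: uc|exact: bc].
pose h := fix h k := if k is k'.+1 then fun t => 1%:M + P (h k') t else fun=> 1%:M.
have hD k (t : R) : t \in `[0, 1] -> {for t, continuous (h k)} /\
    is_derive t 1 (h k.+1) (h k t *m b t).
  elim: k t => [|k IH] t tI.
    split; first exact: cst_continuous.
    rewrite -[X in is_derive _ _ _ X]add0r; apply: is_deriveD.
    by have [|_] := PP (h 0%N); [move=> s _; exact: cst_continuous|exact].
  have hc s : s \in `[0, 1] -> {for s, continuous (h k.+1)}.
    by move=> /IH[_]; exact: is_derive_continuous.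
  split; first exact: hc.
  rewrite -[X in is_derive _ _ _ X]add0r; apply: is_deriveD.
  by have [|_] := PP (h k.+1); [exact: hc|exact].
have h0 k : h k 0 = 1%:M.
  case: k => //= k; have [|-> _] := PP (h k); last by rewrite addr0.
  by move=> t tI; have [] := hD k t tI.
pose K : R := `|1%:M : 'M[R]_n|.
have hK k (t : R) : t \in `[0, 1] -> `|h k.+1 t - h k t| <= K * 2^-1 ^+ k.
  elim: k t => [|k IH] t tI.
    have := @unit_mean_value_le _ _ (h 1%N) (fun s => h 0%N s *m b s) (2^-1 * K) t tI.
    rewrite h0 mulr1 => H; apply: le_trans (H _ _) _ => [s sI|s sI|].
    - by have [] := hD 0%N s sI.
    - by apply: half_bound; [exact: bn|].
    - by rewrite ler_piMl ?normr_ge0 // invf_le1 // ler1n.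
  pose df s := (h k.+1 s - h k s) *m b s.
  have := @unit_mean_value_le _ _ (fun s => h k.+2 s - h k.+1 s) df (2^-1 * (K * 2^-1 ^+ k)) t tI.
  rewrite !h0 !subrr subr0 exprS [K * (_ * _)]mulrCA; apply=> s sI; rewrite /df.
    rewrite mulmxBl; apply: is_deriveB; first by have [] := hD k.+1 s sI.
    by have [] := hD k s sI.
  by apply: half_bound; [exact: bn|exact: IH].
have /choice[l lP] : forall t : R, exists l, forall k, `|l - h k (clamp t)| <= 2 * K * 2^-1 ^+ k.
  by move=> t; apply: geometric_limit => k; exact: hK.
have small (e : R) : 0 < e -> exists k, 2 * K * 2^-1 ^+ k < e.
  move=> e0; have /cvgrPdist_lt/(_ e e0) : (geometric (2 * K) 2^-1 k) @[k --> \oo] --> 0.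
    by apply: cvg_geometric; rewrite ger0_norm ?invr_ge0 // invf_lt1 // ltr1n.
  move=> [N _ NP]; exists N; have := NP N (leqnn N); rewrite /geometric /= sub0r normrN.
  exact: le_lt_trans (ler_norm _).
have lc : continuous l.
  move=> t; apply/cvgrPdist_lt => e e0.
  have [k ke] := small (e / 3) (divr_gt0 e0 (ltr0n _ 3)).
  have kc : {for t, continuous (h k \o clamp)}.
    apply: continuous_comp; first exact: clamp_continuous.
    by have [] := hD k (clamp t) (clamp_itv t).
  have [d /= d0 dP] := (nbhs_ballP _ _).1 ((cvgrPdist_lt _ _).1 kc (e / 3) (divr_gt0 e0 (ltr0n _ 3))).
  apply/nbhs_ballP; exists d => //= s /dP /= ts.
  have -> : l t - l s = (l t - h k (clamp t)) + (h k (clamp t) - h k (clamp s)) - (l s - h k (clamp s)).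
    by rewrite addrA subrK opprB addrA subrK.
  apply: le_lt_trans (ler_normB _ _) _.
  have := ler_normD (l t - h k (clamp t)) (h k (clamp t) - h k (clamp s)).
  have := lP t k; have := lP s k; move: ke ts.
  move: (2 * K * _) `|_| `|_| `|_| `|_| => a c1 c2 c3 c4; lra.
have [|P0 PD] := PP l; first by move=> t _; exact: lc.
exists (fun t => 1%:M + P l t); split; first by rewrite P0 addr0.
have lE (t : R) : t \in `[0, 1] -> 1%:M + P l t = l t.
  move=> tI; apply/eqP; rewrite -subr_eq0 -normr_le0; apply/ler_addgt0Pr => e e0.
  have [k ke] := small e e0; rewrite add0r.
  have lP' s j : s \in `[0, 1] -> `|l s - h j s| <= 2 * K * 2^-1 ^+ j.
    by move=> sI; have := lP s j; rewrite clamp_id.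
  have := @unit_mean_value_le _ _ (fun s => 1%:M + P l s - h k.+1 s)
    (fun s => (l s - h k s) *m b s) (2^-1 * (2 * K * 2^-1 ^+ k)) t tI.
  rewrite h0 P0 addr0 subrr subr0 => H.
  have {}H : `|1%:M + P l t - h k.+1 t| <= 2^-1 * (2 * K * 2^-1 ^+ k).
    apply: H => s sI; last by apply: half_bound; [exact: bn|exact: lP'].
    rewrite mulmxBl; apply: is_deriveB; last by have [] := hD k s sI.
    rewrite -[X in is_derive _ _ _ X]add0r; apply: is_deriveD; exact: PD.
  have := lP' t k.+1 tI; rewrite exprS => lt.
  have -> : 1%:M + P l t - l t = (1%:M + P l t - h k.+1 t) - (l t - h k.+1 t).
    by rewrite opprB addrA subrK.
  apply: le_trans (ler_normB _ _) _; move: H lt ke.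
  move: (2^-1 ^+ k) `|_| `|_| => a c1 c2; lra.
move=> t tI; rewrite lE //.
by rewrite -[X in is_derive _ _ _ X]add0r; apply: is_deriveD; exact: PD.
Qed.

(** A Gronwall estimate without exponentials: as b is small, the maximum of |r|
    bounds itself with the factor 1/2. *)
Lemma linear_ode_bound n (b e r : R -> 'M[R]_n) (c : R) :
  (forall t : R, t \in `[0, 1] -> n%:R * `|b t| <= 2^-1) -> r 0 = 0 ->
  (forall t : R, t \in `[0, 1] -> is_derive t 1 r (r t *m b t + e t)) ->
  (forall t : R, t \in `[0, 1] -> `|e t| <= c) ->
  forall t : R, t \in `[0, 1] -> `|r t| <= 2 * c.
Proof.
move=> bn r0 rD ec.
have [|s sI smax] := @EVT_max R (fun t => `|r t|) 0 1 ler01.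
  apply: continuous_in_subspaceT => t /set_mem /= tI.
  apply: (@continuous_comp _ _ _ r Num.Def.normr); last exact: norm_continuous.
  exact: is_derive_continuous (rD t tI).
suff H : `|r s| <= 2 * c by move=> t /smax /le_trans; exact.
have := @unit_mean_value_le _ _ r _ (2^-1 * `|r s| + c) s sI rD.
rewrite r0 subr0 => H.
have {}H : `|r s| <= 2^-1 * `|r s| + c.
  apply: H => t tI; apply: le_trans (ler_normD _ _) _.
  by rewrite lerD ?ec // half_bound ?bn ?smax.
by lra.
Qed.

End LinearODE.

(** * Integration of flat connections *)

Section BallEstimates.
Context {R : realType} {m : nat}.
Local Notation E := 'rV[R]_m.

Lemma finite_family_bounded (I : finType) k n (f : I -> E -> 'M[R]_(k, n)) x0 :
  (forall i, {for x0, continuous (f i)}) ->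
  exists2 M : R, 0 < M & \forall x \near x0, forall i, `|f i x| <= M.
Proof.
move=> fc; pose M : R := 1 + \sum_i `|f i x0|.
have Mi i : `|f i x0| + 1 <= M.
  by rewrite addrC lerD2l (bigD1 i) //= lerDl sumr_ge0.
exists M; first by rewrite ltr_pwDl // sumr_ge0.
near=> x => i; apply: le_trans (Mi i).
rewrite -[f i x](subrK (f i x0)) addrC; apply: le_trans (ler_normD _ _) _.
rewrite lerD2l distrC; move: i; near: x; apply: filter_forall => i.
exact: ((cvgrPdist_le _ _).1 (fc i)).
Unshelve. all: by end_near. Qed.

Lemma sum_coord_le k n (q : E) (F : 'I_m -> 'M[R]_(k, n)) K :
  (forall j, `|F j| <= K) -> `|\sum_j q 0 j *: F j| <= m%:R * (K * `|q|).
Proof.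
move=> FK; apply: le_trans (ler_norm_sum _ _ _) _.
rewrite -[m in m%:R]card_ord mulr_natl -sumr_const; apply: ler_sum => j _.
by rewrite normrZ mulrC ler_pM // mx_entry_le.
Qed.

Lemma first_order_le k n (f : E -> 'M[R]_(k, n)) x0 r K p q :
  (forall x, ball x0 r x -> differentiable f x) ->
  (forall x j, ball x0 r x -> `|'D_(delta_mx 0 j) f x| <= K) ->
  ball x0 r p -> ball x0 r (p + q) -> `|f (p + q) - f p| <= m%:R * (K * `|q|).
Proof.
move=> fd fK pr qr; apply: mean_value_segment_le => t tI.
  by apply: fd; exact: ball_segment.
have tr := ball_segment pr qr tI; have ft := fd _ tr.
by rewrite (derive_coordE _ ft); apply: sum_coord_le => j; exact: fK.
Qed.

(** Mean value theorem for t |-> f (p + t q) - t D_q f p, whose derivative is of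
    first order in q. *)
Lemma second_order_le k n (f : E -> 'M[R]_(k, n)) x0 r K p q :
  (forall x, ball x0 r x -> differentiable f x) ->
  (forall x j, ball x0 r x -> differentiable ('D_(delta_mx 0 j) f) x) ->
  (forall x i j, ball x0 r x -> `|'D_(delta_mx 0 i) ('D_(delta_mx 0 j) f) x| <= K) ->
  ball x0 r p -> ball x0 r (p + q) ->
  `|f (p + q) - f p - 'D_q f p| <= m%:R * (m%:R * (K * `|q|) * `|q|).
Proof.
move=> fd fdd fK pr qr.
pose phi (t : R) := f (p + t *: q) - t *: 'D_q f p.
pose dphi (t : R) := 'D_q f (p + t *: q) - 'D_q f p.
have phid (t : R) : t \in `[0, 1] -> is_derive t 1 phi (dphi t).
  move=> tI; apply: is_deriveB.
    by apply: is_derive_line; apply: fd; exact: ball_segment.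
  have [d1 d2] := is_diff_scalel t ('D_q f p).
  by apply: DeriveDef; [exact: diff_derivable|rewrite deriveE // d2 /= scale1r].
have I1 : (1 : R) \in `[0, 1] by rewrite in_itv /= ler01 lexx.
have : `|phi 1 - phi 0| <= m%:R * (m%:R * (K * `|q|) * `|q|).
  apply: (unit_mean_value_le I1 phid) => t tI; rewrite /dphi.
  have tr := ball_segment pr qr tI.
  rewrite (derive_coordE q (fd _ tr)) (derive_coordE q (fd _ pr)).
  rewrite -sumrB; under eq_bigr do rewrite -scalerBr.
  apply: sum_coord_le => j.
  have dd x : ball x0 r x -> differentiable ('D_(delta_mx 0 j) f) x by exact: fdd.
  have dK x i : ball x0 r x -> `|'D_(delta_mx 0 i) ('D_(delta_mx 0 j) f) x| <= K by exact: fK.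
  apply: le_trans (first_order_le dd dK pr tr) _.
  have K0 : 0 <= K by apply: le_trans (fK p j j pr).
  rewrite normrZ; have := tI; rewrite in_itv /= => /andP[t0 t1].
  by rewrite ler_wpM2l // ler_wpM2l // ger0_norm // ler_piMl.
by rewrite /phi scale1r scale1r scale0r scale0r addr0 subr0 addrAC.
Qed.

End BallEstimates.

Section FlatConnection.
Context {R : realType} {m n : nat}.
Local Notation E := 'rV[R]_m.
Implicit Types om : 'I_m -> E -> 'M[R]_n.

Definition eval_form om (x v : E) : 'M[R]_n := \sum_i v 0 i *: om i x.

Lemma eval_formD om x u v : eval_form om x (u + v) = eval_form om x u + eval_form om x v.
Proof.
by rewrite /eval_form -big_split; apply: eq_bigr => i _; rewrite mxE scalerDl.
Qed.

Lemma eval_formZ om x a v : eval_form om x (a *: v) = a *: eval_form om x v.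
Proof.
by rewrite /eval_form scaler_sumr; apply: eq_bigr => i _; rewrite mxE scalerA.
Qed.

Definition deval_form om (x u v : E) : 'M[R]_n := \sum_i v 0 i *: 'D_u (om i) x.

Lemma is_derive_eval_form om x u v (t : R) :
  (forall i, differentiable (om i) (x + t *: u)) ->
  is_derive t 1 (fun t : R => eval_form om (x + t *: u) v) (deval_form om (x + t *: u) u v).
Proof.
move=> od.
have -> : (fun t : R => eval_form om (x + t *: u) v) =
    \sum_i (fun t : R => v 0 i *: om i (x + t *: u)).
  by apply/funext => s; rewrite fct_sumE.
apply: is_derive_sum => i; apply: is_deriveZ.
by apply: is_derive_line; exact: od.
Qed.

(** The equation d om + om /\ om = 0, evaluated on the coordinate vectors. *)
Definition flat_at om (x : E) := forall i j,
  'D_(delta_mx 0 i) (om j) x - 'D_(delta_mx 0 j) (om i) x =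
  om j x *m om i x - om i x *m om j x.

Lemma eval_form_mulmx om x u v :
  eval_form om x u *m eval_form om x v = \sum_i \sum_j (u 0 i * v 0 j) *: (om i x *m om j x).
Proof.
rewrite /eval_form mulmx_suml; apply: eq_bigr => i _; rewrite mulmx_sumr.
by apply: eq_bigr => j _; rewrite -scalemxAl -scalemxAr scalerA.
Qed.

Lemma flat_deval_form om x u v : (forall i, differentiable (om i) x) -> flat_at om x ->
  deval_form om x u v - deval_form om x v u = eval_form om x v *m eval_form om x u - eval_form om x u *m eval_form om x v.
Proof.
move=> od ofl.
have dE a b : deval_form om x a b = \sum_i \sum_j (a 0 i * b 0 j) *: 'D_(delta_mx 0 i) (om j) x.
  rewrite /deval_form exchange_big; apply: eq_bigr => j _ /=.
  rewrite (derive_coordE _ (od j)) scaler_sumr; apply: eq_bigr => i _.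
  by rewrite scalerA mulrC.
rewrite !dE [X in _ - X]exchange_big !eval_form_mulmx [X in _ = X - _]exchange_big -!sumrB.
apply: eq_bigr => i _; rewrite -!sumrB; apply: eq_bigr => j _ /=.
by rewrite ![v 0 j * u 0 i]mulrC -!scalerBr ofl.
Qed.

(** Along the ray from x0 to x the transport [h] solves a linear ODE; flatness
    says precisely that t h(t) omega(v) satisfies the variational equation, so
    that it is the derivative of [h] with respect to the end point: the error
    satisfies the same ODE with a quadratically small source term. Smoothness
    follows, as D_v g = g om(v) expresses the derivative of g through g. *)
Theorem flat_connection om (A : set E) x0 : open A -> A x0 ->
  (forall i, Csmooth A (om i)) -> (forall x, A x -> flat_at om x) ->
  exists (r : R) (g : E -> 'M[R]_n), [/\ 0 < r, ball x0 r `<=` A, g x0 = 1%:M,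
    (forall x, ball x0 r x -> differentiable g x /\
      forall v, 'D_v g x = g x *m eval_form om x v) & Csmooth (ball x0 r) g].
Proof.
move=> oA Ax0 oS ofl.
have dA i x : A x -> differentiable (om i) x by move=> Ax; have [+ _] := oS i 1%N; exact.
have ddA i j x : A x -> differentiable ('D_(delta_mx 0 j) (om i)) x.
  by move=> Ax; have [_ /(_ (delta_mx 0 j))[+ _]] := oS i 2%N; exact.
have cA0 i : {for x0, continuous (om i)} by have := oS i 0%N x0 Ax0.
have cA1 (ij : 'I_m * 'I_m) : {for x0, continuous ('D_(delta_mx 0 ij.2) (om ij.1))}.
  exact: differentiable_continuous (ddA _ _ _ Ax0).
have cA2 (ijk : 'I_m * 'I_m * 'I_m) : {for x0, continuous
    ('D_(delta_mx 0 ijk.2) ('D_(delta_mx 0 ijk.1.2) (om ijk.1.1)))}.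
  have [_ /(_ (delta_mx 0 ijk.1.2))[_ /(_ (delta_mx 0 ijk.2))]] := oS ijk.1.1 2%N.
  by move=> /(_ x0 Ax0).
have [M0 M00 M0P] := finite_family_bounded cA0.
have [M1 M10 M1P] := finite_family_bounded cA1.
have [M2 M20 M2P] := finite_family_bounded cA2.
pose M := M0 + M1 + M2; have Mp : 0 < M by rewrite !addr_gt0.
have [rho /= rho0 rhoP] : nbhs_ball x0 (fun x => [/\ A x,
    forall i, `|om i x| <= M,
    forall i j, `|'D_(delta_mx 0 j) (om i) x| <= M &
    forall i j k, `|'D_(delta_mx 0 k) ('D_(delta_mx 0 j) (om i)) x| <= M]).
  apply/nbhs_ballP; near=> x; split.
  - by near: x; exact: open_nbhs_nbhs.
  - have H : forall i, `|om i x| <= M0 by near: x.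
    by move=> i; rewrite (le_trans (H i)) // /M -addrA lerDl addr_ge0 // ltW.
  - have H : forall ij : 'I_m * 'I_m, `|'D_(delta_mx 0 ij.2) (om ij.1) x| <= M1 by near: x.
    by move=> i j; rewrite (le_trans (H (i, j))) // /M addrAC lerDr addr_ge0 // ltW.
  - have H : forall ijk : 'I_m * 'I_m * 'I_m,
      `|'D_(delta_mx 0 ijk.2) ('D_(delta_mx 0 ijk.1.2) (om ijk.1.1)) x| <= M2 by near: x.
    by move=> i j k; rewrite (le_trans (H (i, j, k))) // /M lerDr addr_ge0 // ltW.
pose mM : R := m%:R * M; have mM0 : 0 <= mM by rewrite mulr_ge0 // ltW.
pose c := (2 * (n%:R * mM + 1))^-1 : R.
have c0 : 0 < c by rewrite invr_gt0 mulr_gt0 // ltr_wpDl // mulr_ge0.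
pose r := Num.min rho (Num.min 1 c).
have r0 : 0 < r by rewrite !lt_min rho0 ltr01 c0.
have rrho : r <= rho by rewrite ge_min lexx.
have r1 : r <= 1 by rewrite !ge_min lexx orbT.
have rc : n%:R * (mM * r) <= 2^-1.
  have : r <= c by rewrite !ge_min lexx !orbT.
  have a0 : 0 <= n%:R * mM by rewrite mulr_ge0.
  rewrite mulrA => /(ler_wpM2l a0)/le_trans; apply.
  by rewrite /c invfM mulrCA ler_piMr ?invr_ge0// ler_pdivrMr ?mul1r ?ltr_wpDl// lerDl.
have B x : ball x0 r x -> [/\ A x, forall i, `|om i x| <= M,
    forall i j, `|'D_(delta_mx 0 j) (om i) x| <= M &
    forall i j k, `|'D_(delta_mx 0 k) ('D_(delta_mx 0 j) (om i)) x| <= M].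
  by move=> /(le_ball rrho) /rhoP.
have beval x v : ball x0 r x -> `|eval_form om x v| <= mM * `|v|.
  by move=> /B[_ H _ _]; rewrite /mM -mulrA; exact: sum_coord_le.
have inb u : `|u| < r -> ball x0 r (x0 + u).
  by rewrite -ball_normE /= opprD addrA subrr add0r normrN.
have inbt u (t : R) : `|u| < r -> t \in `[0, 1] -> ball x0 r (x0 + t *: u).
  by move=> ur tI; apply: ball_segment => //; [exact: ballxx|exact: inb].
pose b u (t : R) := eval_form om (x0 + t *: u) u.
have bn u (t : R) : `|u| < r -> t \in `[0, 1] -> n%:R * `|b u t| <= 2^-1.
  move=> ur tI; apply: le_trans rc; rewrite ler_wpM2l //.
  apply: le_trans (beval _ _ (inbt u t ur tI)) _.
  by rewrite ler_wpM2l // ltW.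
have Dconn u v (t : R) : `|u| < r -> t \in `[0, 1] ->
    is_derive t 1 (fun t : R => eval_form om (x0 + t *: u) v) (deval_form om (x0 + t *: u) u v).
  by move=> ur tI; apply: is_derive_eval_form => i; have [/dA] := B _ (inbt u t ur tI).
have /choice[h hP] : forall u, exists h : R -> 'M[R]_n, `|u| < r -> h 0 = 1%:M /\
    forall t : R, t \in `[0, 1] -> is_derive t 1 h (h t *m b u t).
  move=> u; have [ur|ur] := pselect (`|u| < r); last by exists (fun=> 0).
  have [|t tI|h hP] := @linear_ode R n (b u); last by exists h.
    by move=> t tI; exact: is_derive_continuous (Dconn u u t ur tI).
  exact: bn.
pose one : R := `|1%:M : 'M[R]_n|.
have hB u (t : R) : `|u| < r -> t \in `[0, 1] -> `|h u t| <= 2 * one.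
  move=> ur tI; have [h0 hD] := hP u ur.
  have : `|h u t - 1%:M| <= 2 * (2^-1 * one).
    apply: (@linear_ode_bound _ _ (b u) (b u) (fun t => h u t - 1%:M)) (tI) => //.
    - by move=> s sI; exact: bn.
    - by rewrite h0 subrr.
    - move=> s sI; rewrite -[X in is_derive _ _ _ X]subr0.
      apply: is_deriveB; rewrite mulmxBl mul1mx subrK; exact: hD.
    - by move=> s sI; rewrite -[b u s]mul1mx half_bound // bn.
  have := ler_normD (h u t - 1%:M) 1%:M; rewrite subrK -/one.
  move: `|_| `|_| => a a'; lra.
pose g x := h (x - x0) 1.
have I0 : (0 : R) \in `[0, 1] by rewrite in_itv /= lexx ler01.
have I1 : (1 : R) \in `[0, 1] by rewrite in_itv /= ler01 lexx.
have one0 : 0 <= one by exact: normr_ge0.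
(* the increment of the transport is quadratically close to its candidate *)
have key u : `|u| < r -> exists C : R, 0 <= C /\ forall v, `|u + v| < r ->
    `|h (u + v) 1 - h u 1 - h u 1 *m eval_form om (x0 + u) v| <= C * `|v| ^+ 2.
  move=> ur; pose C1 : R := m%:R * mM + mM; pose C2 : R := m%:R * (m%:R * mM) + m%:R * mM.
  have mmM0 : 0 <= m%:R * mM by exact: mulr_ge0 (ler0n _ _) mM0.
  have C10 : 0 <= C1 by exact: addr_ge0.
  have C20 : 0 <= C2 by exact: addr_ge0 (mulr_ge0 (ler0n _ _) mmM0) mmM0.
  have oneM0 : 0 <= 2 * one * mM by exact: mulr_ge0 (mulr_ge0 (ler0n _ 2) one0) mM0.
  pose C : R := 2 * (n%:R * (2 * one * C2) + n%:R * (n%:R * (2 * one * mM) * C1)).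
  exists C; split.
    by rewrite mulr_ge0 // addr_ge0 // mulr_ge0 ?ler0n // mulr_ge0 ?ler0n // mulr_ge0.
  move=> v uvr; have [h0 hD] := hP u ur; have [h0' hD'] := hP _ uvr.
  (* the solution of the variational equation, by flatness *)
  pose k (t : R) := t *: (h u t *m eval_form om (x0 + t *: u) v).
  pose db (t : R) := eval_form om (x0 + t *: u) v + t *: deval_form om (x0 + t *: u) v u.
  have kD (t : R) : t \in `[0, 1] -> is_derive t 1 k (h u t *m db t + k t *m b u t).
    move=> tI.
    have : is_derive t 1 (fun t : R => t *: 1%:M *m (h u t *m eval_form om (x0 + t *: u) v))
        (1%:M *m (h u t *m eval_form om (x0 + t *: u) v) + t *: 1%:M *m
         (h u t *m b u t *m eval_form om (x0 + t *: u) v + h u t *m deval_form om (x0 + t *: u) u v)).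
      apply: is_derive_mulmx; last by apply: is_derive_mulmx; [exact: hD|exact: Dconn].
      have [d1 d2] := is_diff_scalel t (1%:M : 'M[R]_n).
      by apply: DeriveDef; [exact: diff_derivable|rewrite deriveE // d2 /= scale1r].
    have [Ax _ _ _] := B _ (inbt u t ur tI).
    have fl := flat_deval_form u v (fun i => dA i _ Ax) (ofl _ Ax).
    have -> : (fun t : R => t *: 1%:M *m (h u t *m eval_form om (x0 + t *: u) v)) = k.
      by apply/funext => s; rewrite -scalemxAl mul1mx.
    suff -> : 1%:M *m (h u t *m eval_form om (x0 + t *: u) v) + t *: 1%:M *m
         (h u t *m b u t *m eval_form om (x0 + t *: u) v + h u t *m deval_form om (x0 + t *: u) u v) =
         h u t *m db t + k t *m b u t by [].
    rewrite mul1mx -scalemxAl mul1mx /db mulmxDr -addrA; congr (_ + _).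
    rewrite -scalemxAr /k -scalemxAl -scalerDr; congr (_ *: _).
    rewrite -!mulmxA -!mulmxDr; congr (_ *m _).
    move: fl; rewrite -/(b u t); move: (deval_form _ _ _ v) (deval_form _ _ _ u) => d1 d2.
    move: (b u t *m _) (_ *m b u t) => w1 w2 /eqP; rewrite subr_eq => /eqP ->.
    by rewrite -addrA addrCA addNKr addrC.
  pose e (t : R) := h u t *m (b (u + v) t - b u t - db t) + k t *m (b (u + v) t - b u t).
  pose rr (t : R) := h (u + v) t - h u t - k t.
  have rD (t : R) : t \in `[0, 1] -> is_derive t 1 rr (rr t *m b (u + v) t + e t).
    move=> tI.
    have -> : rr t *m b (u + v) t + e t =
       h (u + v) t *m b (u + v) t - h u t *m b u t - (h u t *m db t + k t *m b u t).
      rewrite /rr /e !mulmxBl !mulmxBr.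
      by apply/matrixP => i j; rewrite !mxE; ring.
    by apply: is_deriveB; [apply: is_deriveB; [exact: hD'|exact: hD]|exact: kD].
  have eB (t : R) : t \in `[0, 1] -> `|e t| <= (2^-1 * C) * `|v| ^+ 2.
    move=> tI; have pr := inbt u t ur tI; have := inbt (u + v) t uvr tI.
    rewrite scalerDr addrA => qr; set p := x0 + t *: u in pr qr.
    have tv : `|t *: v| <= `|v|.
      have := tI; rewrite in_itv /= => /andP[t0 t1].
      by rewrite normrZ ger0_norm // ler_piMl.
    have u1 : `|u| <= 1 by rewrite (le_trans (ltW ur)).
    have f1 i : `|om i (p + t *: v) - om i p| <= mM * `|v|.
      apply: (@le_trans _ _ (m%:R * (M * `|t *: v|))); last first.
        by rewrite /mM -mulrA ler_wpM2l // ler_wpM2l // ltW.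
      apply: first_order_le pr qr => [x /B[/dA]//|x j /B[_ _ H _]]; exact: H.
    have f2 i : `|om i (p + t *: v) - om i p - 'D_(t *: v) (om i) p| <= m%:R * mM * `|v| * `|v|.
      apply: (@le_trans _ _ (m%:R * (m%:R * (M * `|t *: v|) * `|t *: v|))).
        apply: second_order_le pr qr => [x /B[/dA]//|x j /B[/ddA]//|x k' j /B[_ _ _ H]].
        exact: H.
      have -> : m%:R * mM * `|v| * `|v| = m%:R * (m%:R * (M * `|v|) * `|v|).
        by rewrite /mM; ring.
      have M0' := ltW Mp; apply: ler_wpM2l => //; apply: ler_pM => //.
        by rewrite !mulr_ge0.
      by rewrite ler_wpM2l // ler_wpM2l.
    have bE : b (u + v) t - b u t = \sum_i u 0 i *: (om i (p + t *: v) - om i p)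
         + eval_form om (p + t *: v) v.
      rewrite /b scalerDr addrA -/p eval_formD addrAC; congr (_ + _).
      by rewrite /eval_form -sumrB; apply: eq_bigr => i _; rewrite scalerBr.
    have b1 : `|b (u + v) t - b u t| <= C1 * `|v|.
      rewrite bE mulrDl; apply: le_trans (ler_normD _ _) _; rewrite lerD ?beval //.
      apply: le_trans (sum_coord_le u f1) _; rewrite -mulrA ler_wpM2l //.
      by rewrite ler_piMr // mulr_ge0.
    have b2 : `|b (u + v) t - b u t - db t| <= C2 * `|v| ^+ 2.
      have -> : b (u + v) t - b u t - db t =
          \sum_i u 0 i *: (om i (p + t *: v) - om i p - 'D_(t *: v) (om i) p) +
          \sum_i v 0 i *: (om i (p + t *: v) - om i p).
        have dt i : 'D_(t *: v) (om i) p = t *: 'D_v (om i) p.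
          have [/(dA i) oip _ _ _] := B p pr.
          by rewrite !(deriveE _ oip) linearZ.
        rewrite bE /db opprD [- eval_form _ _ _ + _]addrC addrACA; congr (_ + _).
          rewrite /deval_form scaler_sumr -sumrB; apply: eq_bigr => i _.
          rewrite dt [in RHS]scalerBr; congr (_ - _).
          by rewrite !scalerA mulrC.
        by rewrite /eval_form -sumrB; apply: eq_bigr => i _; rewrite scalerBr.
      rewrite expr2 mulrA mulrDl mulrDl; apply: le_trans (ler_normD _ _) _; apply: lerD.
        apply: le_trans (sum_coord_le u f2) _.
        have -> : m%:R * (m%:R * mM) * `|v| * `|v| = m%:R * (m%:R * mM * `|v| * `|v|) by ring.
        apply: ler_wpM2l => //; apply: ler_piMr => //.
        by rewrite -mulrA; apply: mulr_ge0 => //; exact: mulr_ge0.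
      apply: le_trans (sum_coord_le v f1) _.
      by rewrite -!mulrA.
    have kB : `|k t| <= n%:R * (2 * one * mM) * `|v|.
      have := tI; rewrite in_itv /= => /andP[t0 t1].
      rewrite /k normrZ ger0_norm //; apply: (@le_trans _ _ `|h u t *m eval_form om p v|).
        by rewrite ler_piMl.
      apply: le_trans (mulmx_norm_le _ _) _.
      have -> : n%:R * (2 * one * mM) * `|v| = n%:R * (2 * one * (mM * `|v|)) by ring.
      by apply: ler_wpM2l => //; apply: ler_pM => //; [exact: hB|exact: beval].
    have -> : 2^-1 * C * `|v| ^+ 2 = n%:R * (2 * one * (C2 * `|v| ^+ 2)) +
        n%:R * (n%:R * (2 * one * mM) * `|v| * (C1 * `|v|)).
      by rewrite /C; field.
    rewrite /e; apply: le_trans (ler_normD _ _) _.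
    apply: lerD; apply: le_trans (mulmx_norm_le _ _) _; rewrite ler_wpM2l // ler_pM //.
    exact: hB.
  have rr0 : rr 0 = 0 by rewrite /rr h0 h0' /k scale0r subrr subr0.
  have := linear_ode_bound (fun t tI => bn _ t uvr tI) rr0 rD eB I1.
  rewrite /rr /k !scale1r; move/le_trans; apply.
  by rewrite le_eqVlt; apply/orP; left; apply/eqP; field.
have g0 : g x0 = 1%:M.
  rewrite /g subrr; have [|h0 hD] := hP 0; first by rewrite normr0.
  have zer (t : R) : t \in `[0, 1] -> h 0 t *m b 0 t = 0.
    move=> tI; suff -> : b 0 t = 0 by rewrite mulmx0.
    by rewrite /b /eval_form big1 // => i _; rewrite mxE scale0r.
  have := @unit_mean_value_le _ _ _ (h 0) (fun t => h 0 t *m b 0 t) 0 1 I1 hD.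
  rewrite h0 => H; apply/eqP; rewrite -subr_eq0 -normr_le0; apply: H => s sI.
  by rewrite zer // normr0.
have gD x : ball x0 r x -> differentiable g x /\ forall v, 'D_v g x = g x *m eval_form om x v.
  move=> xr; have ur : `|x - x0| < r by move: xr; rewrite -ball_normE /= distrC.
  have [C [C0 CP]] := key _ ur.
  have lin : linear (fun v => g x *m eval_form om x v).
    by move=> a v w; rewrite eval_formD eval_formZ mulmxDr scalemxAr.
  pose L : {linear E -> 'M[R]_n} := HB.pack (fun v => g x *m eval_form om x v)
    (GRing.isLinear.Build _ _ _ _ _ lin).
  have [gx gE] : differentiable g x /\ 'd g x = L :> (E -> 'M[R]_n).
    apply: diff_near_intro; first exact: linear_mx_continuous.
    have nb : \forall v \near (0 : E), ball x0 r (v + x).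
      exact: cvg_shift0 (open_nbhs_nbhs (conj (ball_open x0 r) xr)).
    move=> e e0; have nb' : \forall v \near (0 : E), `|v| < e / (C + 1).
      by apply: nbhs0_lt; rewrite divr_gt0 // ltr_wpDl.
    near=> v.
    have E1 : x - x0 + v = v + x - x0 by rewrite addrC addrA.
    have E2 : x0 + (x - x0) = x by rewrite addrC subrK.
    have := CP v; rewrite E1 E2 => H; apply: le_trans (H _) _.
      suff : ball x0 r (v + x) by rewrite -ball_normE /= distrC.
      by near: v.
    rewrite expr2 mulrA ler_wpM2r //.
    have : `|v| <= e / (C + 1).
      by apply/ltW; near: v.
    rewrite ler_pdivlMr ?ltr_wpDl // mulrDr mulr1 mulrC; apply: le_trans.
    by rewrite lerDl.
  by split=> // v; rewrite deriveE // gE.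
exists r, g; split => //; first by move=> x /B[].
have oB : open (ball x0 r) by exact: ball_open.
elim=> [|k IH].
  by move=> x /gD[gx _]; exact: differentiable_continuous.
split=> [x /gD[]//|v].
apply: (@Ck_ext _ _ _ _ _ (fun x => g x *m eval_form om x v)) => // [x /gD[_ ->]//|].
apply: Ck_mulmx => //; apply: Ck_sum => // i _; apply: Ck_scale => //; first exact: Ck_cst.
by apply: Ck_sub (oS i k) => x /B[].
Unshelve. all: by end_near. Qed.

End FlatConnection.

(** * Charts and the exterior derivative *)

Section Charts.
Context {R : realType} {m : nat} {M : manifold R m}.
Implicit Types (c d : chart R m M) (p : M) (U : set M).

Lemma cinvK c x : (cmap c @` cdom c) x -> cdom c (cinv c x) /\ cmap c (cinv c x) = x.
Proof. by move=> [p cp <-]; rewrite cmapK. Qed.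

Lemma chart_imageE c U :
  cmap c @` (cdom c `&` U) = (cmap c @` cdom c) `&` (cinv c @^-1` U).
Proof.
apply/seteqP; split=> [_ [p [cp Up] <-]|x [/cinvK[cx xE] Ux]].
  by split; [exists p|rewrite /= cmapK].
by exists (cinv c x).
Qed.

Lemma chart_image_open c U : open U -> open (cmap c @` (cdom c `&` U)).
Proof.
move=> oU; rewrite chart_imageE openE => x [cx Ux]; rewrite /interior.
have cU : nbhs (cinv c x) U by exact: open_nbhs_nbhs.
exact: filterI (open_nbhs_nbhs (conj (@cimg_open _ _ _ c) cx)) (cinv_continuous cx cU).
Qed.

Lemma chart_preimage_open c (B : set 'rV[R]_m) : open B ->
  open (cdom c `&` (cmap c @^-1` B)).
Proof.
move=> oB; rewrite openE => p [cp Bp]; rewrite /interior.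
have cB : nbhs (cmap c p) B by exact: open_nbhs_nbhs.
exact: filterI (open_nbhs_nbhs (conj (@cdom_open _ _ _ c) cp)) (cmap_continuous cp cB).
Qed.

Lemma mem_chart_image c U p : cdom c p -> U p -> (cmap c @` (cdom c `&` U)) (cmap c p).
Proof. by move=> cp Up; exists p. Qed.

Lemma chart_at_image U p : U p ->
  (cmap (chart_at p) @` (cdom (chart_at p) `&` U)) (cmap (chart_at p) p).
Proof. by move=> Up; apply: mem_chart_image => //; exact: chart_at_dom. Qed.

Lemma cinv_chart_at p : cinv (chart_at p) (cmap (chart_at p) p) = p.
Proof. by rewrite cmapK //; exact: chart_at_dom. Qed.

Definition transition c d := cmap d \o cinv c.

Lemma transition_differentiable c d p : atlas c -> atlas d -> cdom c p -> cdom d p ->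
  differentiable (transition c d) (cmap c p).
Proof.
move=> ac ad cp dp; have [+ _] := atlas_smooth ac ad 1%N.
by apply; exact: mem_chart_image.
Qed.

Lemma transition_comp c d e p : cdom c p -> cdom d p -> cdom e p ->
  \forall x \near cmap c p, transition c e x = transition d e (transition c d x).
Proof.
move=> cp dp ep.
have : nbhs (cmap c p) (cmap c @` (cdom c `&` cdom d)).
  apply: open_nbhs_nbhs; split; first by apply: chart_image_open; exact: cdom_open.
  exact: mem_chart_image.
by apply: filterS => _ [q [cq dq] <-]; rewrite /transition /= cmapK // cmapK.
Qed.

Lemma jacobian_transition_comp c d e p : atlas c -> atlas d -> atlas e ->
  cdom c p -> cdom d p -> cdom e p ->
  'J (transition c e) (cmap c p) =
  'J (transition c d) (cmap c p) *m 'J (transition d e) (cmap d p).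
Proof.
move=> ac ad ae cp dp ep.
have cd := transition_differentiable ac ad cp dp.
have de := transition_differentiable ad ae dp ep.
have E : transition c d (cmap c p) = cmap d p by rewrite /transition /= cmapK.
rewrite -E in de *; rewrite -(jacobian_comp cd de).
apply: near_eq_jacobian; last exact: differentiable_comp.
by apply: filterS (transition_comp cp dp ep) => x ->.
Qed.

Lemma jacobian_transition_id c p : cdom c p -> 'J (transition c c) (cmap c p) = 1%:M.
Proof.
move=> cp; rewrite -(jacobian_id (cmap c p)); apply: near_eq_jacobian => //.
have : nbhs (cmap c p) (cmap c @` (cdom c `&` cdom c)).
  apply: open_nbhs_nbhs; split; first by apply: chart_image_open; exact: cdom_open.
  exact: mem_chart_image.
by apply: filterS => _ [q [cq _] <-]; rewrite /transition /= cmapK.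
Qed.

Lemma jacobian_transitionK c d p : atlas c -> atlas d -> cdom c p -> cdom d p ->
  'J (transition c d) (cmap c p) *m 'J (transition d c) (cmap d p) = 1%:M.
Proof.
by move=> ac ad cp dp; rewrite -jacobian_transition_comp // jacobian_transition_id.
Qed.

Lemma coefsE c (w : oneform M) p : cdom c p ->
  coefs c w (cmap c p) = 'J (transition c (chart_at p)) (cmap c p) *m w p.
Proof. by move=> cp; rewrite /coefs /transition cmapK. Qed.

Lemma coefs_transition c d (w : oneform M) p : atlas c -> atlas d ->
  cdom c p -> cdom d p ->
  coefs c w (cmap c p) = 'J (transition c d) (cmap c p) *m coefs d w (cmap d p).
Proof.
move=> ac ad cp dp; have H := jacobian_transition_comp ac ad (chart_at_atlas p) cp dp (chart_at_dom p).
apply: etrans (coefsE w cp) (etrans (congr1 (mulmx^~ (w p)) H) _).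
by apply: etrans (esym (mulmxA _ _ _)) (congr1 (mulmx _) (esym (coefsE w dp))).
Qed.

Definition dcoefs c (w : oneform M) (x : 'rV[R]_m) : 'M[R]_m :=
  \matrix_(i, j) ('D_(delta_mx 0 i) (coefs c w) x j 0 - 'D_(delta_mx 0 j) (coefs c w) x i 0).

(** The exterior derivative does not depend on the chart, because second
    derivatives of the transition maps commute. *)
Lemma dcoefs_transition c d U (w : oneform M) p : atlas c -> atlas d ->
  open U -> smooth_form U w -> U p -> cdom c p -> cdom d p ->
  dcoefs c w (cmap c p) =
  'J (transition c d) (cmap c p) *m dcoefs d w (cmap d p) *m ('J (transition c d) (cmap c p))^T.
Proof.
move=> ac ad oU wU Up cp dp; set t := transition c d; set x := cmap c p.
pose B := cmap c @` (cdom c `&` cdom d).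
have oB : open B by apply: chart_image_open; exact: cdom_open.
have Bx : B x by exact: mem_chart_image.
have tB : Csmooth B t by exact: atlas_smooth.
have tx : t x = cmap d p by rewrite /t /x /transition /= cmapK.
have tdx : differentiable t x by exact: transition_differentiable.
have cE : \near x, coefs c w x = 'J t x *m coefs d w (t x).
  apply: filterS (open_nbhs_nbhs (conj oB Bx)) => _ [q [cq dq] <-].
  have tq : t (cmap c q) = cmap d q by rewrite /t /transition /= cmapK.
  by rewrite tq; exact: coefs_transition.
have Jt : differentiable (jacobian t) x.
  by have [+ _] := Ck_jacobian oB (tB 2%N); exact.
have wd : differentiable (coefs d w) (t x).
  rewrite tx; have [+ _] := wU d ad 1%N; apply; exact: mem_chart_image.
have D i : 'D_(delta_mx 0 i) (coefs c w) x =
    'D_(delta_mx 0 i) (jacobian t) x *m coefs d w (t x) +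
    'J t x *m 'D_('D_(delta_mx 0 i) t x) (coefs d w) (t x).
  rewrite (near_eq_derive _ cE).
  have wt : differentiable (coefs d w \o t) x by exact: differentiable_comp.
  have D1 : is_derive x (delta_mx 0 i) (jacobian t) ('D_(delta_mx 0 i) (jacobian t) x).
    by split=> //; exact: diff_derivable.
  have D2 : is_derive x (delta_mx 0 i) (coefs d w \o t)
      ('D_('D_(delta_mx 0 i) t x) (coefs d w) (t x)).
    by split; [exact: diff_derivable|exact: derive_comp].
  by have [_ ->] := is_derive_mulmx D1 D2.
have sym i j k : 'D_(delta_mx 0 i) (jacobian t) x j k = 'D_(delta_mx 0 j) (jacobian t) x i k.
  have E a b : 'D_(delta_mx 0 a) (jacobian t) x b k =
      'D_(delta_mx 0 a) ('D_(delta_mx 0 b) (fun y => t y 0 k)) x.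
    rewrite (derive_entry _ _ (diff_derivable Jt)); apply: near_eq_derive.
    apply: filterS (open_nbhs_nbhs (conj oB Bx)) => y By.
    have ty : differentiable t y by have [+ _] := tB 1%N; exact.
    by rewrite jacobian_entry // (derive_entry _ _ (diff_derivable ty)).
  have tk : Ck 2 B (fun y => t y 0 k) by move: (tB 2%N) => /(Ck_mx _ _ oB); exact.
  exact: etrans (E i j) (etrans (schwarz _ _ oB Bx tk) (esym (E j i))).
pose S i j := \sum_k 'D_(delta_mx 0 i) (jacobian t) x j k * coefs d w (t x) k 0.
pose T i j := \sum_k \sum_l 'J t x j k * ('J t x i l * 'D_(delta_mx 0 l) (coefs d w) (t x) k 0).
have DE i j : 'D_(delta_mx 0 i) (coefs c w) x j 0 = S i j + T i j.
  rewrite D [LHS]mxE; congr (_ + _); first by rewrite [LHS]mxE.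
  rewrite [LHS]mxE; apply: eq_bigr => k _.
  rewrite -mulr_sumr; congr (_ * _).
  rewrite (derive_coordE _ wd) summxE; apply: eq_bigr => l _.
  by rewrite mxE -(jacobian_entry _ _ tdx).
have SE i j : S i j = S j i.
  by apply: eq_bigr => k _; congr (_ * _); exact: sym.
apply/matrixP => i j.
have -> : dcoefs c w x i j = T i j - T j i.
  by rewrite [LHS]mxE (DE i j) (DE j i) (SE i j) [S j i + T i j]addrC addrKA.
rewrite /T [X in _ - X]exchange_big -sumrB -tx [RHS]mxE; apply: eq_bigr => k _ /=.
rewrite -/t -/x [('J t x)^T _ _]mxE [X in X * _]mxE mulr_suml -sumrB; apply: eq_bigr => l _.
by rewrite [dcoefs _ _ _ _ _]mxE; ring.
Qed.

Lemma dcoefs_dform c U (w : oneform M) p : atlas c -> open U -> smooth_form U w ->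
  U p -> cdom c p ->
  dcoefs c w (cmap c p) = 'J (transition c (chart_at p)) (cmap c p) *m dform w p
    *m ('J (transition c (chart_at p)) (cmap c p))^T.
Proof.
move=> ac oU wU Up cp.
by rewrite (dcoefs_transition ac (chart_at_atlas p) oU wU Up cp (chart_at_dom p)).
Qed.

Lemma wedge_mulmx k (T : 'M[R]_(k, m)) (w w' : 'cV[R]_m) :
  T *m wedge w w' *m T^T = wedge (T *m w) (T *m w').
Proof. by rewrite /wedge mulmxBr mulmxBl !trmx_mul !mulmxA. Qed.

End Charts.

(** * Smooth functions on manifolds and flat forms *)

Section SmoothFunctions.
Context {R : realType} {m : nat} {M : manifold R m}.
Implicit Types (c d : chart R m M) (p : M) (U : set M).

Definition differentiable_at {W : normedModType R} (f : M -> W) p :=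
  differentiable (f \o cinv (chart_at p)) (cmap (chart_at p) p).

Lemma smooth_fun_differentiable {W : normedModType R} U (f : M -> W) p :
  smooth_fun U f -> U p -> differentiable_at f p.
Proof.
move=> fU Up; have [+ _] := fU _ (chart_at_atlas p) 1%N.
by apply; exact: chart_at_image.
Qed.

Lemma smooth_fun_sub {W : normedModType R} U V (f : M -> W) :
  V `<=` U -> smooth_fun U f -> smooth_fun V f.
Proof.
move=> VU fU c ac k; apply: Ck_sub (fU c ac k) => x [p [cp Vp] <-].
by exists p => //; split=> //; exact: VU.
Qed.

Lemma smooth_fun_ext {W : normedModType R} U (f g : M -> W) : open U ->
  (forall p, U p -> f p = g p) -> smooth_fun U f -> smooth_fun U g.
Proof.
move=> oU fg fU c ac k; apply: Ck_ext (fU c ac k); first exact: chart_image_open.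
by move=> _ [p [cp Up] <-]; rewrite /= cmapK //; exact: fg.
Qed.

Lemma smooth_fun_cst {W : normedModType R} U (w : W) : smooth_fun U (fun=> w).
Proof. by move=> c ac k; exact: Ck_cst. Qed.

Lemma smooth_fun_mx k n U (f : M -> 'M[R]_(k, n)) : open U ->
  smooth_fun U f <-> forall i j, smooth_fun U (fun p => f p i j).
Proof.
move=> oU; split=> [fU i j c ac l|fU c ac l].
  have oc : open (cmap c @` (cdom c `&` U)) by exact: chart_image_open.
  by have /(Ck_mx _ _ oc) := fU c ac l; exact.
by apply/Ck_mx => [|i j]; [exact: chart_image_open|exact: fU].
Qed.

Lemma smooth_fun_mulmx k n l U (f : M -> 'M[R]_(k, n)) (g : M -> 'M[R]_(n, l)) :
  open U -> smooth_fun U f -> smooth_fun U g -> smooth_fun U (fun p => f p *m g p).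
Proof.
move=> oU fU gU c ac j.
by apply: Ck_mulmx (fU c ac j) (gU c ac j); exact: chart_image_open.
Qed.

Lemma smooth_fun_invmx n U (f : M -> 'M[R]_n) :
  open U -> (forall p, U p -> f p \in unitmx) -> smooth_fun U f ->
  smooth_fun U (fun p => invmx (f p)).
Proof.
move=> oU fu fU c ac j; apply: Ck_invmx (fU c ac j); first exact: chart_image_open.
by move=> _ [p [cp Up] <-]; rewrite /= cmapK //; exact: fu.
Qed.

Lemma smooth_funM U (f g : M -> R) : open U ->
  smooth_fun U f -> smooth_fun U g -> smooth_fun U (fun p => f p * g p).
Proof.
move=> oU fU gU c ac j.
by apply: CkM (fU c ac j) (gU c ac j); exact: chart_image_open.
Qed.

Lemma smooth_funD {W : normedModType R} U (f g : M -> W) : open U ->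
  smooth_fun U f -> smooth_fun U g -> smooth_fun U (fun p => f p + g p).
Proof.
move=> oU fU gU c ac j.
by apply: CkD (fU c ac j) (gU c ac j); exact: chart_image_open.
Qed.

Lemma smooth_funN {W : normedModType R} U (f : M -> W) : open U ->
  smooth_fun U f -> smooth_fun U (fun p => - f p).
Proof.
move=> oU fU c ac j; apply: CkN (fU c ac j); exact: chart_image_open.
Qed.

Lemma smooth_funV U (f : M -> R) : open U -> (forall p, U p -> f p != 0) ->
  smooth_fun U f -> smooth_fun U (fun p => (f p)^-1).
Proof.
move=> oU f0 fU c ac j; apply: CkV (fU c ac j); first exact: chart_image_open.
by move=> _ [p [cp Up] <-]; rewrite /= cmapK //; exact: f0.
Qed.

Lemma smooth_fun_scale n k U (a : M -> R) (f : M -> 'M[R]_(n, k)) : open U ->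
  smooth_fun U a -> smooth_fun U f -> smooth_fun U (fun p => a p *: f p).
Proof.
move=> oU aU fU c ac j.
by apply: Ck_scale (aU c ac j) (fU c ac j); exact: chart_image_open.
Qed.

Lemma smooth_fun_det n U (f : M -> 'M[R]_n) : open U ->
  smooth_fun U f -> smooth_fun U (fun p => \det (f p)).
Proof.
move=> oU fU c ac j; apply: Ck_det (fU c ac j); exact: chart_image_open.
Qed.

Lemma smooth_fun_continuous {W : normedModType R} U (f : M -> W) p :
  smooth_fun U f -> U p -> {for p, continuous f}.
Proof.
move=> fU Up; have cp := chart_at_dom p.
have fc := fU _ (chart_at_atlas p) 0%N _ (chart_at_image Up).
move=> B; rewrite -[in X in nbhs X B](cinv_chart_at p) => /fc N.
have := cmap_continuous cp N.
apply: filterS2 (open_nbhs_nbhs (conj (@cdom_open _ _ _ (chart_at p)) cp)) => q cq /=.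
by rewrite cmapK.
Qed.

Lemma smooth_fun_open {W : normedModType R} U (f : M -> W) (B : set W) :
  open U -> smooth_fun U f -> open B -> open (U `&` (f @^-1` B)).
Proof.
move=> oU fU oB; rewrite openE => p [Up Bp]; rewrite /interior.
have fB : nbhs (f p) B by exact: open_nbhs_nbhs.
exact: filterI (open_nbhs_nbhs (conj oU Up)) (smooth_fun_continuous fU Up fB).
Qed.

(** One chart is enough, as the transition maps are smooth. *)
Lemma smooth_fun_chart n k c (B : set 'rV[R]_m) (G : 'rV[R]_m -> 'M[R]_(n, k)) :
  atlas c -> open B -> Csmooth B G ->
  smooth_fun (cdom c `&` (cmap c @^-1` B)) (G \o cmap c).
Proof.
move=> ac oB GB d ad j.
have oc : open (cdom c `&` (cmap c @^-1` B)) by exact: chart_preimage_open.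
apply: (Ck_comp (f := transition d c) (g := G) (B := B)) => //.
- exact: chart_image_open.
- by move=> _ [p [dp [cp Bp]] <-]; rewrite /transition /= cmapK.
- apply: Ck_sub (atlas_smooth ad ac j) => x [p [dp [cp Bp]] <-].
  by exists p.
Qed.


Lemma dfunE {W : normedModType R} (f : M -> W) p v : differentiable_at f p ->
  dfun f p v = 'D_v (f \o cinv (chart_at p)) (cmap (chart_at p) p).
Proof. by move=> fp; rewrite /dfun deriveE. Qed.

Lemma near_chart_at U p : open U -> U p ->
  \forall x \near cmap (chart_at p) p, U (cinv (chart_at p) x).
Proof.
move=> oU Up; have := open_nbhs_nbhs (conj (chart_image_open (c := chart_at p) oU) (chart_at_image Up)).
by apply: filterS => _ [q [cq Uq] <-]; rewrite cmapK.
Qed.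

Lemma dfun_ext {W : normedModType R} U (f g : M -> W) p v : open U -> U p ->
  (forall q, U q -> f q = g q) -> differentiable_at f p -> differentiable_at g p /\ dfun g p v = dfun f p v.
Proof.
move=> oU Up fg fp.
have E : \forall x \near cmap (chart_at p) p,
    (f \o cinv (chart_at p)) x = (g \o cinv (chart_at p)) x.
  by apply: filterS (near_chart_at oU Up) => x /fg.
by have [gp dE] := near_eq_diff E fp; split; rewrite // /dfun dE.
Qed.

Lemma dfun_cst {W : normedModType R} (w : W) p v : dfun (fun _ : M => w) p v = 0.
Proof.
by rewrite dfunE; [exact: derive_cst|exact: differentiable_cst].
Qed.

Lemma differentiable_at_mulmx k n l (f : M -> 'M[R]_(k, n)) (g : M -> 'M[R]_(n, l)) p :
  differentiable_at f p -> differentiable_at g p -> differentiable_at (fun q => f q *m g q) p.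
Proof.
move=> /differentiable_mx fp /differentiable_mx gp; apply/differentiable_mx => i j.
rewrite (_ : (fun _ => _) = \sum_s ((fun x => f (cinv (chart_at p) x) i s) *
    (fun x => g (cinv (chart_at p) x) s j))).
  by apply: differentiable_sum => s; apply: differentiableM; [exact: fp|exact: gp].
by apply/funext => x; rewrite fct_sumE /= mxE.
Qed.

Lemma dfun_mulmx k n l (f : M -> 'M[R]_(k, n)) (g : M -> 'M[R]_(n, l)) p v :
  differentiable_at f p -> differentiable_at g p ->
  dfun (fun q => f q *m g q) p v = dfun f p v *m g p + f p *m dfun g p v.
Proof.
move=> fp gp; have fgp := differentiable_at_mulmx fp gp; rewrite !dfunE //.
have isD (W : normedModType R) (F : M -> W) : differentiable_at F p ->
    is_derive (cmap (chart_at p) p) v (F \o cinv (chart_at p))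
      ('D_v (F \o cinv (chart_at p)) (cmap (chart_at p) p)).
  by move=> Fp; split=> //; exact: diff_derivable.
have [_] := is_derive_mulmx (isD _ _ fp) (isD _ _ gp).
by rewrite /= cinv_chart_at.
Qed.

Lemma differentiable_at_entry k n (f : M -> 'M[R]_(k, n)) p i j : differentiable_at f p -> differentiable_at (fun q => f q i j) p.
Proof. by move=> /differentiable_mx; exact. Qed.

Lemma dfun_entry k n (f : M -> 'M[R]_(k, n)) p v i j : differentiable_at f p ->
  dfun (fun q => f q i j) p v = dfun f p v i j.
Proof.
move=> fp; rewrite !dfunE //; last exact: differentiable_at_entry.
by rewrite derive_entry //; exact: diff_derivable.
Qed.

Lemma dfun_linear k n k' n' (L : {linear 'M[R]_(k, n) -> 'M[R]_(k', n')})
    (f : M -> 'M[R]_(k, n)) p v : continuous L -> differentiable_at f p ->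
  differentiable_at (L \o f) p /\ dfun (L \o f) p v = L (dfun f p v).
Proof.
move=> Lc fp; have dL x : differentiable L x by exact: linear_differentiable.
split; first exact: (@differentiable_comp _ _ _ _ (f \o cinv (chart_at p)) L).
rewrite /dfun -[L \o f \o _]/(L \o (f \o cinv (chart_at p))) diff_comp //=.
by rewrite diff_lin.
Qed.

Lemma differentiable_at_is_derive {W : normedModType R} (f : M -> W) p v : differentiable_at f p ->
  is_derive (cmap (chart_at p) p) v (f \o cinv (chart_at p)) (dfun f p v).
Proof. by move=> fp; split; [exact: diff_derivable|rewrite dfunE]. Qed.

Lemma dfunM (f g : M -> R) p v : differentiable_at f p -> differentiable_at g p ->
  dfun (fun q => f q * g q) p v = dfun f p v * g p + f p * dfun g p v.
Proof.
move=> fp gp; rewrite dfunE; last exact: differentiableM.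
have [_] := is_deriveM (differentiable_at_is_derive v fp) (differentiable_at_is_derive v gp).
by rewrite /= !cinv_chart_at addrC [_ *: dfun f p v]mulrC.
Qed.

Lemma derive_transition {W : normedModType R} (f : M -> W) c d p v :
  atlas c -> atlas d -> cdom c p -> cdom d p ->
  differentiable (f \o cinv d) (cmap d p) ->
  differentiable (f \o cinv c) (cmap c p) /\
  'D_v (f \o cinv c) (cmap c p) =
  'D_(v *m 'J (transition c d) (cmap c p)) (f \o cinv d) (cmap d p).
Proof.
move=> ac ad cp dp fd; have td := transition_differentiable ac ad cp dp.
have E : transition c d (cmap c p) = cmap d p by rewrite /transition /= cmapK.
have nE : \forall x \near cmap c p, (f \o cinv d \o transition c d) x = (f \o cinv c) x.
  have : nbhs (cmap c p) (cmap c @` (cdom c `&` cdom d)).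
    apply: open_nbhs_nbhs; split; first by apply: chart_image_open; exact: cdom_open.
    exact: mem_chart_image.
  by apply: filterS => _ [q [cq dq] <-]; rewrite /transition /= cmapK // cmapK.
rewrite -E in fd; have fc := differentiable_comp td fd.
have [fc' _] := near_eq_diff nE fc; split=> //.
rewrite -(near_eq_derive v nE) (derive_comp v td fd) -E.
by rewrite (deriveEjacobian _ td).
Qed.

Lemma derive_chart {W : normedModType R} (f : M -> W) c p v :
  atlas c -> cdom c p -> differentiable_at f p ->
  differentiable (f \o cinv c) (cmap c p) /\
  'D_v (f \o cinv c) (cmap c p) =
  dfun f p (v *m 'J (transition c (chart_at p)) (cmap c p)).
Proof.
move=> ac cp fp; rewrite (dfunE _ fp).
by apply: derive_transition => //; [exact: chart_at_atlas|exact: chart_at_dom].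
Qed.

Lemma dfun_chart {W : normedModType R} (f : M -> W) c p v :
  atlas c -> cdom c p -> differentiable (f \o cinv c) (cmap c p) ->
  differentiable_at f p /\ dfun f p v =
  'D_(v *m 'J (transition (chart_at p) c) (cmap (chart_at p) p)) (f \o cinv c) (cmap c p).
Proof.
move=> ac cp fc.
have [fp E] := derive_transition v (chart_at_atlas p) ac (chart_at_dom p) cp fc.
by split=> //; rewrite (dfunE _ fp).
Qed.

(** The mean value inequality along the segments of a ball in a chart. *)
Lemma dfun0_locally_constant k n U (f : M -> 'M[R]_(k, n)) p : open U -> U p ->
  (forall q, U q -> differentiable_at f q) -> (forall q v, U q -> dfun f q v = 0) ->
  exists V : set M, [/\ open V, V `<=` U, V p & forall q, V q -> f q = f p].
Proof.
move=> oU Up fU f0; set c := chart_at p; have cp : cdom c p by exact: chart_at_dom.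
have ac : atlas c by exact: chart_at_atlas.
have [r /= r0 rP] := (nbhs_ballP _ _).1 (open_nbhs_nbhs
  (conj (chart_image_open (c := c) oU) (mem_chart_image cp Up))).
exists (cdom c `&` (cmap c @^-1` ball (cmap c p) r)); split.
- by apply: chart_preimage_open; exact: ball_open.
- by move=> q [cq /rP[q' [cq' Uq'] E]]; rewrite -(cmapK cq) -E cmapK.
- by split=> //; exact: ballxx.
move=> q [cq qr]; pose G := f \o cinv c.
have -> : f q = G (cmap c q) by rewrite /G /= cmapK.
have -> : f p = G (cmap c p) by rewrite /G /= cmapK.
have GD x : ball (cmap c p) r x -> differentiable G x /\ forall v, 'D_v G x = 0.
  move=> /rP[q' [cq' Uq'] <-]; split=> [|v].
    by have [] := derive_chart 0 ac cq' (fU _ Uq').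
  by have [_ ->] := derive_chart v ac cq' (fU _ Uq'); rewrite f0.
have Eq : cmap c q = cmap c p + (cmap c q - cmap c p) by rewrite addrC subrK.
have qr' : ball (cmap c p) r (cmap c p + (cmap c q - cmap c p)) by rewrite -Eq.
apply/eqP; rewrite -subr_eq0 -normr_le0 {1}Eq.
have H := @mean_value_segment_le R k n m G (cmap c p) (cmap c q - cmap c p) 0.
apply: H => t tI.
  by have [] := GD _ (ball_segment (ballxx _ r0) qr' tI).
by have [_ ->] := GD _ (ball_segment (ballxx _ r0) qr' tI); rewrite normr0.
Qed.

(** Zero curvature: d om + om /\ om = 0. *)
Definition flat_form n U (om : 'I_n -> 'I_n -> oneform M) := forall p, U p ->
  forall i j, dform (om i j) p = - \sum_k wedge (om i k p) (om k j p).

Definition formval n (om : 'I_n -> 'I_n -> oneform M) p (v : 'rV[R]_m) : 'M[R]_n :=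
  \matrix_(i, j) (v *m om i j p) 0 0.

(** This is [flat_connection] in a chart; that flatness can be read off there is
    the invariance of the exterior derivative, [dcoefs_dform]. *)
Theorem flat_form_primitive n U (om : 'I_n -> 'I_n -> oneform M) p0 :
  open U -> U p0 -> (forall i j, smooth_form U (om i j)) -> flat_form U om ->
  exists (V : set M) (g : M -> 'M[R]_n),
    [/\ open V, V `<=` U, V p0, g p0 = 1%:M & smooth_fun V g] /\
    forall q v, V q -> differentiable_at g q /\ dfun g q v = g q *m formval om q v.
Proof.
move=> oU Up omU ofl; set c := chart_at p0; have cp : cdom c p0 by exact: chart_at_dom.
have ac : atlas c by exact: chart_at_atlas.
pose A := cmap c @` (cdom c `&` U).
have oA : open A by exact: chart_image_open.
have Ax : A (cmap c p0) by exact: mem_chart_image.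
pose W k (x : 'rV[R]_m) : 'M[R]_n := \matrix_(i, j) coefs c (om i j) x k 0.
have cS i j : Csmooth A (coefs c (om i j)) by exact: omU.
have WS k : Csmooth A (W k).
  move=> l; apply/Ck_mx => // i j; rewrite (_ : (fun _ => _) = fun x => coefs c (om i j) x k 0).
    by move: (cS i j l) => /(Ck_mx _ _ oA); exact.
  by apply/funext => x; rewrite mxE.
have WD l k x i j : A x -> 'D_(delta_mx 0 l) (W k) x i j =
    'D_(delta_mx 0 l) (coefs c (om i j)) x k 0.
  move=> Ax'; have [+ _] := WS k 1%N => /(_ x Ax') Wx.
  have [+ _] := cS i j 1%N => /(_ x Ax') cx.
  apply: etrans (derive_entry _ _ (diff_derivable Wx)) _.
  have -> : (fun y => W k y i j) = fun y => coefs c (om i j) y k 0.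
    by apply/funext => y; rewrite mxE.
  exact: esym (derive_entry _ _ (diff_derivable cx)).
have Wfl x : A x -> flat_at W x.
  move=> [p [cp' Up'] <-] a b; apply/matrixP => i j.
  rewrite [LHS]mxE [X in _ + X]mxE !WD; [|by exists p..].
  have := dcoefs_dform ac oU (omU i j) Up' cp'.
  move=> /matrixP/(_ a b); rewrite [LHS]mxE => ->.
  rewrite (ofl p Up' i j) mulmxN mulNmx mulmx_sumr mulmx_suml.
  rewrite [LHS]mxE summxE [RHS]mxE [X in _ = X + _]mxE [X in _ = _ + X]mxE.
  rewrite [X in _ = _ - X]mxE -!sumrB -sumrN; apply: eq_bigr => k _.
  rewrite wedge_mulmx -!(coefsE _ cp') [X in - X]mxE [X in - (X + _)]mxE [X in - (_ + X)]mxE.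
  rewrite [X in - (_ - X)]mxE !big_ord1 ![_^T _ _]mxE ![W _ _ _ _]mxE.
  by ring.
have [r [g [r0 rA g1 gD gS]]] := flat_connection oA Ax WS Wfl.
exists (cdom c `&` (cmap c @^-1` ball (cmap c p0) r)), (g \o cmap c).
have oB : open (ball (cmap c p0) r) by exact: ball_open.
split; first split.
- exact: chart_preimage_open.
- by move=> q [cq /rA[q' [cq' Uq'] E]]; rewrite -(cmapK cq) -E cmapK.
- by split=> //; exact: ballxx.
- exact: g1.
- exact: smooth_fun_chart.
move=> q v [cq qB]; have [gx gE] := gD _ qB.
have E : \forall x \near cmap c q, g x = ((g \o cmap c) \o cinv c) x.
  apply: filterS (open_nbhs_nbhs (conj oB qB)) => x /rA[q' [cq' _] <-].
  by rewrite /= cmapK.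
have [gx' _] := near_eq_diff E gx.
have [gq ->] := dfun_chart v ac cq gx'; split=> //.
rewrite -(near_eq_derive _ E) gE /=; congr (_ *m _).
apply/matrixP => i j; rewrite [RHS]mxE summxE.
have cT := jacobian_transitionK (chart_at_atlas q) ac (chart_at_dom q) cq.
have -> : om i j q = 'J (transition (chart_at q) c) (cmap (chart_at q) q) *m
    coefs c (om i j) (cmap c q).
  by rewrite (coefsE _ cq) mulmxA cT mul1mx.
rewrite mulmxA mxE; apply: eq_bigr => k _.
by rewrite [LHS]mxE [W _ _ _ _]mxE.
Qed.

End SmoothFunctions.

(** * The chain rule and embedded submanifolds *)

Section Maps.
Context {R : realType}.

Lemma tangent_chain {m n} {M : manifold R m} {N : manifold R n} {W : normedModType R}
    U (F : M -> N) (h : N -> W) p v : open U -> U p -> smooth_map U F -> differentiable_at h (F p) ->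
  differentiable_at (h \o F) p /\ dfun h (F p) (v *m tangent F p) = dfun (h \o F) p v.
Proof.
move=> oU Up [Fc FS] hF; set c := chart_at p; set d := chart_at (F p).
pose B := cmap c @` (cdom c `&` U `&` F @^-1` cdom d).
have cp : cdom c p by exact: chart_at_dom.
have dp : cdom d (F p) by exact: chart_at_dom.
have [Fd _] := FS c d (chart_at_atlas _) (chart_at_atlas _) 1%N.
have {}Fd : differentiable (cmap d \o F \o cinv c) (cmap c p) by apply: Fd; exists p.
have E : cinv c (cmap c p) = p by rewrite cmapK.
have Ed : (cmap d \o F \o cinv c) (cmap c p) = cmap d (F p) by rewrite /= E.
have nE : \forall x \near cmap c p,
    ((h \o cinv d) \o (cmap d \o F \o cinv c)) x = ((h \o F) \o cinv c) x.
  have N1 : \forall q \near p, cdom d (F q).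
    have dN : nbhs (F p) (cdom d).
      by apply: open_nbhs_nbhs; split => //; exact: cdom_open.
    exact: Fc p Up _ dN.
  have N2 : \forall x \near cmap c p, cdom d (F (cinv c x)).
    have cc : (cmap c @` cdom c) (cmap c p) by exists p.
    have Nq : nbhs (cinv c (cmap c p)) (fun q => cdom d (F q)) by rewrite E.
    exact: cinv_continuous cc _ Nq.
  by apply: filterS N2 => x dx; rewrite /= cmapK.
have hd : differentiable (h \o cinv d) ((cmap d \o F \o cinv c) (cmap c p)) by rewrite Ed.
have hFd := differentiable_comp Fd hd.
have [hFp dE] := near_eq_diff nE hFd; split=> //.
rewrite dfunE // dfunE //; rewrite -(near_eq_derive v nE).
rewrite (derive_comp v Fd hd) Ed; congr ('D_ _ _ _).
exact: esym (deriveEjacobian _ Fd).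
Qed.

Lemma tangent_chain_at {m n} {M : manifold R m} {N : manifold R n} {W : normedModType R}
    U (F : M -> N) (h : N -> W) p q v : open U -> U p -> smooth_map U F -> F p = q ->
  differentiable_at h q -> dfun h q (v *m tangent F p) = dfun (h \o F) p v.
Proof. by move=> oU Up FU <- hq; have [] := tangent_chain v oU Up FU hq. Qed.

Lemma smooth_map_euclid {m n} {M : manifold R m} U (F : M -> euclid R n) :
  open U -> smooth_fun U (F : M -> 'rV[R]_n) -> smooth_map U F.
Proof.
move=> oU FU; split=> [p Up|c d ac ->]; first exact: (smooth_fun_continuous FU Up).
by move=> k; apply: Ck_sub (FU c ac k) => x [p [[cp Up] _] <-]; exists p.
Qed.

Lemma tangent_euclid {m n} {M : manifold R m} (F : M -> euclid R n) p v :
  differentiable_at (F : M -> 'rV[R]_n) p ->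
  v *m tangent F p = dfun (F : M -> 'rV[R]_n) p v.
Proof. by move=> Fp; rewrite (dfunE _ Fp); exact: esym (deriveEjacobian _ Fp). Qed.

Lemma smooth_map_sub {m n} {M : manifold R m} {N : manifold R n} U V (F : M -> N) :
  V `<=` U -> smooth_map U F -> smooth_map V F.
Proof.
move=> VU [Fc FS]; split=> [p /VU|c d ac ad k]; first exact: Fc.
apply: Ck_sub (FS c d ac ad k) => x [p [[cp Vp] dp] <-].
by exists p => //; split=> //; split=> //; exact: VU.
Qed.

End Maps.

(** A piece of an embedded submanifold N of R^k: a smooth parametrization phi
    with a smooth left inverse psi defined in the ambient space. *)
Record slice (R : realType) (k n : nat) (N : set 'rV[R]_k) := Slice {
  amb : set 'rV[R]_k;
  dom : set 'rV[R]_n;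
  psi : 'rV[R]_k -> 'rV[R]_n;
  phi : 'rV[R]_n -> 'rV[R]_k;
  amb_open : open amb;
  dom_open : open dom;
  psi_smooth : Csmooth amb psi;
  phi_smooth : Csmooth dom phi;
  psi_dom : forall z, amb z -> N z -> dom (psi z) /\ phi (psi z) = z;
  phi_amb : forall u, dom u -> [/\ N (phi u), amb (phi u) & psi (phi u) = u]
}.

Section Submanifold.
Context {R : realType} {k n : nat} (N : set 'rV[R]_k).
Variable sl : forall z : N, slice n N.
Hypothesis sl_amb : forall z : N, amb (sl z) (\val z).

Let T : topologicalType := N : Type.

Let val_cont : continuous (\val : T -> 'rV[R]_k).
Proof. exact: initial_continuous. Qed.

Let val_inj' (x y : T) : \val x = \val y -> x = y.
Proof. exact: val_inj. Qed.

Let memN (z : T) : N (\val z). Proof. by apply: set_mem; exact: (valP z). Qed.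

Definition slice_inv (z : T) (u : 'rV[R]_n) : T :=
  match pselect (dom (sl z) u) with
  | left du => exist (fun x => x \in N) (phi (sl z) u)
      (mem_set (let: And3 Nu _ _ := phi_amb du in Nu))
  | right _ => z
  end.

Lemma val_slice_inv z u : dom (sl z) u -> \val (slice_inv z u) = phi (sl z) u.
Proof. by move=> du; rewrite /slice_inv; case: pselect. Qed.

Let slice_image z : (psi (sl z) \o \val) @` ((\val : T -> _) @^-1` amb (sl z)) = dom (sl z).
Proof.
apply/seteqP; split=> [_ [y ay <-]|u du]; first by have [] := psi_dom ay (memN y).
have [Nu au pu] := phi_amb du; exists (slice_inv z u).
  by rewrite /preimage /= val_slice_inv.
by rewrite /= val_slice_inv.
Qed.

Definition slice_chart (z : T) : chart R n T.
Proof.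
refine (@Chart R n T (\val @^-1` amb (sl z)) (psi (sl z) \o \val) (slice_inv z) _ _ _ _ _).
- by apply: open_comp; [move=> x _; exact: val_cont|exact: amb_open].
- by rewrite slice_image; exact: dom_open.
- move=> y ay; have [du E] := psi_dom ay (memN y).
  by apply: val_inj'; rewrite val_slice_inv.
- move=> y ay; apply: continuous_comp; first exact: val_cont.
  exact: (@psi_smooth _ _ _ _ (sl z) 0%N).
- rewrite slice_image => u du.
  have phic : {for u, continuous (phi (sl z))} by exact: (@phi_smooth _ _ _ _ (sl z) 0%N _ du).
  move=> A [_ [[B oB <-] Bu BA]].
  have : nbhs (phi (sl z) u) B.
    have Bu' : B (\val (slice_inv z u)) by exact: Bu.
    by apply: open_nbhs_nbhs; split=> //; rewrite -val_slice_inv.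
  move=> /phic; have := open_nbhs_nbhs (conj (@dom_open _ _ _ _ (sl z)) du).
  apply: filterS2 => w dw Bw; apply: BA.
  have : B (\val (slice_inv z w)) by rewrite val_slice_inv.
  exact.
Defined.

(** The transition maps psi \o phi are smooth because they factor through the
    ambient space. *)
Definition submanifold : manifold R n.
Proof.
refine (@Manifold R n T _ _ [set slice_chart z | z in setT] slice_chart _ _ _).
- move=> p q pq; apply: val_inj'; apply: (@norm_hausdorff _ 'rV[R]_k) => A B pA qB.
  have [x [Ax Bx]] := pq _ _ (val_cont pA) (val_cont qB).
  by exists (\val x).
- have [B cB [Bo Bb]] := @euclid_second_countable R k.
  exists [set (\val : T -> _) @^-1` b | b in B].
    exact: card_le_trans (card_image_le _ _) cB.
  split=> [_ [b Bb' <-]|x A [_ [[D oD <-] Dx DA]]].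
    by apply: open_comp; [move=> y _; exact: val_cont|exact: Bo].
  have [b [Bb' bx] bD] := Bb (\val x) _ (open_nbhs_nbhs (conj oD Dx)).
  exists ((\val : T -> _) @^-1` b); first by split=> //; exists b.
  by move=> y /bD Dy; apply: DA.
- by move=> p; exists p.
- by move=> p /=; exact: sl_amb.
- move=> _ _ [z _ <-] [z' _ <-] j.
  pose D := dom (sl z) `&` (phi (sl z) @^-1` amb (sl z')).
  have oD : open D.
    by apply: Ck_open_preimage; [exact: dom_open|exact: amb_open|exact: (@phi_smooth _ _ _ _ (sl z) 0%N)].
  apply: (@Ck_sub _ _ _ _ D).
    move=> _ [y [ay ay'] <-] /=; have [du E] := psi_dom ay (memN y).
    by split=> //; rewrite /preimage /= E.
  apply: (@Ck_ext _ _ _ _ _ (psi (sl z') \o phi (sl z))) => //.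
    by move=> u [du _]; rewrite /= val_slice_inv.
  apply: (Ck_comp (B := amb (sl z'))) => //.
  + exact: amb_open.
  + by move=> u [].
  + by apply: Ck_sub (@phi_smooth _ _ _ _ (sl z) j) => u [].
  + exact: psi_smooth.
Defined.

Lemma sub_mem (p : submanifold) : N (\val (p : T)).
Proof. exact: memN. Qed.

Lemma sub_inj (p q : submanifold) : \val (p : T) = \val (q : T) -> p = q.
Proof. exact: val_inj'. Qed.

Definition sub_val (p : submanifold) : 'rV[R]_k := \val (p : T).

Lemma sub_val_smooth l h (B : set 'rV[R]_k) (H : 'rV[R]_k -> 'M[R]_(l, h)) :
  open B -> Csmooth B H -> smooth_fun (sub_val @^-1` B) (H \o sub_val).
Proof.
move=> oB HB _ [z _ <-] j.
pose D := dom (sl z) `&` (phi (sl z) @^-1` B).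
have oD : open D.
  by apply: Ck_open_preimage => //; [exact: dom_open|exact: (@phi_smooth _ _ _ _ (sl z) 0%N)].
apply: (@Ck_sub _ _ _ _ D).
  move=> _ [y [ay By] <-] /=; have [du E] := psi_dom ay (memN y).
  by split=> //; rewrite /preimage /= E.
apply: (@Ck_ext _ _ _ _ _ (H \o phi (sl z))) => //.
  by move=> u [du _]; rewrite /= /sub_val val_slice_inv.
apply: (Ck_comp (B := B)) => //; first by move=> u [].
by apply: Ck_sub (@phi_smooth _ _ _ _ (sl z) j) => u [].
Qed.

(** The charts psi are restrictions of smooth maps of the ambient space, so it is
    enough to be smooth there. *)
Lemma sub_smooth_map {m} {M : manifold R m} U (F : M -> submanifold) : open U ->
  smooth_fun U (sub_val \o F) -> smooth_map U F.
Proof.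
move=> oU FU.
have Fc p : U p -> {for p, continuous F}.
  move=> Up A [_ [[B oB <-] Bu BA]].
  have Bv : nbhs (sub_val (F p)) B by exact: open_nbhs_nbhs.
  have N1 := smooth_fun_continuous FU Up Bv.
  by apply: (@filterS _ (nbhs p) _ _ _ _ N1) => q Bq; exact: BA.
split=> // c _ ac [z _ <-] j.
have oU' : open (U `&` F @^-1` cdom (slice_chart z)).
  rewrite openE => p [Up dp]; rewrite /interior.
  have dN : nbhs (F p) (cdom (slice_chart z)).
    exact: open_nbhs_nbhs (conj (@cdom_open _ _ _ (slice_chart z)) dp).
  exact: filterI (open_nbhs_nbhs (conj oU Up)) (Fc p Up _ dN).
rewrite -setIA; apply: (Ck_comp (f := sub_val \o F \o cinv c) (g := psi (sl z)) (B := amb (sl z))).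
- exact: chart_image_open.
- exact: amb_open.
- by move=> _ [p [cp [_ dp]] <-] /=; rewrite cmapK.
- by apply: Ck_sub (FU c ac j) => _ [p [cp [Up _]] <-]; exists p.
- exact: psi_smooth.
Qed.

Lemma sub_tangent0 {m} {M : manifold R m} U (F : M -> submanifold) p v : open U ->
  smooth_fun U (sub_val \o F) -> U p -> dfun (sub_val \o F) p v = 0 ->
  v *m tangent F p = 0.
Proof.
move=> oU FU Up F0; set z := F p.
have Fp : differentiable_at (sub_val \o F) p by exact: smooth_fun_differentiable FU Up.
have az : amb (sl z) (sub_val z) by exact: sl_amb.
have pz : differentiable (psi (sl z)) ((sub_val \o F \o cinv (chart_at p)) (cmap (chart_at p) p)).
  rewrite /= cinv_chart_at; have [+ _] := @psi_smooth _ _ _ _ (sl z) 1%N; exact.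
have D := differentiable_comp Fp pz.
apply: etrans (esym (deriveEjacobian v D)) _.
rewrite (derive_comp v Fp pz) -(dfunE _ Fp) F0.
exact: derive0.
Qed.

End Submanifold.
Arguments sub_val {R k n N sl sl_amb} p.

(** * Local diffeomorphisms and submersions *)

Section LocalEmbedding.
Context {R : realType}.

(** One pair of charts is enough. *)
Lemma smooth_map_chart {m n} {M : manifold R m} {N : manifold R n} U (F : M -> N)
    (c : chart R m M) (d : chart R n N) :
  open U -> atlas c -> atlas d -> U `<=` cdom c -> (forall p, U p -> cdom d (F p)) ->
  Csmooth (cmap c @` (cdom c `&` U)) (cmap d \o F \o cinv c) -> smooth_map U F.
Proof.
move=> oU ac ad Uc Ud fS; set f := cmap d \o F \o cinv c in fS.
have Fc p : U p -> {for p, continuous F}.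
  move=> Up A FA; have cp := Uc p Up.
  have dq : (cmap d @` cdom d) (f (cmap c p)).
    by rewrite /f /= cmapK //; exists (F p) => //; exact: Ud.
  have N1 : nbhs (cinv d (f (cmap c p))) A by rewrite /f /= !cmapK //; exact: Ud.
  have N2 := cinv_continuous dq N1.
  have N3 := fS 0%N _ (mem_chart_image cp Up) _ N2.
  have N4 := cmap_continuous cp N3.
  apply: (@filterS2 _ (nbhs p) _ _ _ _ _ N4 (open_nbhs_nbhs (conj oU Up))).
  by move=> q /= Aq Uq; move: Aq; rewrite /f /= !cmapK //; do ?exact: Ud; exact: Uc.
split=> // c' d' ac' ad' k.
have oU' : open (U `&` F @^-1` cdom d').
  rewrite openE => p [Up dp]; rewrite /interior.
  have N1 := open_nbhs_nbhs (conj (@cdom_open _ _ _ d') dp).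
  exact: filterI (open_nbhs_nbhs (conj oU Up)) (Fc p Up _ N1).
rewrite -setIA; set B := cmap c' @` _.
have oB : open B by exact: chart_image_open.
apply: (@Ck_ext _ _ _ _ _ (transition d d' \o (f \o transition c' c))) => //.
  move=> _ [p [cp [Up dp]] <-]; rewrite /transition /f /= !cmapK //; do ?exact: Ud; exact: Uc.
apply: (Ck_comp (B := cmap d @` (cdom d `&` cdom d'))) => //.
- by apply: chart_image_open; exact: cdom_open.
- move=> _ [p [cp [Up dp]] <-]; exists (F p); first by split=> //; exact: Ud.
  by rewrite /transition /f /= !cmapK //; exact: Uc.
- apply: (Ck_comp (B := cmap c @` (cdom c `&` U))) => //.
  + exact: chart_image_open.
  + move=> _ [p [cp [Up dp]] <-]; exists p; first by split=> //; exact: Uc.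
    by rewrite /transition /= cmapK.
  + apply: Ck_sub (atlas_smooth ac' ac k) => _ [p [cp [Up dp]] <-].
    by exists p => //; split=> //; exact: Uc.
- exact: atlas_smooth.
Qed.

(** The inverse function theorem in charts. *)
Theorem local_embedding {n} {M N : manifold R n} U (F : M -> N) p0 :
  open U -> U p0 -> smooth_map U F ->
  (forall v : 'rV[R]_n, v *m tangent F p0 = 0 -> v = 0) ->
  exists V, [/\ open V, V p0, V `<=` U & open_embedding V F].
Proof.
move=> oU Up FU F0; have [Fc FS] := FU.
set c := chart_at p0; set d := chart_at (F p0).
have ac : atlas c by exact: chart_at_atlas.
have ad : atlas d by exact: chart_at_atlas.
have cp : cdom c p0 by exact: chart_at_dom.
have dp : cdom d (F p0) by exact: chart_at_dom.
have oU' : open (U `&` F @^-1` cdom d).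
  rewrite openE => p [Up' dp']; rewrite /interior.
  have N1 := open_nbhs_nbhs (conj (@cdom_open _ _ _ d) dp').
  exact: filterI (open_nbhs_nbhs (conj oU Up')) (Fc p Up' _ N1).
pose A := cmap c @` (cdom c `&` (U `&` F @^-1` cdom d)).
have oA : open A by exact: chart_image_open.
have Ap : A (cmap c p0) by exists p0.
pose f := cmap d \o F \o cinv c.
have fS : Csmooth A f by have := FS c d ac ad; rewrite -setIA.
have fd : differentiable f (cmap c p0) by have [+ _] := fS 1%N; exact.
have f0 v : 'D_v f (cmap c p0) = 0 -> v = 0.
  by move=> fv; apply: F0; apply: etrans fv; exact: esym (deriveEjacobian v fd).
have [U1 [g [[oU1 U1p U1A gf gS] fo]]] := inverse_function oA Ap fS f0.
pose V := cdom c `&` (cmap c @^-1` U1).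
have oV : open V by exact: chart_preimage_open.
have VU p : V p -> U p /\ cdom d (F p).
  by move=> [cp' /U1A[q [cq [Uq dq]] E]]; rewrite -(cmapK cp') -E cmapK.
have ofU : open (f @` U1) by exact: fo.
have FVE : F @` V = cdom d `&` (cmap d @^-1` (f @` U1)).
  apply/seteqP; split=> [_ [p Vp <-]|r [dr [x U1x E]]].
    split; first by have [] := VU p Vp.
    by have [cp' U1p'] := Vp; exists (cmap c p) => //; rewrite /f /= cmapK.
  have [p [cp' _] xE] := U1A x U1x; have Vp : V p by split=> //; rewrite /preimage /= xE.
  exists p => //; have [_ dp'] := VU p Vp.
  have e : cmap d (F p) = cmap d r by rewrite -E -xE /f /= (cmapK cp').
  by rewrite -(cmapK dp') e cmapK.
exists V; split=> //; first by move=> p /VU[].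
have GF p : V p -> (cinv c \o g \o cmap d) (F p) = p.
  move=> [cp' U1p']; rewrite /= -{2}(cmapK cp') -[in RHS](gf _ U1p').
  by rewrite /f /= cmapK.
exists (cinv c \o g \o cmap d); split.
- by apply: smooth_map_sub FU => p /VU[].
- by rewrite FVE; exact: chart_preimage_open.
- exact: GF.
apply: (@smooth_map_chart _ _ _ _ _ _ d c) => //.
- by rewrite FVE; exact: chart_preimage_open.
- by rewrite FVE => r [].
- by move=> _ [p Vp <-]; rewrite GF //; have [] := Vp.
move=> k; have oI : open (cmap d @` (cdom d `&` F @` V)).
  by apply: chart_image_open; rewrite FVE; exact: chart_preimage_open.
apply: (@Ck_ext _ _ _ _ _ g) => //.
  move=> _ [_ [_ [p Vp <-]] <-] /=; have [_ dFp] := VU p Vp; rewrite cmapK //.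
  have := GF p Vp => /= E; have [cp' U1p'] := Vp.
  rewrite E -(gf _ U1p'); congr g; by rewrite /f /= cmapK.
apply: Ck_sub (gS k) => _ [_ [_ [p [cp' U1p'] <-]] <-].
by exists (cmap c p) => //; rewrite /f /= cmapK.
Qed.

(** Submersions are open: restrict to an affine subspace that the
    differential maps isomorphically. *)
Theorem submersion_open {m n} {M : manifold R m} U (q : M -> 'rV[R]_n) :
  open U -> smooth_fun U q ->
  (forall p w, U p -> exists v, dfun q p v = w) -> open (q @` U).
Proof.
move=> oU qU qs; rewrite openE => _ [p Up <-]; rewrite /interior.
set c := chart_at p; have cp : cdom c p by exact: chart_at_dom.
have ac : atlas c by exact: chart_at_atlas.
pose A := cmap c @` (cdom c `&` U); have oA : open A by exact: chart_image_open.
pose x := cmap c p; have Ax : A x by exists p.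
pose f := q \o cinv c.
have fS : Csmooth A f by exact: qU.
have fd y : A y -> differentiable f y by have [+ _] := fS 1%N; exact.
have /choice[s sP] : forall i : 'I_n, exists v, dfun q p v = delta_mx 0 i.
  by move=> i; exact: qs.
pose S : 'M[R]_(n, m) := \matrix_(i, j) s i 0 j.
have fS1 (u : 'rV_n) : 'D_(u *m S) f x = u.
  have -> : u *m S = \sum_i u 0 i *: s i.
    apply/rowP => j; rewrite mxE summxE; apply: eq_bigr => i _.
    by rewrite !mxE.
  rewrite (deriveE _ (fd x Ax)) linear_sum [RHS]row_sum_delta.
  apply: eq_bigr => i _; rewrite linearZ -(sP i) /=; congr (_ *: _).
have Lc : continuous (mulmxr S : 'rV[R]_n -> 'rV[R]_m) by exact: linear_mx_continuous.
pose l (u : 'rV[R]_n) := x + u *m S.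
have lS : Csmooth setT l.
  by move=> k; apply: CkD; [exact: openT|exact: Ck_cst|apply: Ck_mulmx;
     [exact: openT|exact: Csmooth_id|exact: Ck_cst]].
pose B := setT `&` (l @^-1` A).
have oB : open B by apply: Ck_open_preimage; [exact: openT|exact: oA|exact: (lS 0%N)].
have B0 : B 0 by split=> //; rewrite /preimage /= /l mul0mx addr0.
have phiS : Csmooth B (f \o l).
  move=> k; apply: (Ck_comp (B := A)) => //; first by move=> u [].
  exact: Ck_sub (lS k).
have l0 : l 0 = x by rewrite /l mul0mx addr0.
have phi0 v : 'D_v (f \o l) 0 = 0 -> v = 0.
  have ld : differentiable l 0 by have [+ _] := lS 1%N; exact.
  have fl : differentiable f (l 0) by rewrite l0; exact: fd.
  rewrite (derive_comp v ld fl) l0.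
  suff -> : 'D_v l 0 = v *m S by rewrite fS1.
  rewrite (_ : l = cst x + mulmxr S) // deriveD; last 2 first.
  - exact: derivable_cst.
  - by apply: diff_derivable; exact: linear_differentiable.
  rewrite derive_cst add0r deriveE; last exact: linear_differentiable.
  by rewrite diff_lin.
have [U1 [g [[oU1 U10 U1B _ _] fo]]] := inverse_function oB B0 phiS phi0.
have N1 : nbhs (q p) ((f \o l) @` U1).
  apply: open_nbhs_nbhs; split; first exact: fo.
  by exists 0 => //; rewrite /= l0 /f /x /= cmapK.
apply: (@filterS _ (nbhs (q p)) _ _ _ _ N1) => _ [u /U1B[_ [r [cr Ur] rE]] <-].
by exists r => //; rewrite /= /f -rE /= cmapK.
Qed.

End LocalEmbedding.

(** * The conformal group CO(2,2) and its Cayley transform *)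

Section LinearSmooth.
Context {R : realType} {V : normedModType R}.

Lemma Ck_linear m n p q k (A : set V) (L : {linear 'M[R]_(m, n) -> 'M[R]_(p, q)})
    (f : V -> 'M[R]_(m, n)) : open A -> Ck k A f -> Ck k A (fun x => L (f x)).
Proof.
move=> oA fA.
rewrite (_ : (fun x => L (f x)) = fun x => \sum_i \sum_j f x i j *: L (delta_mx i j)).
  apply: Ck_sum => // i _; apply: Ck_sum => // j _; apply: Ck_scale => //; last exact: Ck_cst.
  by move/(Ck_mx _ _ oA) : fA; exact.
apply/funext => x; rewrite {1}[f x]matrix_sum_delta linear_sum.
by apply: eq_bigr => i _; rewrite linear_sum; apply: eq_bigr => j _; rewrite linearZ.
Qed.

Lemma Ck_row_mx m n p k (A : set V) (f : V -> 'M[R]_(m, n)) (g : V -> 'M[R]_(m, p)) :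
  open A -> Ck k A f -> Ck k A g -> Ck k A (fun x => row_mx (f x) (g x)).
Proof.
move=> oA /(Ck_mx _ _ oA) fA /(Ck_mx _ _ oA) gA; apply/Ck_mx => // i j.
under eq_fun do rewrite mxE.
by case: (fintype.split j) => j'; [exact: fA|exact: gA].
Qed.

Lemma Ck_scalar_mx n k (A : set V) (a : V -> R) :
  open A -> Ck k A a -> Ck k A (fun x => (a x)%:M : 'M[R]_n).
Proof.
move=> oA aA; rewrite (_ : (fun _ => _) = fun x => a x *: 1%:M).
  by apply: Ck_scale => //; exact: Ck_cst.
by apply/funext => x; rewrite scalemx1.
Qed.

End LinearSmooth.

Section ConformalGroup.
Context {R : realType}.
Local Notation eta := (eta22 R).

Lemma eta_sym : eta^T = eta.
Proof.
by apply/matrixP => -[[|[|[|[|//]]]] ?] [[|[|[|[|//]]]] ?]; rewrite !mxE.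
Qed.

Lemma eta_sqr : eta *m eta = 1%:M.
Proof.
apply/matrixP => -[[|[|[|[|//]]]] ?] [[|[|[|[|//]]]] ?];
rewrite !mxE !big_ord_recl big_ord0 !mxE /=;
by rewrite ?(mulr0, mul0r, mulr1, mul1r, addr0, add0r, mulr0n, mulr1n).
Qed.

Lemma eta01 : eta 0 1 = 1. Proof. by rewrite mxE. Qed.

(** The conformal factor of g, read off at a place where [eta] has the entry 1. *)
Definition factor (g : 'M[R]_4) : R := (g^T *m eta *m g) 0 1.

Lemma CO22P (g : 'M[R]_4) :
  CO22 R g <-> 0 < factor g /\ g^T *m eta *m g = factor g *: eta.
Proof.
split=> [[s s0 gE]|[f0 gE]]; last by exists (factor g).
have -> : factor g = s by rewrite /factor gE mxE eta01 mulr1.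
by [].
Qed.

Lemma CO22_unit (g : 'M[R]_4) : CO22 R g -> g \in unitmx.
Proof.
move=> [s s0 gE]; have : (s^-1 *: (eta *m g^T *m eta)) *m g = 1%:M.
  rewrite -scalemxAl -!mulmxA (mulmxA _ _ g) gE -scalemxAr eta_sqr scalerA.
  by rewrite mulVf ?scale1r // gt_eqF.
by move=> /mulmx1_unit[].
Qed.

Lemma CO22_1 : CO22 R 1%:M.
Proof. by exists 1 => //; rewrite trmx1 mul1mx mulmx1 scale1r. Qed.

Lemma CO22_mul (g h : 'M[R]_4) :
  CO22 R g -> CO22 R h -> CO22 R (g *m h).
Proof.
move=> [s s0 gE] [t t0 hE]; exists (s * t); first exact: mulr_gt0.
have -> : (g *m h)^T *m eta *m (g *m h) = h^T *m (g^T *m eta *m g) *m h.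
  by rewrite trmx_mul !mulmxA.
rewrite gE -scalemxAr -scalemxAl hE scalerA.
exact: erefl.
Qed.

Lemma CO22_inv (g : 'M[R]_4) : CO22 R g -> CO22 R (invmx g).
Proof.
move=> Gg; have gu := CO22_unit Gg; have [s s0 gE] := Gg.
exists s^-1; first by rewrite invr_gt0.
have E : eta = s *: ((invmx g)^T *m eta *m invmx g).
  have <- : (invmx g)^T *m (g^T *m eta *m g) *m invmx g = s *: ((invmx g)^T *m eta *m invmx g).
    by rewrite gE -scalemxAr -scalemxAl.
  by rewrite -!mulmxA mulmxV // mulmx1 mulmxA -trmx_mul mulmxV // trmx1 mul1mx.
by rewrite {2}E scalerA mulVf ?scale1r // gt_eqF.
Qed.

(** The Lie algebra of the orthogonal group of [eta] consists of the matrices X for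
    which [eta *m X] is skew-symmetric, so that these matrices serve as its
    coordinates. *)
Definition skew (x : 'rV[R]_6) : 'M[R]_4 :=
  \matrix_(i, j) nth 0 (nth [::]
    [:: [:: 0; x 0 0; x 0 1; x 0 2];
        [:: - x 0 0; 0; x 0 3; x 0 4];
        [:: - x 0 1; - x 0 3; 0; x 0 5];
        [:: - x 0 2; - x 0 4; - x 0 5; 0]] i) j.

Definition skew_coord (K : 'M[R]_4) : 'rV[R]_6 :=
  \row_i nth 0 [:: K 0 1; K 0 2; K 0 3; K 1 2; K 1 3; K 2 3] i.

Lemma skewK x : skew_coord (skew x) = x.
Proof.
apply/rowP => -[[|[|[|[|[|[|//]]]]]] lt]; rewrite !mxE /=; congr (x _ _); exact: val_inj.
Qed.

Lemma skew_skew x : (skew x)^T = - skew x.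
Proof.
by apply/matrixP => -[[|[|[|[|//]]]] ?] [[|[|[|[|//]]]] ?]; rewrite !mxE /= ?oppr0 ?opprK.
Qed.

Lemma skew_coordK K : K^T = - K -> skew (skew_coord K) = K.
Proof.
move=> /matrixP Ks.
have KE i j : K j i = - K i j by have := Ks i j; rewrite !mxE.
have K0 i : K i i = 0.
  by have /eqP := KE i i; rewrite -subr_eq0 opprK -mulr2n mulrn_eq0 /= => /eqP.
apply/matrixP => i j; rewrite mxE.
have [<-|ij] := eqVneq i j.
  by rewrite K0; case: i => [[|[|[|[|//]]]] ?].
case: i ij => [[|[|[|[|//]]]] ?]; case: j => [[|[|[|[|//]]]] ?] //= _;
  rewrite !mxE /= -?KE; congr (K _ _); exact: val_inj.
Qed.

Lemma Csmooth_skew (A : set 'rV[R]_6) : open A -> Csmooth A skew.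
Proof.
move=> oA k; apply/Ck_mx => // i j; under eq_fun do rewrite mxE.
have cx l : Ck k A (fun x : 'rV[R]_6 => x 0 l).
  have /(Ck_mx _ _ oA) := @Csmooth_id R 'rV[R]_6 A k; exact.
have ncx l : Ck k A (fun x : 'rV[R]_6 => - x 0 l) by exact: CkN.
have c0 : Ck k A (fun _ : 'rV[R]_6 => 0 : R) by exact: Ck_cst.
case: i => [[|[|[|[|//]]]] ?]; case: j => [[|[|[|[|//]]]] ?];
  solve [exact: c0|exact: cx|exact: ncx].
Qed.

Lemma Ck_skew_coord {V : normedModType R} k (A : set V) (f : V -> 'M[R]_4) :
  open A -> Ck k A f -> Ck k A (fun x => skew_coord (f x)).
Proof.
move=> oA /(Ck_mx _ _ oA) fA; apply/Ck_mx => // i j; under eq_fun do rewrite mxE.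
case: j => [[|[|[|[|[|[|//]]]]]] ?] /=; exact: fA.
Qed.

End ConformalGroup.

Section Cayley.
Context {R : realType}.
Local Notation eta := (eta22 R).
Implicit Types (k X : 'M[R]_4) (a : R).

Lemma scalar_mul n a (A : 'M[R]_n) : a%:M *m A = a *: A.
Proof. exact: mul_scalar_mx. Qed.

Lemma unit_of_mul n (A B : 'M[R]_n) b : b != 0 -> A *m B = b%:M ->
  [/\ A \in unitmx, B \in unitmx & invmx A = b^-1 *: B].
Proof.
move=> b0 AB; have : A *m (b^-1 *: B) = 1%:M.
  by rewrite -scalemxAr AB scale_scalar_mx mulVf.
move=> AB1; have [Au _] := mulmx1_unit AB1; split=> //.
  have : (b^-1 *: A) *m B = 1%:M by rewrite -scalemxAl AB scale_scalar_mx mulVf.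
  by move=> /mulmx1_unit[].
by rewrite -[LHS]mulmx1 -AB1 mulKmx.
Qed.

Lemma skew_etaE X : (eta *m X)^T = - (eta *m X) <-> X^T *m eta + eta *m X = 0.
Proof.
rewrite trmx_mul eta_sym; split=> [->|/eqP]; first by rewrite addNr.
by rewrite addr_eq0 => /eqP.
Qed.

(** If a^2 is the factor of k, then k / a is orthogonal, and the Cayley transform
    (k / a - 1) / (k / a + 1) lies in the Lie algebra of the orthogonal group.
    The scaling by a is kept inside, to avoid the division. *)
Lemma cayley_of_group k a : 0 < a -> k^T *m eta *m k = a ^+ 2 *: eta ->
  k + a%:M \in unitmx -> let X := (k - a%:M) *m invmx (k + a%:M) in
  [/\ (eta *m X)^T = - (eta *m X), 1%:M - X \in unitmx &
      a *: ((1%:M + X) *m invmx (1%:M - X)) = k].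
Proof.
move=> a0 kE; set P := k + a%:M => Pu X; set M := k - a%:M.
have XP : X *m P = M by rewrite /X mulmxKV.
clearbody X.
have a20 : a *+ 2 != 0 by rewrite mulrn_eq0 /= gt_eqF.
have XmP : (1%:M - X) *m P = (a *+ 2)%:M.
  rewrite mulmxBl mul1mx XP /P /M; apply/matrixP => i j; rewrite !mxE.
  by case: (i == j); rewrite ?mulr1n ?mulr0n; ring.
have XpP : (1%:M + X) *m P = k *+ 2.
  by rewrite mulmxDl mul1mx XP /P /M addrACA subrr addr0 mulr2n.
have [Xu _ XI] := unit_of_mul a20 XmP.
split=> //.
  apply/skew_etaE.
  have H : P^T *m (X^T *m eta + eta *m X) *m P = 0.
    have H1 : P^T *m X^T = M^T by rewrite -trmx_mul XP.
    rewrite mulmxDr mulmxDl !mulmxA H1 -[_ *m X *m P]mulmxA XP.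
    have E (b c : R) : (k + b%:M)^T *m eta *m (k + c%:M) =
        a ^+ 2 *: eta + c *: (k^T *m eta) + b *: (eta *m k) + (b * c) *: eta.
      have -> : (k + b%:M)^T = k^T + b%:M by apply/matrixP => i j; rewrite !mxE eq_sym.
      rewrite (mulmxDl k^T) scalar_mul mulmxDr mul_mx_scalar.
      rewrite mulmxDl kE -scalemxAl scalerDr scalerA [b * c]mulrC !addrA.
      by congr (_ + _); rewrite addrAC.
    have Mn : M = k + (- a)%:M by rewrite /M raddfN.
    rewrite Mn /P !E.
    move: (k^T *m eta) (eta *m k) eta => u w e.
    by apply/matrixP => i j; rewrite !mxE; ring.
  have := congr1 (fun A => invmx P^T *m A *m invmx P) H.
  by rewrite mulmx0 mul0mx mulmxA mulKmx ?unitmx_tr // mulmxK.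
by rewrite XI -scalemxAr XpP scalerA -scalerMnr scalerMnl -mulrnAl divff // scale1r.
Qed.

(** The inverse Cayley transform (1 + X) / (1 - X) is orthogonal because 1 + X and
    1 - X are exchanged, up to transposition, by [eta]. *)
Lemma cayley_of_algebra X a : 0 < a -> (eta *m X)^T = - (eta *m X) ->
  1%:M - X \in unitmx -> let k := a *: ((1%:M + X) *m invmx (1%:M - X)) in
  [/\ k^T *m eta *m k = a ^+ 2 *: eta, k + a%:M \in unitmx &
      (k - a%:M) *m invmx (k + a%:M) = X].
Proof.
move=> a0 /skew_etaE Xs Xu k.
have kX : k *m (1%:M - X) = a *: (1%:M + X) by rewrite /k -scalemxAl mulmxKV.
have a20 : a *+ 2 != 0 by rewrite mulrn_eq0 /= gt_eqF.
have PX : (k + a%:M) *m (1%:M - X) = (a *+ 2)%:M.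
  rewrite mulmxDl kX scalar_mul; apply/matrixP => i j; rewrite !mxE.
  by case: (i == j); rewrite ?mulr1n ?mulr0n; ring.
have MX : (k - a%:M) *m (1%:M - X) = (a *+ 2) *: X.
  rewrite mulmxBl kX scalar_mul; apply/matrixP => i j; rewrite !mxE.
  by case: (i == j); rewrite ?mulr1n ?mulr0n; ring.
have [Pu _ PI] := unit_of_mul a20 PX.
split=> //.
  have H : (1%:M - X)^T *m (k^T *m eta *m k) *m (1%:M - X) =
      (1%:M - X)^T *m (a ^+ 2 *: eta) *m (1%:M - X).
    have E : (1%:M + X)^T *m eta *m (1%:M + X) = (1%:M - X)^T *m eta *m (1%:M - X).
      have -> : (1%:M + X)^T = 1%:M + X^T by apply/matrixP => i j; rewrite !mxE eq_sym.
      have -> : (1%:M - X)^T = 1%:M - X^T by apply/matrixP => i j; rewrite !mxE eq_sym.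
      rewrite !(mulmxDr, mulmxDl, mulmxBr, mulmxBl, mulNmx, mulmxN, mul1mx, mulmx1).
      move: Xs; move: (X^T *m eta *m X) (X^T *m eta) (eta *m X) eta => v u w e uw.
      by apply/matrixP => i j; move/matrixP/(_ i j) : uw; rewrite !mxE; lra.
    have -> : (1%:M - X)^T *m (k^T *m eta *m k) *m (1%:M - X) =
        (k *m (1%:M - X))^T *m eta *m (k *m (1%:M - X)) by rewrite trmx_mul !mulmxA.
    have -> : (k *m (1%:M - X))^T = a *: (1%:M + X)^T.
      by rewrite kX; apply/matrixP => i j; rewrite !mxE.
    by rewrite kX -!scalemxAl -!scalemxAr scalerA -expr2 E -scalemxAl.
  have := congr1 (fun A => invmx (1%:M - X)^T *m A *m invmx (1%:M - X)) H.
  by rewrite !mulmxA !mulVmx ?unitmx_tr // !mul1mx -!mulmxA !mulmxV // !mulmx1 !mulmxA.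
by rewrite PI -scalemxAr MX scalerA mulVf ?scale1r.
Qed.

End Cayley.

(** * The bundle of motions *)

Section Bundle.
Context {R : realType}.
Local Notation eta := (eta22 R).
Local Notation amb_t := 'rV[R]_(4 * 4 + 4).
Local Notation loc_t := 'rV[R]_(4 + (1 + 6)).

Definition lin_part (z : amb_t) : 'M[R]_4 := vec_mx (lsubmx z).
Definition tr_part (z : amb_t) : 'rV[R]_4 := rsubmx z.
Definition pack (g : 'M[R]_4) (y : 'rV[R]_4) : amb_t := row_mx (mxvec g) y.

Lemma pack_lin g y : lin_part (pack g y) = g.
Proof. by rewrite /lin_part /pack row_mxKl mxvecK. Qed.

Lemma pack_tr g y : tr_part (pack g y) = y.
Proof. by rewrite /tr_part /pack row_mxKr. Qed.

Lemma packK z : pack (lin_part z) (tr_part z) = z.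
Proof. by rewrite /pack /lin_part vec_mxK hsubmxK. Qed.

Section Smoothness.
Context {V : normedModType R} (A : set V) (oA : open A) (k : nat).

Lemma Ck_lin_part (f : V -> amb_t) : Ck k A f -> Ck k A (fun x => lin_part (f x)).
Proof. by move=> fA; apply: Ck_linear => //; exact: Ck_linear. Qed.

Lemma Ck_tr_part (f : V -> amb_t) : Ck k A f -> Ck k A (fun x => tr_part (f x)).
Proof. exact: Ck_linear. Qed.

Lemma Ck_pack (f : V -> 'M[R]_4) (g : V -> 'rV[R]_4) : Ck k A f -> Ck k A g ->
  Ck k A (fun x => pack (f x) (g x)).
Proof. by move=> fA gA; apply: Ck_row_mx => //; exact: Ck_linear. Qed.

End Smoothness.

Definition affine_group : set amb_t := [set z | CO22 R (lin_part z)].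

Section CayleyChart.
Variable g0 : 'M[R]_4.
Hypothesis Gg0 : CO22 R g0.

Let kpart z := invmx g0 *m lin_part z.
Let scale z := Num.sqrt (factor (kpart z)).
Let den z := kpart z + (scale z)%:M.
Let num z := kpart z - (scale z)%:M.
Let pos : set amb_t := setT `&` ((factor \o kpart) @^-1` [set s | 0 < s]).
Let U : set amb_t := pos `&` ((fun z => \det (den z)) @^-1` [set s | s != 0]).

(** A motion with linear part g0 k is described by its translation, the square
    root a of the factor of k and the Cayley transform of k / a. *)
Definition cayley_coord (z : amb_t) : loc_t :=
  row_mx (tr_part z) (row_mx (scale z)%:M (skew_coord (eta *m (num z *m invmx (den z))))).

Let us (u : loc_t) : R := lsubmx (rsubmx u) 0 0.
Let uX (u : loc_t) : 'M[R]_4 := eta *m skew (rsubmx (rsubmx u)).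
Let D : set loc_t := ([set u | 0 < us u]) `&` ((fun u => \det (1%:M - uX u)) @^-1` [set s | s != 0]).

Definition cayley_param (u : loc_t) : amb_t :=
  pack (g0 *m (us u *: ((1%:M + uX u) *m invmx (1%:M - uX u)))) (lsubmx u).

Let kS k : Ck k setT kpart.
Proof.
apply: Ck_mulmx; [exact: openT|exact: Ck_cst|].
by apply: Ck_lin_part; [exact: openT|exact: Csmooth_id].
Qed.

Let open_pos : open [set s : R | 0 < s].
Proof. exact: open_gt. Qed.

Let open_neq0 : open [set s : R | s != 0].
Proof. exact: open_neq. Qed.

Let factorS k : Ck k setT (factor \o kpart).
Proof.
have kk : Ck k setT (fun z => (kpart z)^T *m eta *m kpart z).
  have oT := @openT amb_t.
  apply: (Ck_mulmx oT _ (kS k)).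
  exact: (Ck_mulmx oT (Ck_trmx oT (kS k)) (Ck_cst _ _ _)).
by have /(Ck_mx _ _ (@openT _)) := kk; exact.
Qed.

Let oP : open pos.
Proof. by apply: Ck_open_preimage; [exact: openT|exact: open_pos|exact: factorS]. Qed.

Let scaleS k : Ck k pos scale.
Proof.
apply: Ck_sqrt; first exact: oP; first by move=> z [].
by apply: Ck_sub (factorS k) => z [].
Qed.

Let sS k : Ck k pos (fun z => (scale z)%:M : 'M[R]_4).
Proof. by apply: Ck_scalar_mx; [exact: oP|exact: scaleS]. Qed.

Let denS k : Ck k pos den.
Proof. by apply: CkD; [exact: oP|apply: Ck_sub (kS k) => z []|exact: sS]. Qed.

Let numS k : Ck k pos num.
Proof.
apply: CkD; [exact: oP|by apply: Ck_sub (kS k) => z []|].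
by apply: CkN; [exact: oP|exact: sS].
Qed.

Let oU : open U.
Proof.
apply: Ck_open_preimage; [exact: oP|exact: open_neq0|].
by apply: Ck_det; [exact: oP|exact: denS].
Qed.

Let Upos : U `<=` pos. Proof. by move=> z []. Qed.

Let coordS : Csmooth U cayley_coord.
Proof.
move=> k; apply: Ck_row_mx => //.
  by apply: Ck_tr_part => //; exact: Csmooth_id.
apply: Ck_row_mx => //; first by apply: Ck_scalar_mx => //; apply: Ck_sub (scaleS k).
apply: Ck_skew_coord => //; apply: Ck_mulmx => //; first exact: Ck_cst.
apply: Ck_mulmx => //; first exact: Ck_sub (numS k).
apply: Ck_invmx => //; last exact: Ck_sub (denS k).
by move=> z [_ /= d0]; rewrite unitmxE unitfE.
Qed.

Let idS k : Ck k setT (fun u : loc_t => u). Proof. exact: Csmooth_id. Qed.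

Let rS k : Ck k setT (fun u : loc_t => rsubmx u : 'rV_(1 + 6)).
Proof. by apply: Ck_linear; [exact: openT|exact: idS]. Qed.

Let lS k : Ck k setT (fun u : loc_t => lsubmx u : 'rV_4).
Proof. by apply: Ck_linear; [exact: openT|exact: idS]. Qed.

Let usS k : Ck k setT us.
Proof.
have oT := @openT loc_t.
have H : Ck k setT (fun u : loc_t => lsubmx (rsubmx u)).
  exact: Ck_linear oT (rS k).
by have /(Ck_mx _ _ oT) := H; exact.
Qed.

Let uXS k : Ck k setT uX.
Proof.
have oT := @openT loc_t.
apply: Ck_mulmx => //; first exact: Ck_cst.
apply: (Ck_comp (f := fun u : loc_t => rsubmx (rsubmx u)) (g := skew) (B := setT)) => //.
- exact: openT.
- exact: Ck_linear oT (rS k).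
- by apply: Csmooth_skew; exact: openT.
Qed.

Let mS k : Ck k setT (fun u => 1%:M - uX u).
Proof.
have oT := @openT loc_t.
by apply: CkD => //; [exact: Ck_cst|apply: CkN => //; exact: uXS].
Qed.

Let oD : open D.
Proof.
have oT := @openT loc_t.
rewrite (_ : D = (setT `&` us @^-1` [set s | 0 < s]) `&`
  (setT `&` ((fun u => \det (1%:M - uX u)) @^-1` [set s | s != 0]))); last first.
  by rewrite /D !setTI.
apply: openI; first exact: (Ck_open_preimage oT open_pos (usS 0)).
exact: (Ck_open_preimage oT open_neq0 (Ck_det oT (mS 0))).
Qed.

Let paramS : Csmooth D cayley_param.
Proof.
move=> k; apply: Ck_pack => //; last exact: Ck_sub (lS k).
apply: Ck_mulmx => //; first exact: Ck_cst.
apply: Ck_scale => //; first exact: Ck_sub (usS k).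
apply: Ck_mulmx => //.
  by apply: CkD => //; [exact: Ck_cst|exact: Ck_sub (uXS k)].
apply: Ck_invmx => //; last exact: Ck_sub (mS k).
by move=> z [_ /= d0]; rewrite unitmxE unitfE.
Qed.

Let etaetaK (X : 'M[R]_4) : eta *m (eta *m X) = X.
Proof. by rewrite mulmxA eta_sqr mul1mx. Qed.

Let coord_dom z : U z -> affine_group z ->
  D (cayley_coord z) /\ cayley_param (cayley_coord z) = z.
Proof.
move=> [[_ fz] /= dz] Gz.
have /CO22P[_ kE] : CO22 R (kpart z) by apply: CO22_mul => //; exact: CO22_inv.
have s0 : 0 < scale z by rewrite sqrtr_gt0.
have {}kE : (kpart z)^T *m eta *m kpart z = scale z ^+ 2 *: eta.
  by rewrite kE /scale sqr_sqrtr // ltW.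
have Pu : kpart z + (scale z)%:M \in unitmx by rewrite unitmxE unitfE.
have [Xs Xu XE] := cayley_of_group s0 kE Pu.
have usE : us (cayley_coord z) = scale z.
  by rewrite /us /cayley_coord row_mxKr row_mxKl mxE mulr1n.
have uXE : uX (cayley_coord z) = num z *m invmx (den z).
  by rewrite /uX /cayley_coord !row_mxKr skew_coordK.
split; first split.
- by rewrite /= usE.
- by rewrite /= uXE -unitfE -unitmxE.
rewrite /cayley_param usE uXE XE /cayley_coord row_mxKl /kpart mulKVmx ?packK //.
exact: CO22_unit.
Qed.

Let param_amb u : D u ->
  [/\ affine_group (cayley_param u), U (cayley_param u) & cayley_coord (cayley_param u) = u].
Proof.
move=> [/= s0 d0].
have Xu : 1%:M - uX u \in unitmx by rewrite unitmxE unitfE.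
have Xs : (eta *m uX u)^T = - (eta *m uX u) by rewrite /uX etaetaK skew_skew.
have [kE Pu XE] := cayley_of_algebra s0 Xs Xu.
have g0u := CO22_unit Gg0.
have kp : kpart (cayley_param u) = us u *: ((1%:M + uX u) *m invmx (1%:M - uX u)).
  by rewrite /kpart /cayley_param pack_lin mulKmx.
have fE : factor (kpart (cayley_param u)) = us u ^+ 2.
  by rewrite /factor kp kE mxE eta01 mulr1.
have sE : scale (cayley_param u) = us u.
  by rewrite /scale fE sqrtr_sqr gtr0_norm.
split.
- rewrite /affine_group /= /cayley_param pack_lin; apply: CO22_mul => //.
  by exists (us u ^+ 2); [rewrite exprn_gt0|].
- split; first by split=> //; rewrite /preimage /= fE exprn_gt0.
  by rewrite /preimage /= /den kp sE -unitfE -unitmxE.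
rewrite /cayley_coord sE /num /den kp sE XE etaetaK skewK.
rewrite /cayley_param pack_tr.
rewrite -[RHS]hsubmxK -[in RHS](hsubmxK (rsubmx u)); congr (row_mx _ (row_mx _ _)).
by apply/matrixP => i j; rewrite !ord1 mxE mulr1n.
Qed.

Definition cayley_slice : slice (4 + (1 + 6)) affine_group :=
  Slice oU oD coordS paramS coord_dom param_amb.

Lemma cayley_slice_amb y : amb cayley_slice (pack g0 y).
Proof.
have g0u := CO22_unit Gg0.
have kp : kpart (pack g0 y) = 1%:M by rewrite /kpart pack_lin mulVmx.
have f1 : factor (1%:M : 'M[R]_4) = 1 by rewrite /factor trmx1 mul1mx mulmx1 eta01.
split; first by split=> //; rewrite /preimage /= kp f1.
by rewrite /preimage /= /den kp /scale kp f1 sqrtr1 -raddfD det_scalar expf_neq0 //.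
Qed.

End CayleyChart.

Lemma affine_group_lin (z : affine_group) : CO22 R (lin_part (\val z)).
Proof. exact: (set_mem (valP z)). Qed.

Definition group_slice (z : affine_group) : slice (4 + (1 + 6)) affine_group :=
  cayley_slice (affine_group_lin z).

Lemma group_slice_amb (z : affine_group) : amb (group_slice z) (\val z).
Proof. by have := cayley_slice_amb (affine_group_lin z) (tr_part (\val z)); rewrite packK. Qed.

(** The group of motions x |-> g x + y with g in CO(2,2), as the total space of
    a bundle over the space of translations y. *)
Definition motions : manifold R 11 := submanifold group_slice_amb.

Definition base_proj (q : motions) : euclid R 4 := tr_part (sub_val q).
Definition fibre_coord (q : motions) : 'M[R]_4 := lin_part (sub_val q).

(** The motions carry a proof of membership in the group; the default value [q0]
    makes this a total function of the matrix [g]. *)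
Definition mk_motion (q0 : motions) (g : 'M[R]_4) (y : 'rV[R]_4) : motions :=
  match pselect (CO22 R g) with
  | left Gg => exist (fun z => z \in affine_group) (pack g y)
     (mem_set (eq_ind_r (CO22 R) Gg (pack_lin g y) : affine_group (pack g y)))
  | right _ => q0
  end.

Lemma mk_motion_val q0 g y : CO22 R g -> sub_val (mk_motion q0 g y) = pack g y.
Proof. by move=> Gg; rewrite /mk_motion; case: pselect. Qed.

Lemma fibre_coord_group q : CO22 R (fibre_coord q).
Proof. exact: (@sub_mem _ _ _ _ _ group_slice_amb q). Qed.

Lemma mk_motion_fibre q0 g y : CO22 R g -> fibre_coord (mk_motion q0 g y) = g.
Proof. by move=> Gg; rewrite /fibre_coord mk_motion_val // pack_lin. Qed.

Lemma mk_motion_base q0 g y : CO22 R g -> base_proj (mk_motion q0 g y) = y.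
Proof. by move=> Gg; rewrite /base_proj mk_motion_val // pack_tr. Qed.

Lemma motion_eq (p q : motions) :
  base_proj p = base_proj q -> fibre_coord p = fibre_coord q -> p = q.
Proof.
by move=> E1 E2; apply: sub_inj; rewrite -[LHS]packK -[RHS]packK; congr pack.
Qed.

Definition motion_act (q : motions) (g : 'M[R]_4) : motions :=
  mk_motion q (fibre_coord q *m g) (base_proj q).

Lemma motion_act_fibre q g : CO22 R g -> fibre_coord (motion_act q g) = fibre_coord q *m g.
Proof. by move=> Gg; apply: mk_motion_fibre; apply: CO22_mul => //; exact: fibre_coord_group. Qed.

Lemma motion_act_base q g : CO22 R g -> base_proj (motion_act q g) = base_proj q.
Proof. by move=> Gg; apply: mk_motion_base; apply: CO22_mul => //; exact: fibre_coord_group. Qed.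

Lemma base_proj_smooth : smooth_fun setT (base_proj : motions -> 'rV[R]_4).
Proof.
have oT : open [set: 'rV[R]_(4 * 4 + 4)] by exact: openT.
apply: (@sub_val_smooth _ _ _ _ _ group_slice_amb _ _ setT tr_part oT) => k.
by apply: Ck_tr_part => //; exact: Csmooth_id.
Qed.

Lemma fibre_coord_smooth : smooth_fun setT fibre_coord.
Proof.
have oT : open [set: 'rV[R]_(4 * 4 + 4)] by exact: openT.
apply: (@sub_val_smooth _ _ _ _ _ group_slice_amb _ _ setT lin_part oT) => k.
by apply: Ck_lin_part => //; exact: Csmooth_id.
Qed.

Lemma motion_smooth_map {m} {M : manifold R m} U (F : M -> motions) : open U ->
  smooth_fun U (fibre_coord \o F) -> smooth_fun U (base_proj \o F : M -> 'rV[R]_4) ->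
  smooth_fun U (sub_val \o F).
Proof.
move=> oU fU bU c ac k; have oc : open (cmap c @` (cdom c `&` U)) by exact: chart_image_open.
rewrite (_ : (sub_val \o F) \o cinv c =
  fun x => pack (((fibre_coord \o F) \o cinv c) x) (((base_proj \o F) \o cinv c) x)).
  by apply: Ck_pack => //; [exact: fU|exact: bU].
by apply/funext => x; rewrite /= packK.
Qed.

Lemma motion_tangent0 {m} {M : manifold R m} U (F : M -> motions) p v : open U -> U p ->
  smooth_fun U (fibre_coord \o F) -> smooth_fun U (base_proj \o F : M -> 'rV[R]_4) ->
  dfun (fibre_coord \o F) p v = 0 -> dfun (base_proj \o F : M -> 'rV[R]_4) p v = 0 ->
  v *m tangent F p = 0.
Proof.
move=> oU Up fU bU f0 b0; have FU := motion_smooth_map oU fU bU.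
apply: (sub_tangent0 oU FU Up).
have Fp : differentiable_at (sub_val \o F) p by exact: smooth_fun_differentiable FU Up.
pose L1 : {linear amb_t -> 'rV[R]_(4 * 4)} := @lsubmx R 1 (4 * 4) 4.
pose L2 : {linear 'rV[R]_(4 * 4) -> 'M[R]_4} := @vec_mx R 4 4.
pose L3 : {linear amb_t -> 'rV[R]_4} := @rsubmx R 1 (4 * 4) 4.
have [d1 E1] := dfun_linear v (@linear_mx_continuous _ _ _ L1) Fp.
have [_ E2] := dfun_linear v (@linear_mx_continuous _ _ _ L2) d1.
have [_ E3] := dfun_linear v (@linear_mx_continuous _ _ _ L3) Fp.
rewrite -[LHS]hsubmxK -[RHS](@hsubmxK _ 1 (4 * 4) 4 0); congr row_mx.
  have Z : vec_mx (lsubmx (dfun (sub_val \o F) p v)) = 0 :> 'M[R]_4.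
    by move: E2; rewrite E1 /= => <-; exact: f0.
  by rewrite -[LHS]vec_mxK Z linear0; apply/rowP => j; rewrite !mxE.
by move: E3 => /= <-; rewrite (_ : rsubmx 0 = 0); [exact: b0|apply/rowP => j; rewrite !mxE].
Qed.

(** The bundle is trivial: [fibre_coord] is a trivialization over the whole base.
    The projection is a submersion because it has a section through every
    motion, with constant linear part. *)
Theorem motions_principal : principal_bundle (CO22 R) base_proj motion_act.
Proof.
have bS := base_proj_smooth; have fS := fibre_coord_smooth.
have oT : open [set: motions] by exact: openT.
have dT0 (q : motions) v : v *m tangent base_proj q = 0 -> dfun fibre_coord q v = 0 -> v = 0.
  move=> b0 f0.
  have : v *m tangent (id : motions -> motions) q = 0.
    apply: (motion_tangent0 oT (U := setT)) => //.
    by rewrite -b0; apply/esym/tangent_euclid; exact: smooth_fun_differentiable bS _.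
  by rewrite -[tangent id q]/('J (transition _ _) _) jacobian_transition_id ?mulmx1 //;
     exact: chart_at_dom.
split.
- split; first exact: smooth_map_euclid.
  move=> q _.
  pose sec (y : euclid R 4) : motions := mk_motion q (fibre_coord q) y.
  have Gq := fibre_coord_group q.
  have oE : open [set: euclid R 4] by exact: openT.
  have secS : smooth_map setT sec.
    apply: (@sub_smooth_map _ _ _ _ _ group_slice_amb _ _ _ _ oE); apply: motion_smooth_map => //.
      rewrite (_ : _ \o _ = fun=> fibre_coord q); first exact: smooth_fun_cst.
      by apply/funext => y; rewrite /= mk_motion_fibre.
    rewrite (_ : _ \o _ = id); last by apply/funext => y; rewrite /= mk_motion_base.
    by move=> c -> k; exact: Csmooth_id.
  have bq : differentiable_at (base_proj : motions -> 'rV[R]_4) q by exact: smooth_fun_differentiable bS _.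
  have sq : sec (base_proj q) = q.
    by apply: motion_eq; [rewrite mk_motion_base|rewrite mk_motion_fibre].
  apply/row_fullP; exists (tangent sec (base_proj q)).
  apply/row_matrixP => i; rewrite !rowE mulmx1.
  set e := delta_mx 0 i : 'rV_4.
  have E := tangent_chain_at e oE I secS sq bq.
  rewrite mulmxA; apply: etrans (tangent_euclid _ bq) _.
  apply: etrans E _.
  rewrite (_ : _ \o _ = id); last by apply/funext => y; rewrite /= mk_motion_base.
  by rewrite dfunE //; exact: derive_id.
- move=> q; have G1 := @CO22_1 R.
  by apply: motion_eq; [exact: motion_act_base|rewrite motion_act_fibre // mulmx1].
- move=> q g h Gg Gh; have Ggh := CO22_mul Gg Gh.
  apply: motion_eq; first by rewrite !motion_act_base.
  by rewrite !motion_act_fibre // mulmxA.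
- by move=> q g Gg; exact: motion_act_base.
move=> s; exists setT, fibre_coord; split=> //; split.
- by split; [exact: openT|rewrite preimage_setT].
- by move=> q _; exact: fibre_coord_group.
- by move=> q g _; exact: motion_act_fibre.
- move=> y g _ Gg.
  have [z Gz] : exists z : 'rV[R]_(4 * 4 + 4), affine_group z.
    by exists (pack g y); rewrite /affine_group /= pack_lin.
  pose q0 : motions := exist (fun z => z \in affine_group) z (mem_set Gz).
  exists (mk_motion q0 g y); split; first by rewrite mk_motion_base // mk_motion_fibre.
  move=> q [bE fE]; apply: motion_eq; first by rewrite mk_motion_base.
  by rewrite mk_motion_fibre.
- by move=> q v _; exact: dT0.
Qed.

End Bundle.

(** * Open subsets of R^n as manifolds *)

Section OpenSubmanifold.
Context {R : realType} {n : nat} {O : set 'rV[R]_n} (oO : open O).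

Lemma open_slice_dom z : O z -> O z -> O (id z) /\ id (id z) = z. Proof. by []. Qed.

Lemma open_slice_amb u : O u -> [/\ O (id u), O (id u) & id (id u) = u].
Proof. by []. Qed.

Definition open_slice : slice n O :=
  Slice oO oO (Csmooth_id O) (Csmooth_id O) open_slice_dom open_slice_amb.

Lemma open_slice_mem (z : O) : amb open_slice (\val z).
Proof. exact: (set_mem (valP z)). Qed.

Definition open_sub : manifold R n := submanifold (sl := fun=> open_slice) open_slice_mem.

Implicit Types (c d : chart R n open_sub) (p : open_sub).

Definition incl (p : open_sub) : euclid R n := sub_val p.

Lemma open_sub_mem (p : open_sub) : O (sub_val p).
Proof. exact: (@sub_mem _ _ _ _ _ open_slice_mem p). Qed.

Lemma open_chart_image c (U : set open_sub) : atlas c ->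
  cmap c @` (cdom c `&` U) = (sub_val : open_sub -> _) @` U.
Proof.
move=> [z _ <-]; apply/seteqP; split=> [_ [p [_ Up] <-]|_ [p Up <-]]; exists p => //.
by split=> //; exact: open_sub_mem.
Qed.

Lemma open_chart_inv c u : atlas c -> O u -> sub_val (cinv c u) = u.
Proof. by move=> [z _ <-] Ou; exact: (@val_slice_inv _ _ _ _ (fun=> open_slice) z u Ou). Qed.

Lemma open_chart_map c p : atlas c -> cmap c p = sub_val p.
Proof. by move=> [z _ <-]. Qed.

Lemma open_chart_dom c p : atlas c -> cdom c p.
Proof. by move=> [z _ <-]; exact: open_sub_mem. Qed.

Lemma near_open (p : open_sub) : \forall u \near sub_val p, O u.
Proof. by apply: open_nbhs_nbhs; split=> //; exact: open_sub_mem. Qed.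

Lemma tangent_incl p : tangent incl p = 1%:M.
Proof.
rewrite -(jacobian_id (sub_val p)) /tangent.
have ac := chart_at_atlas p.
rewrite (open_chart_map p ac); apply: near_eq_jacobian => //.
by apply: filterS (near_open p) => u Ou; exact: esym (open_chart_inv ac Ou).
Qed.

Lemma open_transition_jacobian c d p : atlas c -> atlas d ->
  'J (transition c d) (sub_val p) = 1%:M.
Proof.
move=> ac ad; rewrite -(jacobian_id (sub_val p)); apply: near_eq_jacobian => //.
apply: filterS (near_open p) => u Ou.
exact: esym (etrans (open_chart_map _ ad) (open_chart_inv ac Ou)).
Qed.

Lemma open_coefs c (w : oneform open_sub) p : atlas c -> coefs c w (sub_val p) = w p.
Proof.
move=> ac; have := coefsE w (open_chart_dom p ac); rewrite (open_chart_map p ac) => ->.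
by rewrite open_transition_jacobian ?mul1mx //; exact: chart_at_atlas.
Qed.

Lemma open_coefs_near c (W : 'rV[R]_n -> 'cV[R]_n) u : atlas c -> O u ->
  coefs c (fun p => W (sub_val p)) u = W u.
Proof.
move=> ac Ou; rewrite -[in LHS](open_chart_inv ac Ou) open_coefs //.
by rewrite open_chart_inv.
Qed.

Lemma open_smooth_form (W : 'rV[R]_n -> 'cV[R]_n) (U : set open_sub) :
  Csmooth O W -> smooth_form U (fun p => W (sub_val p)).
Proof.
move=> WS c ac k; apply: (@Ck_sub _ _ _ _ O).
  by rewrite open_chart_image // => _ [p _ <-]; exact: open_sub_mem.
by apply: Ck_ext (WS k) => // u Ou; rewrite open_coefs_near.
Qed.

(** All charts of an open subset have the coordinates of R^n, so that dW is the
    antisymmetrized derivative of W. *)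
Lemma open_dform (W : 'rV[R]_n -> 'cV[R]_n) (I : finType) (al be : I -> 'cV[R]_n) p :
  differentiable W (sub_val p) ->
  (forall v, 'D_v W (sub_val p) = \sum_k (v *m al k) 0 0 *: be k) ->
  dform (fun p => W (sub_val p)) p = \sum_k wedge (al k) (be k).
Proof.
move=> Wd WD; set w := fun p => W (sub_val p); have ac := chart_at_atlas p.
have D i : 'D_(delta_mx 0 i) (coefs (chart_at p) w) (cmap (chart_at p) p) =
    \sum_k al k i 0 *: be k.
  rewrite (open_chart_map p ac).
  apply: etrans (_ : _ = 'D_(delta_mx 0 i) W (sub_val p)) _.
    by apply: near_eq_derive; apply: filterS (near_open p) => u Ou; rewrite open_coefs_near.
  rewrite WD; apply: eq_bigr => k _; congr (_ *: _).
  by rewrite -rowE mxE.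
apply/matrixP => i j; rewrite [LHS]mxE !D !summxE -sumrB; apply: eq_bigr => k _.
by rewrite !mxE !big_ord1 !mxE [be k i 0 * _]mulrC.
Qed.

Lemma incl_embedding (p0 : open_sub) : open_embedding setT incl.
Proof.
have iE : incl @` setT = O.
  apply/seteqP; split=> [_ [p _ <-]|u Ou]; first exact: open_sub_mem.
  by exists (cinv (chart_at p0) u) => //; rewrite /incl open_chart_inv //; exact: chart_at_atlas.
have ac := chart_at_atlas p0.
exists (cinv (chart_at p0)); split.
- apply: smooth_map_euclid; first exact: openT.
  have oT : open [set: 'rV[R]_n] by exact: openT.
  exact: (@sub_val_smooth _ _ _ _ _ open_slice_mem _ _ setT id oT (@Csmooth_id _ _ _)).
- by rewrite iE.
- move=> p _; apply: (@sub_inj _ _ _ _ _ open_slice_mem).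
  exact: (open_chart_inv ac (open_sub_mem p)).
rewrite iE; apply: (@sub_smooth_map _ _ _ _ _ open_slice_mem) => // c -> k /=.
apply: (@Ck_sub _ _ _ _ O); first by move=> _ [u [_ Ou] <-].
apply: Ck_ext (@Csmooth_id _ _ O k) => // u Ou.
exact: esym (open_chart_inv ac Ou).
Qed.

End OpenSubmanifold.
Arguments incl {R n O oO} p.

(** * Classes of para-CR coframes *)

Section CRStructure.
Context {R : realType}.

Section Equivalence.
Context {m : nat} {M : manifold R m}.

(** With the forms as columns, a change of coframe is a matrix product. *)
Definition cols n (w : 'I_n -> oneform M) (p : M) : 'M[R]_(m, n) := \matrix_(i, j) w j p i 0.

Lemma colsP n (w w' : 'I_n -> oneform M) (l : oneform M) (p : M) (h : 'M[R]_n) (c : 'rV[R]_n) :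
  (forall A, w' A p = \sum_B h B A *: w B p + c 0 A *: l p) <->
  cols w' p = cols w p *m h + l p *m c.
Proof.
split=> [E|/matrixP E A].
  apply/matrixP => i A; rewrite mxE E mxE summxE [RHS]mxE; congr (_ + _).
    by rewrite mxE; apply: eq_bigr => B _; rewrite !mxE mulrC.
  by rewrite !mxE big_ord1 mulrC.
apply/colP => i; have := E i A; rewrite [LHS]mxE => ->.
rewrite [LHS]mxE [RHS]mxE summxE; congr (_ + _).
  by rewrite mxE; apply: eq_bigr => B _; rewrite !mxE mulrC.
by rewrite !mxE big_ord1 mulrC.
Qed.

End Equivalence.

Context {Sigma : manifold R 6}.
Implicit Types L : CRcoframe Sigma.

Lemma CR_equiv_refl L : CR_equiv L L.
Proof.
exists (fun=> 1), (fun=> 0), (fun=> 0), (fun=> 1%:M), (fun=> 1%:M).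
split; first by split; exact: smooth_fun_cst.
move=> p _; split.
- by rewrite !det1 !mulr1 oner_eq0.
- by rewrite scale1r.
- by apply/colsP; rewrite mulmx1 mulmx0 addr0.
- by apply/colsP; rewrite mulmx1 mulmx0 addr0.
Qed.

Lemma cols_comp n (w w1 w2 : 'I_n -> oneform Sigma) (l l1 : oneform Sigma)
    (a1 : Sigma -> R) (c1 c2 : Sigma -> 'rV[R]_n) (h1 h2 : Sigma -> 'M[R]_n) p :
  a1 p != 0 -> h1 p \in unitmx -> l1 p = a1 p *: l p ->
  cols w1 p = cols w p *m h1 p + l p *m c1 p ->
  cols w2 p = cols w p *m h2 p + l p *m c2 p ->
  cols w2 p = cols w1 p *m (invmx (h1 p) *m h2 p) +
    l1 p *m ((a1 p)^-1 *: (c2 p - c1 p *m (invmx (h1 p) *m h2 p))).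
Proof.
move=> a0 hu l1E -> ->; rewrite l1E mulmxDl !mulmxA mulmxK // -!addrA; congr (_ + _).
rewrite -scalemxAl -scalemxAr scalerA divff // scale1r mulmxBr !mulmxA.
by rewrite addrC subrK.
Qed.

(** The change of coframe from L1 to L2 is the change from L to L2 composed with
    the inverse of the change from L to L1; L is needed on all of their common
    domain. *)
Lemma CR_equiv_common L L1 L2 : CRdom L = setT ->
  open (CRdom L1) -> open (CRdom L2) -> CR_equiv L L1 -> CR_equiv L L2 -> CR_equiv L1 L2.
Proof.
move=> LT o1 o2 [a1 [c1 [b1 [h1 [f1 [[sa1 sc1 sb1 sh1 sf1] E1]]]]]].
move=> [a2 [c2 [b2 [h2 [f2 [[sa2 sc2 sb2 sh2 sf2] E2]]]]]].
rewrite LT setTI in sa1 sc1 sb1 sh1 sf1 E1; rewrite LT setTI in sa2 sc2 sb2 sh2 sf2 E2.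
pose U := CRdom L1 `&` CRdom L2; have oU : open U by exact: openI.
have U1 : U `<=` CRdom L1 by move=> p [].
have U2 : U `<=` CRdom L2 by move=> p [].
have nz (a : Sigma -> R) (h : Sigma -> 'M[R]_2) (f : Sigma -> 'M[R]_3) p :
    a p * \det (h p) * \det (f p) != 0 -> [/\ a p != 0, h p \in unitmx & f p \in unitmx].
  by rewrite !mulf_eq0 !negb_or !unitmxE !unitfE => /andP[/andP[-> ->] ->].
have n1 p : U p -> [/\ a1 p != 0, h1 p \in unitmx & f1 p \in unitmx].
  by move=> /U1/E1[/nz].
have n2 p : U p -> [/\ a2 p != 0, h2 p \in unitmx & f2 p \in unitmx].
  by move=> /U2/E2[/nz].
have sV (a : Sigma -> R) : smooth_fun U a -> (forall p, U p -> a p != 0) ->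
    smooth_fun U (fun p => (a p)^-1) by move=> aU a0; exact: smooth_funV.
have sa1' := sV _ (smooth_fun_sub U1 sa1) (fun p Up => let: And3 H _ _ := n1 p Up in H).
have sq n (x1 x2 : Sigma -> 'M[R]_n) : smooth_fun (CRdom L1) x1 -> smooth_fun (CRdom L2) x2 ->
    (forall p, U p -> x1 p \in unitmx) -> smooth_fun U (fun p => invmx (x1 p) *m x2 p).
  move=> s1 s2 u1; apply: smooth_fun_mulmx => //; last exact: smooth_fun_sub s2.
  by apply: smooth_fun_invmx => //; exact: smooth_fun_sub s1.
have sh := sq _ _ _ sh1 sh2 (fun p Up => let: And3 _ H _ := n1 p Up in H).
have sf := sq _ _ _ sf1 sf2 (fun p Up => let: And3 _ _ H := n1 p Up in H).
have st n (y1 y2 : Sigma -> 'rV[R]_n) (x : Sigma -> 'M[R]_n) :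
    smooth_fun (CRdom L1) y1 -> smooth_fun (CRdom L2) y2 -> smooth_fun U x ->
    smooth_fun U (fun p => (a1 p)^-1 *: (y2 p - y1 p *m x p)).
  move=> s1 s2 sx; apply: smooth_fun_scale => //; apply: smooth_funD => //.
    exact: smooth_fun_sub s2.
  apply: smooth_funN => //; apply: smooth_fun_mulmx => //; exact: smooth_fun_sub s1.
exists (fun p => (a1 p)^-1 * a2 p),
  (fun p => (a1 p)^-1 *: (c2 p - c1 p *m (invmx (h1 p) *m h2 p))),
  (fun p => (a1 p)^-1 *: (b2 p - b1 p *m (invmx (f1 p) *m f2 p))),
  (fun p => invmx (h1 p) *m h2 p), (fun p => invmx (f1 p) *m f2 p).
split.
  split=> //; [|exact: st|exact: st].
  by apply: smooth_funM => //; exact: smooth_fun_sub sa2.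
move=> p Up; have [na1 uh1 uf1] := n1 p Up; have [na2 uh2 uf2] := n2 p Up.
have [_ l1 m1 v1] := E1 p (U1 p Up); have [_ l2 m2 v2] := E2 p (U2 p Up).
split.
- rewrite !mulf_eq0 !negb_or invr_eq0 na1 na2 /= -!unitfE -!unitmxE !unitmx_mul !unitmx_inv.
  by rewrite uh1 uh2 uf1 uf2.
- by rewrite l2 l1 scalerA mulrAC mulVf // mul1r.
- apply/colsP; apply: (@cols_comp _ (mu L) (mu L1) (mu L2) (lam L) (lam L1) a1 c1 c2 h1 h2) => //; apply/colsP; [exact: m1|exact: m2].
- apply/colsP; apply: (@cols_comp _ (nu L) (nu L1) (nu L2) (lam L) (lam L1) a1 b1 b2 f1 f2) => //; apply/colsP; [exact: v1|exact: v2].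
Qed.

Definition CR_class L : set (CRcoframe Sigma) :=
  [set L' | para_CR_coframe L' /\ CR_equiv L L'].

(** A coframe on the whole manifold determines its class: any member is related to
    any other through it. *)
Lemma CR_class_structure L : CRdom L = setT -> para_CR_coframe L ->
  para_CR_structure (CR_class L).
Proof.
move=> LT pL; split.
- by move=> L' [].
- by move=> p; exists L; [split=> //; exact: CR_equiv_refl|rewrite LT].
- move=> L1 L2 [p1 e1] [p2 e2]; have [D1 _ _ _] := p1; have [D2 _ _ _] := p2; exact: (CR_equiv_common LT).
- by move=> L' pL' H; split=> //; apply: H; split=> //; exact: CR_equiv_refl.
Qed.

End CRStructure.

(** * The flat model on open subsets *)

Section FlatModel.
Context {R : realType} {O : set 'rV[R]_6} (oO : open O).
Local Notation Sigma := (open_sub oO).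

Definition flat_coframe : CRcoframe Sigma := CR_pullback setT incl CR_model.

Lemma flat_coframe_dom : CRdom flat_coframe = setT.
Proof. by rewrite /= preimage_setT setIT. Qed.

(** The column of the differential of the k-th coordinate. *)
Definition basis_form (k : nat) : 'cV[R]_6 := \col_j ((j : nat) == k)%:R.
Local Notation E := basis_form.

Definition contact (u : 'rV[R]_6) : 'cV[R]_6 :=
  E 2 + u 0 0 *: E 3 + u 0 1 *: E 4 + (u 0 0 * u 0 1) *: E 5.

Lemma flat_lamE : lam flat_coframe = fun p => contact (sub_val p).
Proof. by apply/funext => p; rewrite /= /pullback tangent_incl mul1mx. Qed.

Lemma flat_muE A : mu flat_coframe A = fun p => E A.
Proof. by apply/funext => p; rewrite /= /pullback tangent_incl mul1mx. Qed.

Lemma flat_nuE k : nu flat_coframe k = fun p => E (3 + k).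
Proof. by apply/funext => p; rewrite /= /pullback tangent_incl mul1mx. Qed.

Lemma pair_basis (v : 'rV[R]_6) (k : 'I_6) : (v *m E k) 0 0 = v 0 k.
Proof.
rewrite mxE (bigD1 k) //= mxE eqxx mulr1 big1 ?addr0 // => j jk.
by rewrite mxE (negbTE (_ : (j : nat) != k)) ?mulr0.
Qed.

Let coordS k (l : 'I_6) : Ck k O (fun u : 'rV[R]_6 => u 0 l).
Proof. by have /(Ck_mx _ _ oO) := @Csmooth_id R 'rV[R]_6 O k; exact. Qed.

Let cstS k (w : 'cV[R]_6) : Ck k O (fun _ : 'rV[R]_6 => w).
Proof. exact: Ck_cst. Qed.

Lemma contact_smooth : Csmooth O contact.
Proof.
move=> k; apply: CkD => //; last by apply: Ck_scale => //; exact: CkM.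
apply: CkD => //; last exact: Ck_scale.
by apply: CkD => //; exact: Ck_scale.
Qed.

Lemma contact_derive (u v : 'rV[R]_6) :
  is_derive u v contact (v 0 0 *: E 3 + v 0 1 *: E 4 + (v 0 1 * u 0 0 + v 0 0 * u 0 1) *: E 5).
Proof.
have D (l : 'I_6) : is_derive u v (fun u : 'rV[R]_6 => u 0 l) (v 0 l).
  exact: is_derive_entry (is_derive_id u v).
apply: is_derive_mx => i j.
rewrite (_ : (fun _ => _) = fun u : 'rV[R]_6 => E 2 i j + E 3 i j *: u 0 0 + E 4 i j *: u 0 1 +
    E 5 i j *: ((fun u : 'rV[R]_6 => u 0 0) * (fun u : 'rV[R]_6 => u 0 1)) u); last first.
  apply/funext => w; rewrite /contact !mxE.
  by rewrite ![_ *: _]mulrC.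
rewrite (_ : (v 0 0 *: E 3 + v 0 1 *: E 4 + _) i j = 0 + E 3 i j *: v 0 0 + E 4 i j *: v 0 1 +
    E 5 i j *: (u 0 0 *: v 0 1 + u 0 1 *: v 0 0)); last first.
  rewrite !mxE add0r /GRing.scale /=.
  ring.
do ![apply: is_deriveD | apply: is_deriveZ | exact: D | apply: is_deriveM].
Qed.

(** d(da0 + x da1 + y da2 + x y da3) = dx /\ da1 + dy /\ da2 + (y dx + x dy) /\ da3
    is in the ideal of the mu, and in that of the nu. *)
Lemma contact_dform p : dform (lam flat_coframe) p =
  wedge (E 0) (E 3) + wedge (E 1) (E 4) +
  wedge (sub_val p 0 1 *: E 0 + sub_val p 0 0 *: E 1) (E 5).
Proof.
rewrite flat_lamE; set u := sub_val p.
pose al (k : 'I_3) := nth 0 [:: E 0; E 1; u 0 1 *: E 0 + u 0 0 *: E 1] k.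
have Wd : differentiable contact u.
  have [+ _] := contact_smooth 1%N; apply; exact: open_sub_mem.
have -> := @open_dform _ _ _ oO contact _ al (fun k : 'I_3 => E (3 + k)) p Wd.
  by rewrite !big_ord_recl big_ord0 addr0 addrA.
move=> v; have [_ ->] := contact_derive u v.
rewrite !big_ord_recl big_ord0 addr0 !addrA /al /=; congr (_ + _ + _).
- by rewrite (pair_basis v 0).
- by rewrite (pair_basis v 1).
have -> : (v *m (u 0 1 *: E 0 + u 0 0 *: E 1)) 0 0 = u 0 1 * v 0 0 + u 0 0 * v 0 1.
  rewrite mulmxDr -!scalemxAr [LHS]mxE; congr (_ + _); rewrite [LHS]mxE; congr (_ * _).
    exact: (pair_basis v 0).
  exact: (pair_basis v 1).
by congr (_ *: _); ring.
Qed.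

Lemma const_dform (w : 'cV[R]_6) (p : Sigma) : dform (fun _ : Sigma => w) p = 0.
Proof.
have -> := @open_dform _ _ _ oO (fun=> w) 'I_0 (fun=> 0) (fun=> 0) p.
- by rewrite big_ord0.
- exact: differentiable_cst.
- by move=> v; rewrite big_ord0; exact: derive_cst.
Qed.

Lemma const_smooth_form (w : 'cV[R]_6) U : smooth_form U (fun _ : Sigma => w).
Proof. by apply: (@open_smooth_form _ _ _ oO (fun=> w)) => k; exact: Ck_cst. Qed.

Lemma wedge0l n (w : 'cV[R]_n) : wedge 0 w = 0.
Proof. by rewrite /wedge mul0mx trmx0 mulmx0 subrr. Qed.

Lemma flat_ideal_mu : closed_differential_ideal (CRdom flat_coframe)
  [tuple lam flat_coframe; mu flat_coframe 0; mu flat_coframe 1].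
Proof.
pose W (i j : 'I_3) (u : 'rV[R]_6) : 'cV[R]_6 :=
  if i == 0 then nth 0 [:: 0; - (E 3 + u 0 1 *: E 5); - (E 4 + u 0 0 *: E 5)] j else 0.
have WS i j : Csmooth O (W i j).
  move=> k; rewrite /W; case: (i == 0); last exact: Ck_cst.
  case: j => [[|[|[|//]]] ?] /=; first exact: Ck_cst.
    by apply: CkN => //; apply: CkD => //; exact: Ck_scale.
  by apply: CkN => //; apply: CkD => //; exact: Ck_scale.
exists (fun i j p => W i j (sub_val p)); split.
  by move=> i j; exact: open_smooth_form.
move=> p _ i; rewrite !big_ord_recl big_ord0 addr0.
set u := sub_val p; pose F := flat_coframe.
case: i => [[|[|[|//]]] lt].
- change (dform (lam F) p = wedge (0 : 'cV_6) (lam F p) +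
    (wedge (- (E 3 + u 0 1 *: E 5)) (mu F 0 p) + wedge (- (E 4 + u 0 0 *: E 5)) (mu F 1 p))).
  rewrite contact_dform wedge0l add0r !flat_muE -/u.
  by apply/matrixP => a b; rewrite !mxE !big_ord1 !mxE; ring.
- change (dform (mu F 0) p = wedge (0 : 'cV_6) (lam F p) +
    (wedge (0 : 'cV_6) (mu F 0 p) + wedge (0 : 'cV_6) (mu F 1 p))).
  by rewrite !wedge0l !addr0 flat_muE const_dform.
- change (dform (mu F 1) p = wedge (0 : 'cV_6) (lam F p) +
    (wedge (0 : 'cV_6) (mu F 0 p) + wedge (0 : 'cV_6) (mu F 1 p))).
  by rewrite !wedge0l !addr0 flat_muE const_dform.
Qed.

Lemma flat_ideal_nu : closed_differential_ideal (CRdom flat_coframe)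
  [tuple lam flat_coframe; nu flat_coframe 0; nu flat_coframe 1; nu flat_coframe 2].
Proof.
pose W (i j : 'I_4) (u : 'rV[R]_6) : 'cV[R]_6 :=
  if i == 0 then nth 0 [:: 0; E 0; E 1; u 0 1 *: E 0 + u 0 0 *: E 1] j else 0.
have WS i j : Csmooth O (W i j).
  move=> k; rewrite /W; case: (i == 0); last exact: Ck_cst.
  case: j => [[|[|[|[|//]]]] ?] /=; try exact: Ck_cst.
  by apply: CkD => //; exact: Ck_scale.
exists (fun i j p => W i j (sub_val p)); split.
  by move=> i j; exact: open_smooth_form.
move=> p _ i; rewrite !big_ord_recl big_ord0 addr0.
set u := sub_val p; pose F := flat_coframe.
have nuD k : dform (nu F k) p = wedge (0 : 'cV_6) (lam F p) + (wedge (0 : 'cV_6) (nu F 0 p) +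
    (wedge (0 : 'cV_6) (nu F 1 p) + wedge (0 : 'cV_6) (nu F 2 p))).
  by rewrite !wedge0l !addr0 flat_nuE const_dform.
case: i => [[|[|[|[|//]]]] lt].
- change (dform (lam F) p = wedge (0 : 'cV_6) (lam F p) + (wedge (E 0) (nu F 0 p) +
    (wedge (E 1) (nu F 1 p) + wedge (u 0 1 *: E 0 + u 0 0 *: E 1) (nu F 2 p)))).
  rewrite contact_dform wedge0l add0r (flat_nuE 0) (flat_nuE 1) (flat_nuE 2).
  exact: esym (addrA _ _ _).
- exact: (nuD 0).
- exact: (nuD 1).
- exact: (nuD 2).
Qed.

Lemma flat_para_CR : para_CR_coframe flat_coframe.
Proof.
split; [|split|exact: flat_ideal_mu|exact: flat_ideal_nu].
- by rewrite flat_coframe_dom; exact: openT.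
- case=> [[|[|[|[|[|[|//]]]]]] lt].
  + rewrite -[tnth _ _]/(lam flat_coframe) flat_lamE.
    exact: open_smooth_form contact_smooth.
  + by rewrite -[tnth _ _]/(mu flat_coframe 0) flat_muE; exact: const_smooth_form.
  + by rewrite -[tnth _ _]/(mu flat_coframe 1) flat_muE; exact: const_smooth_form.
  + by rewrite -[tnth _ _]/(nu flat_coframe 0) flat_nuE; exact: const_smooth_form.
  + by rewrite -[tnth _ _]/(nu flat_coframe 1) flat_nuE; exact: const_smooth_form.
  + by rewrite -[tnth _ _]/(nu flat_coframe 2) flat_nuE; exact: const_smooth_form.
move=> p _; set A := \matrix_(i, j) _.
pose x := sub_val p 0 0; pose y := sub_val p 0 1.
(* the inverse of the coefficient matrix of the coframe *)
pose B : 'M[R]_6 := \matrix_(i, j) nth 0 (nth [::]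
  [:: [:: 0; 1; 0; 0; 0; 0]; [:: 0; 0; 1; 0; 0; 0]; [:: 1; 0; 0; - x; - y; - (x * y)];
      [:: 0; 0; 0; 1; 0; 0]; [:: 0; 0; 0; 0; 1; 0]; [:: 0; 0; 0; 0; 0; 1]] i) j.
suff : B *m A = 1%:M by move=> /mulmx1_unit[].
have AE i j : A i j = (nth 0 [:: contact (sub_val p); E 0; E 1; E 3; E 4; E 5] i) j 0.
  rewrite mxE; case: i => [[|[|[|[|[|[|//]]]]]] lt].
  + by rewrite -[tnth _ _]/(lam flat_coframe) flat_lamE.
  + by rewrite -[tnth _ _]/(mu flat_coframe 0) flat_muE.
  + by rewrite -[tnth _ _]/(mu flat_coframe 1) flat_muE.
  + by rewrite -[tnth _ _]/(nu flat_coframe 0) flat_nuE.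
  + by rewrite -[tnth _ _]/(nu flat_coframe 1) flat_nuE.
  + by rewrite -[tnth _ _]/(nu flat_coframe 2) flat_nuE.
apply/matrixP => i j; rewrite mxE !big_ord_recl big_ord0 !AE [RHS]mxE !mxE /= -/x -/y.
case: i => [[|[|[|[|[|[|//]]]]]] lt]; case: j => [[|[|[|[|[|[|//]]]]]] lt'] /=; ring.
Qed.

Lemma flat_CR_flat : flat_CR (CR_class flat_coframe).
Proof.
move=> p; exists setT, incl; split=> //; first exact: openT.
  exact: incl_embedding p.
by split; [exact: flat_para_CR|exact: CR_equiv_refl].
Qed.

End FlatModel.

(** * Linearity of the exterior derivative *)

Section FormCalculus.
Context {R : realType} {m : nat} {M : manifold R m}.
Implicit Types (w : oneform M) (p : M).

Lemma coefsD c w w' x : coefs c (fun p => w p + w' p) x = coefs c w x + coefs c w' x.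
Proof. by rewrite /coefs mulmxDr. Qed.

Lemma coefsZ c (a : R) w x : coefs c (fun p => a *: w p) x = a *: coefs c w x.
Proof. by rewrite /coefs -scalemxAr. Qed.

Lemma smooth_formD U w w' : open U -> smooth_form U w -> smooth_form U w' ->
  smooth_form U (fun p => w p + w' p).
Proof.
move=> oU wU wU' c ac k; have oc : open (cmap c @` (cdom c `&` U)) by exact: chart_image_open.
by apply: Ck_ext (CkD oc (wU c ac k) (wU' c ac k)) => // x _; rewrite coefsD.
Qed.

Lemma smooth_formZ U (a : R) w : open U -> smooth_form U w ->
  smooth_form U (fun p => a *: w p).
Proof.
move=> oU wU c ac k; have oc : open (cmap c @` (cdom c `&` U)) by exact: chart_image_open.
by apply: Ck_ext (Ck_scale oc (Ck_cst _ _ a) (wU c ac k)) => // x _; rewrite coefsZ.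
Qed.

Lemma smooth_form_derivable w (wU : smooth_form setT w) p (v : 'rV[R]_m) :
  derivable (coefs (chart_at p) w) (cmap (chart_at p) p) v.
Proof.
apply: diff_derivable; have [+ _] := wU _ (chart_at_atlas p) 1%N.
by apply; exact: chart_at_image.
Qed.

Lemma dformD w w' p : smooth_form setT w -> smooth_form setT w' ->
  dform (fun q => w q + w' q) p = dform w p + dform w' p.
Proof.
move=> wU wU'; apply/matrixP => i j; rewrite !mxE.
have D k : 'D_(delta_mx 0 k) (coefs (chart_at p) (fun q => w q + w' q)) (cmap (chart_at p) p)
   = 'D_(delta_mx 0 k) (coefs (chart_at p) w) (cmap (chart_at p) p) +
     'D_(delta_mx 0 k) (coefs (chart_at p) w') (cmap (chart_at p) p).
  rewrite (_ : coefs _ _ = coefs (chart_at p) w + coefs (chart_at p) w'); last first.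
    by apply/funext => x; exact: coefsD.
  have H := deriveD (smooth_form_derivable wU (p := p) (v := delta_mx 0 k)) (smooth_form_derivable wU' (p := p) (v := delta_mx 0 k)).
  exact: H.
rewrite (D i) (D j) [X in X - _]mxE [X in _ - X]mxE; ring.
Qed.

Lemma dformZ (a : R) w p : smooth_form setT w ->
  dform (fun q => a *: w q) p = a *: dform w p.
Proof.
move=> wU; apply/matrixP => i j; rewrite !mxE.
have D k : 'D_(delta_mx 0 k) (coefs (chart_at p) (fun q => a *: w q)) (cmap (chart_at p) p)
   = a *: 'D_(delta_mx 0 k) (coefs (chart_at p) w) (cmap (chart_at p) p).
  rewrite (_ : coefs _ _ = a \*: coefs (chart_at p) w); last first.
    by apply/funext => x; exact: coefsZ.
  have H := deriveZ a (smooth_form_derivable wU (p := p) (v := delta_mx 0 k)).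
  exact: H.
rewrite (D i) (D j) [X in X - _]mxE [X in _ - X]mxE; ring.
Qed.

(** Blocks, rows and transposes of a matrix function are of this form. *)
Lemma smooth_fun_reindex a b a' b' U (F : M -> 'M[R]_(a, b)) (s : 'I_a' -> 'I_b' -> 'I_a)
    (t : 'I_a' -> 'I_b' -> 'I_b) : open U -> smooth_fun U F ->
  smooth_fun U (fun q => \matrix_(i, j) F q (s i j) (t i j)).
Proof.
move=> oU FU; apply/smooth_fun_mx => // i j.
rewrite (_ : (fun _ => _) = fun q => F q (s i j) (t i j)); last first.
  by apply/funext => q; rewrite mxE.
by have /(smooth_fun_mx _ oU) := FU; exact.
Qed.

Lemma dfun_reindex a b a' b' (F : M -> 'M[R]_(a, b)) (s : 'I_a' -> 'I_b' -> 'I_a)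
    (t : 'I_a' -> 'I_b' -> 'I_b) p v : differentiable_at F p ->
  differentiable_at (fun q => \matrix_(i, j) F q (s i j) (t i j)) p /\
  dfun (fun q => \matrix_(i, j) F q (s i j) (t i j)) p v =
  \matrix_(i, j) dfun F p v (s i j) (t i j).
Proof.
move=> Fp; have E i j : (fun q => (\matrix_(i, j) F q (s i j) (t i j)) i j) =
    fun q => F q (s i j) (t i j) by apply/funext => q; rewrite mxE.
have D : differentiable_at (fun q => \matrix_(i, j) F q (s i j) (t i j)) p.
  apply/differentiable_mx => i j.
  have := differentiable_at_entry (s i j) (t i j) Fp.
  by rewrite -E.
split=> //; apply/matrixP => i j.
by rewrite -(dfun_entry v i j D) E (dfun_entry _ _ _ Fp) mxE.
Qed.

Lemma dfun_scale a b (f : M -> R) (F : M -> 'M[R]_(a, b)) p v : differentiable_at f p -> differentiable_at F p ->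
  differentiable_at (fun q => f q *: F q) p /\
  dfun (fun q => f q *: F q) p v = dfun f p v *: F p + f p *: dfun F p v.
Proof.
move=> fp Fp.
have E i j : (fun q => (f q *: F q) i j) = fun q => f q * F q i j.
  by apply/funext => q; rewrite mxE.
have D : differentiable_at (fun q => f q *: F q) p.
  apply/differentiable_mx => i j.
  have := @differentiableM _ _ _ _ _ fp (differentiable_at_entry i j Fp).
  by rewrite -[_ * _]/((fun q => f q * F q i j) \o cinv (chart_at p)) -E.
split=> //; apply/matrixP => i j.
rewrite -(dfun_entry v i j D) E dfunM //; last exact: differentiable_at_entry.
by rewrite (dfun_entry _ _ _ Fp) !mxE.
Qed.

Lemma dfunV (f : M -> R) U p v : open U -> U p -> smooth_fun U f ->
  (forall q, U q -> f q != 0) ->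
  dfun (fun q => (f q)^-1) p v = - ((f p)^-1 * (f p)^-1 * dfun f p v).
Proof.
move=> oU Up fU f0; have fp : differentiable_at f p by exact: smooth_fun_differentiable fU Up.
have Vp : differentiable_at (fun q => (f q)^-1) p by exact: smooth_fun_differentiable (smooth_funV oU f0 fU) Up.
have E : dfun (fun q => (f q)^-1 * f q) p v = 0.
  pose one : M -> R := fun=> 1.
  have d1 : differentiable_at one p by exact: differentiable_cst.
  have [_ ->] := dfun_ext (f := one) (g := fun q => (f q)^-1 * f q) v oU Up
     (fun q Uq => esym (mulVf (f0 q Uq))) d1.
  exact: dfun_cst.
move: E; rewrite (dfunM v Vp fp) => /eqP; rewrite addr_eq0 => /eqP E.
by rewrite -[LHS](mulfK (f0 p Up)) E; ring.
Qed.

End FormCalculus.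

(** * The structure equations as a Maurer-Cartan equation *)

Section AffineForm.
Context {R : realType} {P : manifold R 11}.
Context (th1 th2 th3 th4 Om1 Om2 Om3 Om4 Om5 Om6 A : oneform P).

Local Notation conn := (connection Om1 Om2 Om3 Om4 Om5 Om6 A).
Local Notation steq := (structure_equations th1 th2 th3 th4 Om1 Om2 Om3 Om4 Om5 Om6 A).

Definition form_comb (a b : R) (w : oneform P) : oneform P := fun p => a *: A p + b *: w p.

Definition motion_table : seq (seq (oneform P)) :=
  let h : R := 2^-1 in let z := form_comb 0 0 A in let e := form_comb 0 1 in
  let n := form_comb 0 (-1) in
  [:: [:: form_comb h (-1) Om1; z; e Om3; e Om5; e th1];
      [:: z; form_comb h 1 Om1; e Om2; e Om4; e th2];
      [:: n Om4; n Om5; form_comb h (-1) Om6; z; e th3];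
      [:: n Om2; n Om3; z; form_comb h 1 Om6; e th4];
      [:: z; z; z; z; z]].

(** The matrix with the blocks (Gamma, theta) over (0, 0): it takes values in the
    Lie algebra of the group of motions x |-> g x + y. *)
Definition motion_form (i j : 'I_5) : oneform P :=
  nth (form_comb 0 0 A) (nth [::] motion_table i) j.

Lemma form_combE a b w p : form_comb a b w p = a *: A p + b *: w p. Proof. by []. Qed.

Lemma wedge_entry (w w' : 'cV[R]_11) i j :
  wedge w w' i j = w i 0 * w' j 0 - w' i 0 * w j 0.
Proof. by rewrite !mxE !big_ord1 !mxE. Qed.

Lemma smooth_form_comb a b w : smooth_form setT A -> smooth_form setT w ->
  smooth_form setT (form_comb a b w).
Proof.
move=> As ws; have oT := @openT P.
exact: (smooth_formD oT (smooth_formZ a oT As) (smooth_formZ b oT ws)).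
Qed.

Lemma dform_comb a b w p : smooth_form setT A -> smooth_form setT w ->
  dform A p = 0 -> dform (form_comb a b w) p = b *: dform w p.
Proof.
move=> As ws A0; have oT := @openT P.
have := dformD p (smooth_formZ a oT As) (smooth_formZ b oT ws).
rewrite (dformZ a p As) (dformZ b p ws) A0 scaler0 add0r => <-.
exact: erefl.
Qed.

Context (cof : coframe setT
  [tuple th1; th2; th3; th4; Om1; Om2; Om3; Om4; Om5; Om6; A]).

Lemma forms_smooth : [/\ smooth_form setT th1, smooth_form setT th2, smooth_form setT th3 &
  smooth_form setT th4] /\ [/\ smooth_form setT Om1, smooth_form setT Om2, smooth_form setT Om3 &
  smooth_form setT Om4] /\ [/\ smooth_form setT Om5, smooth_form setT Om6 & smooth_form setT A].
Proof.
have [+ _] := cof => H.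
split; first by split; [exact: (H (@Ordinal 11 0 isT))|exact: (H (@Ordinal 11 1 isT))|
  exact: (H (@Ordinal 11 2 isT))|exact: (H (@Ordinal 11 3 isT))].
split; first by split; [exact: (H (@Ordinal 11 4 isT))|exact: (H (@Ordinal 11 5 isT))|
  exact: (H (@Ordinal 11 6 isT))|exact: (H (@Ordinal 11 7 isT))].
by split; [exact: (H (@Ordinal 11 8 isT))|exact: (H (@Ordinal 11 9 isT))|
  exact: (H (@Ordinal 11 10 isT))].
Qed.

Lemma motion_form_smooth i j : smooth_form setT (motion_form i j).
Proof.
have [[? ? ? ?] [[? ? ? ?] [? ? ?]]] := forms_smooth.
case: i j => -[|[|[|[|[|//]]]]] ? [[|[|[|[|[|//]]]]] ?]; exact: smooth_form_comb.
Qed.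

Lemma motion_form_connection p v (i j : 'I_4) :
  formval motion_form p v (lshift 1 i) (lshift 1 j) = conn p v i j.
Proof.
rewrite !mxE.
case: i j => -[|[|[|[|//]]]] ? [[|[|[|[|//]]]] ?];
rewrite /motion_form /= form_combE ?(scale0r, scale1r, scaleN1r, add0r, addr0) //.
Qed.

(** The structure equations are the Maurer-Cartan equation of the group of
    motions. *)
Lemma motion_form_flat : steq -> flat_form setT motion_form.
Proof.
move=> E p _ i j; have [[e1 e2 e3 e4] [[f1 f2 f3 f4 f5] [f6 a0]]] := E p.
have [[? ? ? ?] [[? ? ? ?] [? ? ?]]] := forms_smooth.
rewrite !big_ord_recl big_ord0 addr0.
case: i j => -[|[|[|[|[|//]]]]] ? [[|[|[|[|[|//]]]]] ?];
rewrite /motion_form /= dform_comb // ?(e1, e2, e3, e4, f1, f2, f3, f4, f5, f6, a0) /form_comb.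
all: apply/matrixP => a b; rewrite !(wedge_entry, mxE); ring.
Qed.

End AffineForm.

Section MotionFrame.
Context {R : realType} {P : manifold R 11}.
Context (th1 th2 th3 th4 Om1 Om2 Om3 Om4 Om5 Om6 A : oneform P).

Local Notation conn := (connection Om1 Om2 Om3 Om4 Om5 Om6 A).
Local Notation om := (motion_form th1 th2 th3 th4 Om1 Om2 Om3 Om4 Om5 Om6 A).
Local Notation steq := (structure_equations th1 th2 th3 th4 Om1 Om2 Om3 Om4 Om5 Om6 A).
Local Notation eta := (eta22 R).

Definition solder (p : P) (v : 'rV[R]_11) : 'cV[R]_4 :=
  \col_i (v *m nth 0 [:: th1 p; th2 p; th3 p; th4 p] i) 0 0.

Lemma motion_form_solder p v (i : 'I_4) :
  formval om p v (lshift 1 i) (rshift 4 0) = solder p v i 0.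
Proof.
rewrite !mxE; case: i => -[|[|[|[|//]]]] ?;
by rewrite /motion_form /= form_combE scale0r scale1r add0r.
Qed.

Lemma motion_form_last p v j : formval om p v (rshift 4 0) j = 0.
Proof.
rewrite mxE; case: j => -[|[|[|[|[|//]]]]] ?;
by rewrite /motion_form /= form_combE !scale0r addr0 mulmx0 mxE.
Qed.

(** The entries of Gamma off the diagonal are skew with respect to eta, and its
    diagonal is A/2 plus a skew part. *)
Lemma conn_conformal p v : conn p v *m eta + eta *m (conn p v)^T = (v *m A p) 0 0 *: eta.
Proof.
pose h : R := 2^-1; have hh (x : R) : h * x + h * x = x.
  have h2 : h + h = 1 by rewrite /h [RHS]splitr mul1r.
  by rewrite -mulrDl h2 mul1r.
apply/matrixP => -[[|[|[|[|//]]]] ?] [[|[|[|[|//]]]] ?];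
rewrite ![in LHS]mxE !big_ord_recl !big_ord0 !mxE /=;
rewrite ?(mulr0, mul0r, mulr1, mul1r, addr0, add0r);
rewrite -big_split /= -/h.
all: (apply: eq_bigr => k _ || apply: big1 => k _); rewrite !mxE ?mulr0 ?addr0 //.
all: first [ring | rewrite -[A p _ 0 in RHS]hh; ring].
Qed.

Lemma conformal_transpose (C : 'M[R]_4) s : 0 < s ->
  C *m eta *m C^T = s *: eta -> C^T *m eta *m C = s *: eta.
Proof.
move=> s0 E; have s1 : s != 0 by rewrite gt_eqF.
have : C *m (s^-1 *: (eta *m C^T *m eta)) = 1%:M.
  rewrite -scalemxAr !mulmxA E -scalemxAl eta_sqr scalerA mulVf // scale1r.
  exact: erefl.
move=> /mulmx1C; rewrite -scalemxAl => H.
have : eta *m (eta *m C^T *m eta *m C) = eta *m (s *: 1%:M).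
  by rewrite -H scalerA mulfV // scale1r.
rewrite -scalemxAr mulmx1 => <-.
by rewrite !mulmxA eta_sqr mul1mx.
Qed.

Context (cof : coframe setT
  [tuple th1; th2; th3; th4; Om1; Om2; Om3; Om4; Om5; Om6; A]).

(** The primitive g of the flat form [motion_form] has the blocks C and y, with
    dC = C Gamma and dy = C theta. Since Gamma is conformal, d(C eta C^T) is A
    times C eta C^T; hence this matrix stays proportional to its value eta at p0. *)
Theorem motion_frame p0 : steq -> exists (V : set P) (C : P -> 'M[R]_4) (y : P -> 'rV[R]_4),
  [/\ open V, V p0, C p0 = 1%:M, smooth_fun V C & smooth_fun V y] /\
  [/\ forall q v, V q -> dfun C q v = C q *m conn q v,
      forall q v, V q -> dfun y q v = (C q *m solder q v)^T &
      forall q, V q -> exists2 s, 0 < s & C q *m eta *m (C q)^T = s *: eta].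
Proof.
move=> E; have oT := @openT P.
have [V [g [[oV _ Vp g1 gS] gD]]] := flat_form_primitive oT (I : setT p0)
  (motion_form_smooth cof) (motion_form_flat cof E).
pose l (i : 'I_4) : 'I_(4 + 1) := lshift 1 i.
pose r : 'I_(4 + 1) := rshift 4 0.
pose C q : 'M[R]_4 := \matrix_(i, j) g q (l i) (l j).
pose y q : 'rV[R]_4 := \matrix_(i, j) g q (l j) r.
have CS : smooth_fun V C by exact: (smooth_fun_reindex (fun i _ => l i) (fun _ j => l j) oV gS).
have yS : smooth_fun V y by exact: (smooth_fun_reindex (fun _ j => l j) (fun _ _ => r) oV gS).
have CD q v : V q -> dfun C q v = C q *m conn q v.
  move=> Vq; have [gq gE] := gD q v Vq.
  have [_ ->] := dfun_reindex (fun i _ => l i : 'I_(4 + 1)) (fun _ j => l j) v gq.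
  apply/matrixP => i j; rewrite mxE gE mxE (@big_split_ord _ _ _ 4 1) big_ord1 /= motion_form_last mulr0 addr0.
  rewrite [RHS]mxE; apply: eq_bigr => k _; congr (_ * _); first by rewrite mxE.
  exact: motion_form_connection.
have yD q v : V q -> dfun y q v = (C q *m solder q v)^T.
  move=> Vq; have [gq gE] := gD q v Vq.
  have [_ ->] := dfun_reindex (fun (_ : 'I_1) (j : 'I_4) => l j : 'I_(4 + 1)) (fun _ _ => r) v gq.
  apply/matrixP => i j; rewrite mxE gE mxE (@big_split_ord _ _ _ 4 1) big_ord1 /= motion_form_last mulr0 addr0.
  rewrite [RHS]mxE [RHS]mxE; apply: eq_bigr => k _; rewrite ord1; congr (_ * _); first by rewrite mxE.
  exact: motion_form_solder.
have C1 : C p0 = 1%:M.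
  by apply/matrixP => i j; rewrite !mxE g1 mxE.
have Cd q : V q -> differentiable_at C q by exact: smooth_fun_differentiable CS.
pose Ct q := \matrix_(i, j) C q j i.
have CtE q : Ct q = (C q)^T by apply/matrixP => i j; rewrite !mxE.
pose X q := C q *m eta *m Ct q.
have CtS : smooth_fun V Ct by exact: (smooth_fun_reindex (fun _ j => j) (fun i _ => i) oV CS).
have XS : smooth_fun V X.
  apply: smooth_fun_mulmx => //; apply: smooth_fun_mulmx => //; exact: smooth_fun_cst.
have XD q v : V q -> dfun X q v = (v *m A q) 0 0 *: X q.
  move=> Vq; have Cq := Cd q Vq.
  have eq : differentiable_at (fun _ : P => eta) q by exact: differentiable_cst.
  have [Ctq CtD] := dfun_reindex (fun _ j => j : 'I_4) (fun (i _ : 'I_4) => i) v Cq.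
  have := dfun_mulmx v (differentiable_at_mulmx Cq eq) Ctq.
  rewrite -/X (dfun_mulmx v Cq eq) dfun_cst mulmx0 addr0 CtD (CD q v Vq) => ->.
  rewrite -/(Ct q) /X CtE.
  have -> : \matrix_(i, j) (C q *m conn q v) j i = (C q *m conn q v)^T.
    by apply/matrixP => i j; rewrite [LHS]mxE [RHS]mxE.
  have F : C q *m (conn q v *m eta + eta *m (conn q v)^T) *m (C q)^T =
      C q *m conn q v *m eta *m (C q)^T + C q *m eta *m (C q *m conn q v)^T.
    by rewrite mulmxDr mulmxDl trmx_mul !mulmxA.
  by rewrite -F conn_conformal -scalemxAr -scalemxAl.
pose x q := X q 0 1.
have xS : smooth_fun V x by have /(smooth_fun_mx _ oV) := XS; exact.
have X1 : X p0 = eta by rewrite /X CtE C1 trmx1 mulmx1 mul1mx.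
pose V1 := V `&` (x @^-1` [set s | 0 < s]).
have oV1 : open V1 by apply: smooth_fun_open => //; exact: open_gt.
have V1p : V1 p0 by split=> //; rewrite /preimage /= /x X1 eta01.
have V1V : V1 `<=` V by move=> q [].
have x0 q : V1 q -> x q != 0 by move=> [_ /=]; rewrite /preimage /= => /lt0r_neq0.
have xS1 := smooth_fun_sub V1V xS.
(* X and x have the same logarithmic derivative A *)
pose Z q := (x q)^-1 *: X q.
have ZD q : V1 q -> differentiable_at Z q /\ forall v, dfun Z q v = 0.
  move=> V1q; have Vq := V1V q V1q.
  have xq : differentiable_at (fun q => (x q)^-1) q by exact: smooth_fun_differentiable (smooth_funV oV1 x0 xS1) V1q.
  have Xq : differentiable_at X q by exact: smooth_fun_differentiable XS Vq.
  split=> [|v]; first by have [] := dfun_scale 0 xq Xq.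
  have [_ ->] := dfun_scale v xq Xq.
  rewrite (dfunV v oV1 V1q xS1 x0) XD //.
  have -> : dfun x q v = (v *m A q) 0 0 * x q by rewrite (dfun_entry v 0 1 Xq) XD // mxE.
  rewrite scalerA -scalerDl; set a := (v *m A q) 0 0.
  have -> : - ((x q)^-1 * (x q)^-1 * (a * x q)) + (x q)^-1 * a = 0.
    have -> : (x q)^-1 * (x q)^-1 * (a * x q) = (x q)^-1 * a * ((x q)^-1 * x q) by ring.
    by rewrite (mulVf (x0 q V1q)) mulr1 addNr.
  by rewrite scale0r.
have [V2 [oV2 V21 V2p Zc]] := dfun0_locally_constant oV1 V1p
  (fun q Vq => (ZD q Vq).1) (fun q v Vq => (ZD q Vq).2 v).
have V2V : V2 `<=` V by move=> q /V21/V1V.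
exists V2, C, y; split; first by split=> //; [exact: smooth_fun_sub CS|exact: smooth_fun_sub yS].
split=> [q v /V2V|q v /V2V|q V2q]; [exact: CD|exact: yD|].
exists (x q); first by have [] := V21 q V2q.
rewrite -CtE -/(X q); have := Zc q V2q; rewrite /Z /x X1 eta01 invr1 scale1r => <-.
by rewrite scalerA mulfV ?scale1r //; exact: x0 (V21 q V2q).
Qed.

End MotionFrame.

(** * The principal bundle *)

Section BundlePart.
Context {R : realType}.

Lemma preimage_nbhs {T U : topologicalType} (f : T -> U) x (B : set U) :
  {for x, continuous f} -> nbhs (f x) B -> nbhs x (f @^-1` B).
Proof. by move=> fx; exact: fx. Qed.

(** In the coordinate [fibre_coord] the action is right multiplication. *)
Lemma motion_fundamental (q : motions (R := R)) xi w :
  fundamental (CO22 R) motion_act q xi w -> dfun fibre_coord q w = fibre_coord q *m xi.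
Proof.
move=> [gam [gG g0 gD wD]]; set c := chart_at q in wD.
pose f t := cmap c (motion_act q (gam t)); rewrite -/f in wD.
have q0 : motion_act q (gam 0) = q.
  by apply: motion_eq; [exact: motion_act_base|rewrite motion_act_fibre // g0 mulmx1].
have f0 : f 0 = cmap c q by rewrite /f q0.
have Fq : differentiable_at fibre_coord q by exact: smooth_fun_differentiable fibre_coord_smooth _.
have nearc : \forall t \near (0 : R), cdom c (motion_act q (gam t)).
  pose H (g : 'M[R]_4) := pack (fibre_coord q *m g) (base_proj q).
  have HS : Ck 0 setT H.
    apply: Ck_pack; [exact: openT| |exact: Ck_cst].
    by apply: Ck_mulmx; [exact: openT|exact: Ck_cst|exact: Csmooth_id].
  have E t : sub_val (motion_act q (gam t)) = H (gam t).
    exact: (mk_motion_val q (base_proj q) (CO22_mul (fibre_coord_group q) (gG t))).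
  have N : nbhs (H (gam 0)) (amb (group_slice q)).
    apply: open_nbhs_nbhs; split; first exact: amb_open.
    by rewrite -E q0; exact: group_slice_amb.
  have Hc : {for gam 0, continuous H} by exact: HS.
  have N0 : nbhs (gam 0) (H @^-1` amb (group_slice q)) by exact: (preimage_nbhs Hc N).
  have gc := is_derive_continuous gD.
  have N1 : nbhs (0 : R) (gam @^-1` (H @^-1` amb (group_slice q))) by exact: (preimage_nbhs gc N0).
  apply: (@filterS _ (nbhs (0 : R)) _ _ _ _ N1) => t Ht.
  by rewrite -[cdom c _]/(amb (group_slice q) (sub_val (motion_act q (gam t)))) E.
pose G := fibre_coord \o cinv c.
have nE : \forall t \near (0 : R), (G \o f) t = fibre_coord q *m gam t.
  apply: filterS nearc => t ct; apply: etrans _ (motion_act_fibre q (gG t)).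
  have ct1 := cmapK ct; exact: (congr1 (@fibre_coord R) ct1).
have Gd : differentiable G (f 0) by rewrite f0; exact: Fq.
have [wd wE] := wD.
have fd : differentiable f (0 : R) by exact/derivable1_diffP.
have -> : dfun fibre_coord q w = 'D_(1 : R) (G \o f) 0.
  by rewrite (derive_comp (1 : R) fd Gd) wE f0 dfunE.
rewrite (near_eq_derive _ nE).
have cD : is_derive (0 : R) 1 (fun=> fibre_coord q) 0 by exact: is_derive_cst.
have [_ ->] := is_derive_mulmx cD gD.
by rewrite mul0mx add0r.
Qed.

Context {P : manifold R 11}.
Context (th1 th2 th3 th4 Om1 Om2 Om3 Om4 Om5 Om6 A : oneform P).
Local Notation conn := (connection Om1 Om2 Om3 Om4 Om5 Om6 A).
Local Notation sold := (solder th1 th2 th3 th4).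
Local Notation frame := [tuple th1; th2; th3; th4; Om1; Om2; Om3; Om4; Om5; Om6; A].

Section Dual.
Context (cof : coframe setT frame).

Lemma coframe_dual p (w : 'rV[R]_11) :
  exists2 v : 'rV[R]_11, forall i, (v *m tnth frame i p) 0 0 = w 0 i &
    forall v', (forall i, (v' *m tnth frame i p) 0 0 = w 0 i) -> v' = v.
Proof.
have [_ /(_ p I) Mu] := cof; set M := (\matrix_(i, j) _) in Mu.
have E (v : 'rV[R]_11) i : (v *m tnth frame i p) 0 0 = (v *m M^T) 0 i.
  by rewrite !mxE; apply: eq_bigr => j _; rewrite !mxE.
have Mt : M^T \in unitmx by rewrite unitmx_tr.
exists (w *m invmx M^T) => [i|v' v'E]; first by rewrite E mulmxKV.
rewrite -[v'](mulmxK Mt); congr (_ *m _).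
by apply/rowP => i; rewrite -v'E E.
Qed.

(** The forms Omega and A are combinations of the entries of the connection. *)
Lemma frame_faithful p v : conn p v = 0 -> sold p v = 0 -> v = 0.
Proof.
move=> /matrixP c0 /colP s0.
have C i j : (v *m nth 0 (nth [::] [:: [:: 2^-1 *: A p - Om1 p; 0; Om3 p; Om5 p];
   [:: 0; 2^-1 *: A p + Om1 p; Om2 p; Om4 p]; [:: - Om4 p; - Om5 p; 2^-1 *: A p - Om6 p; 0];
   [:: - Om2 p; - Om3 p; 0; 2^-1 *: A p + Om6 p]] (i : 'I_4)) (j : 'I_4)) 0 0 = 0.
  by have := c0 i j; rewrite [LHS]mxE [RHS]mxE.
have S (i : 'I_4) : (v *m nth 0 [:: th1 p; th2 p; th3 p; th4 p] i) 0 0 = 0.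
  by have := s0 i; rewrite [LHS]mxE [RHS]mxE.
pose o (k : nat) (H : (k < 4)%N) : 'I_4 := Ordinal H.
have D1 := C (@o 0 isT) (@o 0 isT); have D2 := C (@o 1 isT) (@o 1 isT).
have D3 := C (@o 2 isT) (@o 2 isT).
move: D1 D2 D3; rewrite /= !mulmxDr !mulmxN -!scalemxAr => D1 D2 D3.
rewrite [LHS]mxE [X in X + _]mxE [X in _ + X]mxE in D1.
rewrite [LHS]mxE [X in X + _]mxE in D2.
rewrite [LHS]mxE [X in X + _]mxE [X in _ + X]mxE in D3.
set a := (v *m A p) 0 0 in D1 D2 D3.
have [v0 _ v0U] := coframe_dual p 0.
have h0 : (2^-1 : R) != 0 by rewrite invr_eq0 pnatr_eq0.
have a0 : a = 0 by lra.
have O1 : (v *m Om1 p) 0 0 = 0 by lra.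
have O6 : (v *m Om6 p) 0 0 = 0 by lra.
have v00 : 0 = v0 by apply: v0U => i; rewrite mul0mx !mxE.
rewrite v00; apply: v0U => i; rewrite [RHS]mxE.
case: i => -[|[|[|[|[|[|[|[|[|[|[|//]]]]]]]]]]] Hi; rewrite (tnth_nth A) /=.
- exact: (S (@o 0 isT)).
- exact: (S (@o 1 isT)).
- exact: (S (@o 2 isT)).
- exact: (S (@o 3 isT)).
- exact: O1.
- exact: (C (@o 1 isT) (@o 2 isT)).
- exact: (C (@o 0 isT) (@o 2 isT)).
- exact: (C (@o 1 isT) (@o 3 isT)).
- exact: (C (@o 0 isT) (@o 3 isT)).
- exact: O6.
- exact: a0.
Qed.

End Dual.

Context (cof : coframe setT frame).

(** The map (C, y) into the group of motions has the injective differential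
    (C Gamma, C theta), so it is a local diffeomorphism. The second component
    shows that the fibres are given by theta = 0, the first one that Gamma takes
    the value xi on the fundamental vector field of xi. *)
Theorem motion_frame_bundle (V : set P) (p0 : P) (C : P -> 'M[R]_4) (y : P -> 'rV[R]_4) :
  open V -> V p0 -> smooth_fun V C -> smooth_fun V y -> (forall q, V q -> CO22 R (C q)) ->
  (forall q v, V q -> dfun C q v = C q *m conn q v) ->
  (forall q v, V q -> dfun y q v = (C q *m sold q v)^T) ->
  exists U : set P, [/\ open U, U p0, U `<=` V &
    principal_CO22_bundle_on th1 th2 th3 th4 Om1 Om2 Om3 Om4 Om5 Om6 A U].
Proof.
move=> oV Vp CS yS CG CD yD.
have G1 : affine_group (pack 1%:M 0 : 'rV[R]_(4 * 4 + 4)).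
  by rewrite /affine_group /= pack_lin; exact: CO22_1.
pose q0 : motions := exist (fun z => z \in affine_group) (pack 1%:M 0) (mem_set G1).
pose iota (q : P) : motions := mk_motion q0 (C q) (y q).
have fE q : V q -> C q = (fibre_coord \o iota) q.
  by move=> Vq; rewrite /= mk_motion_fibre //; exact: CG.
have bE q : V q -> y q = (base_proj \o iota) q.
  by move=> Vq; rewrite /= mk_motion_base //; exact: CG.
have fS := smooth_fun_ext oV fE CS; have bS := smooth_fun_ext oV bE yS.
have iS : smooth_map V iota.
  exact: (@sub_smooth_map _ _ _ _ _ group_slice_amb _ _ _ _ oV (motion_smooth_map oV fS bS)).
have fD q v : V q -> dfun (fibre_coord \o iota) q v = C q *m conn q v.
  move=> Vq; have [_ ->] := dfun_ext v oV Vq fE (smooth_fun_differentiable CS Vq).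
  exact: CD.
have bD q v : V q -> dfun (base_proj \o iota : P -> 'rV[R]_4) q v = (C q *m sold q v)^T.
  move=> Vq; have [_ ->] := dfun_ext v oV Vq bE (smooth_fun_differentiable yS Vq).
  exact: yD.
have fchain q v : V q -> dfun fibre_coord (iota q) (v *m tangent iota q) = C q *m conn q v.
  move=> Vq; rewrite -fD //; apply: (tangent_chain_at v oV Vq iS erefl).
  exact: smooth_fun_differentiable fibre_coord_smooth _.
have bchain q v : V q -> dfun (base_proj : motions -> 'rV[R]_4) (iota q) (v *m tangent iota q)
    = (C q *m sold q v)^T.
  move=> Vq; rewrite -bD //; apply: (tangent_chain_at v oV Vq iS erefl).
  exact: smooth_fun_differentiable base_proj_smooth _.
have Cu q : V q -> C q \in unitmx by move=> /CG/CO22_unit.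
have Cinj q (n : nat) (X Y : 'M[R]_(4, n)) : V q -> C q *m X = C q *m Y -> X = Y.
  by move=> Vq E; rewrite -[X](mulKmx (Cu q Vq)) E mulKmx //; exact: Cu.
have bz q v : V q -> (C q *m sold q v)^T = 0 -> sold q v = 0.
  move=> Vq E; apply: (Cinj q) => //; rewrite mulmx0 -[LHS]trmxK E.
  by apply/matrixP => i j; rewrite !mxE.
have i0 (v : 'rV[R]_11) : v *m tangent iota p0 = 0 -> v = 0.
  move=> v0; have d0 (W : normedModType R) (h : motions -> W) : dfun h (iota p0) 0 = 0.
    exact: linear0.
  apply: (frame_faithful cof (p := p0)).
    by apply: (Cinj p0) => //; rewrite mulmx0 -fchain // v0 d0.
  by apply: bz => //; rewrite -bchain // v0 d0.
have [U [oU Up UV Ue]] := local_embedding oV Vp iS i0.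
exists U; split; [exact: oU|exact: Up|exact: UV|].
exists (euclid R 4), motions, base_proj, motion_act, iota; split.
- exact: motions_principal.
- exact: Ue.
- move=> p v /UV Vp'.
  have bp : differentiable_at (base_proj \o iota : P -> 'rV[R]_4) p by exact: smooth_fun_differentiable bS Vp'.
  have E := tangent_euclid v bp.
  have TE : (v *m tangent (base_proj \o iota) p = 0 :> 'rV_4) <-> sold p v = 0.
    split=> [T0|S0]; last by apply: etrans E _; rewrite bD // S0 mulmx0; apply/rowP => j; rewrite !mxE.
    by apply: bz => //; rewrite -bD //; apply: etrans (esym E) _.
  apply: (iff_trans TE); split=> [/colP S|[e1 e2 e3 e4]].
    have Z (w : 'cV[R]_11) : (v *m w) 0 0 = 0 -> v *m w = 0.
      by move=> H; apply/matrixP => i j; rewrite !ord1 H mxE.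
    split; apply: Z.
    + by have := S (@Ordinal 4 0 isT); rewrite [LHS]mxE [RHS]mxE.
    + by have := S (@Ordinal 4 1 isT); rewrite [LHS]mxE [RHS]mxE.
    + by have := S (@Ordinal 4 2 isT); rewrite [LHS]mxE [RHS]mxE.
    + by have := S (@Ordinal 4 3 isT); rewrite [LHS]mxE [RHS]mxE.
  apply/colP => i; rewrite [LHS]mxE [RHS]mxE.
  by case: i => -[|[|[|[|//]]]] ? /=; rewrite ?(e1, e2, e3, e4) mxE.
- move=> p v xi /UV Vp' /motion_fundamental; rewrite fchain // [fibre_coord _](esym (fE p Vp')).
  exact: Cinj.
Qed.

End BundlePart.

(** * The para-CR manifold *)

Section ImageFibration.
Context {R : realType} {m n : nat} {M : manifold R m}.

(** The tangent spaces of an open subset of R^n are identified with R^n by the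
    inclusion. *)
Lemma dfun_sub_val (O : set 'rV[R]_n) (oO : open O) (z : open_sub oO) w :
  differentiable_at (sub_val : open_sub oO -> 'rV[R]_n) z /\
  dfun (sub_val : open_sub oO -> 'rV[R]_n) z w = w.
Proof.
have oT : open [set: 'rV[R]_n] by exact: openT.
have S := @sub_val_smooth _ _ _ _ _ (open_slice_mem oO) _ _ setT id oT (@Csmooth_id _ _ _).
have D : differentiable_at (sub_val : open_sub oO -> 'rV[R]_n) z by exact: smooth_fun_differentiable S _.
split=> //; have := tangent_euclid (F := incl) w D; rewrite (tangent_incl z) mulmx1.
by move=> {2}->.
Qed.

(** The image is open because submersions are open maps; restricting the codomain
    to it makes the map surjective. *)
Theorem image_fibration U (f : M -> 'rV[R]_n) p0 : open U -> U p0 -> smooth_fun U f ->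
  (forall p w, U p -> exists v, dfun f p v = w) ->
  exists (oO : open (f @` U)) (q : M -> open_sub oO), fibred_over U q /\
    forall p, U p -> sub_val (q p) = f p /\ forall v, v *m tangent q p = dfun f p v.
Proof.
move=> oU Up fU fs; have oO : open (f @` U) by exact: submersion_open.
exists oO.
have O0 : (f @` U) (f p0) by exists p0.
pose q p : open_sub oO :=
  match pselect ((f @` U) (f p)) with
  | left H => exist (fun u => u \in f @` U) (f p) (mem_set H)
  | right _ => exist (fun u => u \in f @` U) (f p0) (mem_set O0)
  end.
have qE p : U p -> sub_val (q p) = f p.
  by move=> Up'; rewrite /q; case: pselect => [//|[]]; exists p.
have sqU : smooth_fun U (sub_val \o q).
  by apply: smooth_fun_ext fU => // p Up'; rewrite /= qE.
have qU : smooth_map U q by exact: (@sub_smooth_map _ _ _ _ _ (open_slice_mem oO) _ _ _ _ oU sqU).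
have qT p v : U p -> v *m tangent q p = dfun f p v.
  move=> Up'; have [D E] := dfun_sub_val (q p) (v *m tangent q p).
  have [_ T] := tangent_chain v oU Up' qU D.
  rewrite -[LHS]E T; have Fp := smooth_fun_differentiable fU Up'.
  have fq r : U r -> f r = (sub_val \o q) r by move=> Ur; exact: esym (qE r Ur).
  have [_ fqD] := dfun_ext v oU Up' fq Fp; exact: fqD.
exists q; split; last by move=> p Up'; split=> [|v]; [exact: qE|exact: qT].
split; last first.
  apply/seteqP; split=> // z _; have [p Up' pE] := open_sub_mem z.
  by exists p => //; apply: (@sub_inj _ _ _ _ _ (open_slice_mem oO)); rewrite -[LHS]/(sub_val (q p)) qE.
split=> // p Up'; apply/row_fullP.
have /choice[s sP] : forall i : 'I_n, exists v, dfun f p v = (delta_mx 0 i : 'rV_n).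
  by move=> i; exact: fs.
exists (\matrix_(i, j) s i 0 j); apply/row_matrixP => i.
rewrite row_mul; have -> : row i (\matrix_(i, j) s i 0 j) = s i.
  by apply/rowP => j; rewrite !mxE.
by rewrite qT // sP; apply/rowP => j; rewrite !mxE eqxx eq_sym.
Qed.

End ImageFibration.

Section NullRow.
Context {R : realType}.
Local Notation eta := (eta22 R).
Local Notation o k := (@Ordinal 4 k isT).
Implicit Types D : 'M[R]_4.

Lemma sum4 (F : 'I_4 -> R) : \sum_i F i = F (o 0) + F (o 1) + F (o 2) + F (o 3).
Proof.
rewrite !big_ord_recr big_ord0 /= add0r.
by congr (F _ + F _ + F _ + F _); apply: val_inj.
Qed.

Lemma ord4P (Q : 'I_4 -> Prop) : Q (o 0) -> Q (o 1) -> Q (o 2) -> Q (o 3) -> forall i, Q i.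
Proof.
move=> Q0 Q1 Q2 Q3 [[|[|[|[|//]]]] lt]; rewrite (bool_irrelevance lt isT) //.
Qed.

(** The last row of D is a null vector of [eta], hence a multiple of
    (s0, s1, - s0 s1, 1) for the two slopes s0 and s1. *)
Definition slope0 D : R := D (o 3) (o 0) / D (o 3) (o 3).
Definition slope1 D : R := D (o 3) (o 1) / D (o 3) (o 3).

(** The coefficients of theta^1, theta^2, theta^3 on nu_1, nu_2, nu_3 when
    theta = D dy is expanded in the coframe of the flat model. *)
Definition nu_coef D : 'M[R]_3 := \matrix_(i, j)
  let k := widen_ord (leqnSn 3) i in
  nth 0 [:: D k (o 0) - slope0 D * D k (o 3); D k (o 1) - slope1 D * D k (o 3);
    - (D k (o 2) + slope0 D * slope1 D * D k (o 3))] j.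

(** The coefficients of the differentials of the slopes on Omega_3 and Omega_2. *)
Definition mu_coef D : 'M[R]_2 := \matrix_(i, j)
  let s := nth 0 [:: slope0 D; slope1 D] i in
  let k := nth (o 0) [:: o 1; o 0] j in
  (D (o 3) (o 3))^-1 * (D k (nth (o 0) [:: o 0; o 1] i) - s * D k (o 3)).

(** The coordinates (x, y, a0, a1, a2, a3) of the flat model. The order and the
    sign of the entries of y make theta^4, which is the last row of D dy, a
    multiple of da0 + x da1 + y da2 + x y da3. *)
Definition slopes_base D (y : 'rV[R]_4) : 'rV[R]_6 := \row_k
  nth 0 [:: slope0 D; slope1 D; y 0 (o 3); y 0 (o 0); y 0 (o 1); - y 0 (o 2)] k.

Lemma null_row D s : D *m eta *m D^T = s *: eta -> D (o 3) (o 3) != 0 ->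
  [/\ D (o 3) (o 0) = slope0 D * D (o 3) (o 3), D (o 3) (o 1) = slope1 D * D (o 3) (o 3) &
      D (o 3) (o 2) = - (slope0 D * slope1 D * D (o 3) (o 3))].
Proof.
move=> /matrixP/(_ (o 3) (o 3)) E D33; rewrite /slope0 /slope1 !divfK //; split=> //.
move: E; rewrite !mxE sum4 !mxE !sum4 !mxE /= !(mulr0, mulr1, addr0, add0r) => E.
have {}E : D (o 3) (o 0) * D (o 3) (o 1) + D (o 3) (o 2) * D (o 3) (o 3) = 0.
  (* the diagonal entry of D eta D^T is twice the left-hand side *)
  have h2 : (2 : R) != 0 by rewrite pnatr_eq0.
  by apply: (mulfI h2); rewrite mulr0 -E; ring.
apply: (mulIf D33); have -> : D (o 3) (o 2) * D (o 3) (o 3) = - (D (o 3) (o 0) * D (o 3) (o 1)).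
  by apply/eqP; rewrite -addr_eq0 addrC E.
by field.
Qed.

End NullRow.

Section LiftPart.
Context {R : realType} {P : manifold R 11}.
Context (th1 th2 th3 th4 Om1 Om2 Om3 Om4 Om5 Om6 A : oneform P).
Local Notation conn := (connection Om1 Om2 Om3 Om4 Om5 Om6 A).
Local Notation sold := (solder th1 th2 th3 th4).
Local Notation frame := [tuple th1; th2; th3; th4; Om1; Om2; Om3; Om4; Om5; Om6; A].
Local Notation eta := (eta22 R).
Local Notation o k := (@Ordinal 4 k isT).

Context (cof : coframe setT frame).

Lemma prescribed_vector p (t : 'cV[R]_4) (x2 x3 : R) :
  exists v, [/\ sold p v = t, (v *m Om2 p) 0 0 = x2 & (v *m Om3 p) 0 0 = x3].
Proof.
pose w : 'rV[R]_11 := \row_k nth 0 [:: t (o 0) 0; t (o 1) 0; t (o 2) 0; t (o 3) 0; 0; x2; x3] k.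
have [v vE _] := coframe_dual cof p w; exists v.
have E (k : 'I_11) : (v *m nth A [:: th1; th2; th3; th4; Om1; Om2; Om3; Om4; Om5; Om6; A] k p) 0 0 =
    nth 0 [:: t (o 0) 0; t (o 1) 0; t (o 2) 0; t (o 3) 0; 0; x2; x3] k.
  by rewrite -(tnth_nth A frame) vE mxE.
split; last 2 first.
- exact: (E (@Ordinal 11 5 isT)).
- exact: (E (@Ordinal 11 6 isT)).
apply/colP; apply: ord4P; rewrite mxE.
- exact: (E (@Ordinal 11 0 isT)).
- exact: (E (@Ordinal 11 1 isT)).
- exact: (E (@Ordinal 11 2 isT)).
- exact: (E (@Ordinal 11 3 isT)).
Qed.

Context (V : set P) (C : P -> 'M[R]_4) (y : P -> 'rV[R]_4).
Hypothesis oV : open V.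
Hypothesis CS : smooth_fun V C.
Hypothesis yS : smooth_fun V y.
Hypothesis CD : forall q v, V q -> dfun C q v = C q *m conn q v.
Hypothesis yD : forall q v, V q -> dfun y q v = (C q *m sold q v)^T.
Hypothesis CX : forall q, V q -> exists2 s, 0 < s & C q *m eta *m (C q)^T = s *: eta.

Let D q := invmx (C q).

Let CG q : V q -> CO22 R (C q).
Proof. by move=> /CX[s s0 E]; exists s => //; exact: conformal_transpose. Qed.

Let Cu q : V q -> C q \in unitmx. Proof. by move=> /CG/CO22_unit. Qed.

Let DS : smooth_fun V D.
Proof. exact: smooth_fun_invmx. Qed.

Let D_dble q : V q -> differentiable_at D q. Proof. exact: smooth_fun_differentiable DS. Qed.

Lemma inverse_frame_derive q v : V q -> dfun D q v = - (conn q v *m D q).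
Proof.
move=> Vq; have Cq := smooth_fun_differentiable CS Vq; have Dq := D_dble Vq.
pose one : P -> 'M[R]_4 := fun=> 1%:M.
have d1 : differentiable_at one q by exact: differentiable_cst.
have E r : V r -> one r = C r *m D r by move=> Vr; rewrite /D mulmxV //; exact: Cu.
have [_ H] := dfun_ext (f := one) (g := fun r => C r *m D r) v oV Vq E d1.
move: H; rewrite dfun_cst (dfun_mulmx v Cq Dq) (CD _ Vq) -mulmxA -mulmxDr => H.
have Z : conn q v *m D q + dfun D q v = 0.
  by rewrite -[LHS](mulKmx (Cu Vq)) H mulmx0.
by apply/eqP; rewrite -addr_eq0 addrC Z.
Qed.

Lemma last_row_derive q v j : V q -> dfun (fun r => D r (o 3) j) q v =
  (v *m Om2 q) 0 0 * D q (o 0) j + (v *m Om3 q) 0 0 * D q (o 1) j -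
  (v *m (2^-1 *: A q + Om6 q)) 0 0 * D q (o 3) j.
Proof.
move=> Vq; rewrite (dfun_entry _ _ _ (D_dble Vq)) inverse_frame_derive //.
rewrite [LHS]mxE [X in - X]mxE sum4 ![conn q v _ _]mxE /= !mulmxN !mulmx0.
have N (X : 'M[R]_1) : (- X) 0 0 = - X 0 0 by rewrite mxE.
have Z : (0 : 'M[R]_1) 0 0 = 0 by rewrite mxE.
by rewrite !N Z; ring.
Qed.

Let V1 := V `&` ((fun q => D q (o 3) (o 3)) @^-1` [set s | s != 0]).
Let V2 := V1 `&` ((fun q => \det (nu_coef (D q))) @^-1` [set s | s != 0]).

(** The slopes are defined here, and the matrices of the lifting procedure are
    invertible. *)
Definition lift_domain : set P := V2 `&` ((fun q => \det (mu_coef (D q))) @^-1` [set s | s != 0]).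

Let DijS (i j : 'I_4) : smooth_fun V (fun q => D q i j).
Proof. by have /(smooth_fun_mx _ oV) := DS; exact. Qed.

Let oneq0 : open [set s : R | s != 0]. Proof. exact: open_neq. Qed.

Let oV1 : open V1. Proof. exact: smooth_fun_open. Qed.

Let V1V : V1 `<=` V. Proof. by move=> q []. Qed.

Let D33 q : V1 q -> D q (o 3) (o 3) != 0. Proof. by move=> []. Qed.

Let DS1 i j : smooth_fun V1 (fun q => D q i j).
Proof. exact: smooth_fun_sub V1V (DijS i j). Qed.

Let VS1 : smooth_fun V1 (fun q => (D q (o 3) (o 3))^-1).
Proof. by apply: smooth_funV => //; exact: DS1. Qed.

Let s0S : smooth_fun V1 (fun q => slope0 (D q)).
Proof. by apply: smooth_funM => //; exact: DS1. Qed.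

Let s1S : smooth_fun V1 (fun q => slope1 (D q)).
Proof. by apply: smooth_funM => //; exact: DS1. Qed.

Let nuS : smooth_fun V1 (fun q => nu_coef (D q)).
Proof.
apply/smooth_fun_mx => // i j; under eq_fun do rewrite mxE.
case: j => [[|[|[|//]]] ?] /=; do ?[apply: smooth_funD => // | apply: smooth_funN => // |
  apply: smooth_funM => // | exact: DS1].
Qed.

Let muS : smooth_fun V1 (fun q => mu_coef (D q)).
Proof.
apply/smooth_fun_mx => // i j; under eq_fun do rewrite mxE.
case: i => [[|[|//]] ?] /=; do ?[apply: smooth_funD => // | apply: smooth_funN => // |
  apply: smooth_funM => // | exact: DS1].
Qed.

Let oV2 : open V2.
Proof. by apply: smooth_fun_open => //; exact: smooth_fun_det. Qed.

Lemma lift_domain_open : open lift_domain.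
Proof.
apply: smooth_fun_open => //; apply: smooth_fun_det => //.
by apply: smooth_fun_sub muS => q [].
Qed.

Lemma lift_domain_sub : lift_domain `<=` V. Proof. by move=> q [[[]]]. Qed.

Lemma lift_domain_id q : V q -> C q = 1%:M -> lift_domain q.
Proof.
move=> Vq C1; have D1 : D q = 1%:M by rewrite /D C1 invmx1.
have s0 : slope0 (1%:M : 'M[R]_4) = 0 by rewrite /slope0 !mxE mul0r.
have s1 : slope1 (1%:M : 'M[R]_4) = 0 by rewrite /slope1 !mxE mul0r.
have nE : nu_coef (1%:M : 'M[R]_4) = diag_mx (\row_j nth 0 [:: 1; 1; -1] j).
  apply/matrixP => -[[|[|[|//]]] ?] [[|[|[|//]]] ?];
  by rewrite !mxE s0 s1 /= ?(mul0r, mulr0, mulr0n, mulr1n, subr0, addr0, oppr0) ?mxE /= ?oppr0.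
have mE : mu_coef (1%:M : 'M[R]_4) = \matrix_(i, j) (i != j)%:R.
  apply/matrixP => -[[|[|//]] ?] [[|[|//]] ?];
  by rewrite !mxE s0 s1 /= ?(mul0r, mulr0, mulr0n, mulr1n, subr0, addr0, oppr0) ?mxE /= ?(invr1, mulr1, mulr0).
split; first split; first split=> //; rewrite /preimage /= D1.
- by rewrite mxE oner_neq0.
- rewrite nE det_diag !big_ord_recl big_ord0 !mxE /= !mul1r mulr1.
  by rewrite oppr_eq0 oner_eq0.
have mK : mu_coef (1%:M : 'M[R]_4) *m mu_coef 1%:M = 1%:M.
  rewrite mE; apply/matrixP => -[[|[|//]] ?] [[|[|//]] ?];
  by rewrite !mxE !big_ord_recl big_ord0 !mxE /= ?(mulr0, mul0r, mulr1, addr0, add0r).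
by have [] := mulmx1_unit mK; rewrite unitmxE unitfE.
Qed.

Let f q := slopes_base (D q) (y q).

Let LV1 : lift_domain `<=` V1. Proof. by move=> q [[]]. Qed.

Let fS : smooth_fun V1 f.
Proof.
have yS1 (j : 'I_4) : smooth_fun V1 (fun q => y q 0 j).
  by apply: smooth_fun_sub V1V _; have /(smooth_fun_mx _ oV) := yS; exact.
apply/smooth_fun_mx => // i j; under eq_fun do rewrite mxE.
by case: j => [[|[|[|[|[|[|//]]]]]] ?] /=; do ?[exact: yS1 | apply: smooth_funN].
Qed.

Let yjD q v j : V q -> dfun (fun r => y r 0 j) q v = (C q *m sold q v) j 0.
Proof.
by move=> Vq; rewrite (dfun_entry _ _ _ (smooth_fun_differentiable yS Vq)) yD // mxE.
Qed.

(** By dD = - Gamma D the other connection forms only rescale the last row of D,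
    which does not change its slopes. *)
Let slope_derive q v (s : P -> R) j : V1 q -> smooth_fun V1 s ->
  (forall r, V1 r -> D r (o 3) j = s r * D r (o 3) (o 3)) ->
  dfun s q v = (D q (o 3) (o 3))^-1 * ((D q (o 1) j - s q * D q (o 1) (o 3)) * (v *m Om3 q) 0 0
    + (D q (o 0) j - s q * D q (o 0) (o 3)) * (v *m Om2 q) 0 0).
Proof.
move=> V1q sS E; have Vq := V1V V1q.
have sq := smooth_fun_differentiable sS V1q.
have d3 k : differentiable_at (fun r => D r (o 3) k) q by exact: smooth_fun_differentiable (DS1 (o 3) k) V1q.
have [_ H] := dfun_ext (g := fun r => s r * D r (o 3) (o 3)) v oV1 V1q E (d3 j).
move: H; rewrite (dfunM v sq (d3 (o 3))) !last_row_derive // (E q V1q) => H.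
apply: (mulIf (D33 V1q)); rewrite mulrAC mulVf ?D33 // mul1r.
move: H; set k := (v *m (2^-1 *: A q + Om6 q)) 0 0; set x2 := (v *m Om2 q) 0 0; set x3 := (v *m Om3 q) 0 0.
by move=> H; apply: (addIr (s q * (x2 * D q (o 0) (o 3) + x3 * D q (o 1) (o 3) - k * D q (o 3) (o 3))));
  rewrite H; ring.
Qed.

Let f_entry q v k : V1 q -> dfun f q v 0 k = dfun (fun r => f r 0 k) q v.
Proof. by move=> V1q; rewrite (dfun_entry _ _ _ (smooth_fun_differentiable fS V1q)). Qed.

Let f_derive q v : V1 q -> let dy := C q *m sold q v in
  dfun f q v = \row_k nth 0 [:: dfun (fun r => slope0 (D r)) q v; dfun (fun r => slope1 (D r)) q v;
    dy (o 3) 0; dy (o 0) 0; dy (o 1) 0; - dy (o 2) 0] k.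
Proof.
move=> V1q dy; have Vq := V1V V1q; apply/rowP => k; rewrite f_entry // [RHS]mxE.
under [X in dfun X]eq_fun do rewrite mxE.
case: k => [[|[|[|[|[|[|//]]]]]] ?] /=; rewrite ?yjD //.
have yq : differentiable_at (fun r => y r 0 (o 2)) q by exact: differentiable_at_entry (smooth_fun_differentiable yS Vq).
rewrite -yjD // !dfunE //; last exact: differentiableN.
by apply: deriveN; exact: diff_derivable.
Qed.

Let slopes_derive q v : V1 q ->
  \col_i nth 0 [:: dfun (fun r => slope0 (D r)) q v; dfun (fun r => slope1 (D r)) q v] (i : 'I_2) =
  mu_coef (D q) *m \col_i nth 0 [:: (v *m Om3 q) 0 0; (v *m Om2 q) 0 0] (i : 'I_2).
Proof.
move=> V1q; apply/colP => i; rewrite [LHS]mxE [RHS]mxE !big_ord_recl big_ord0.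
rewrite ![mu_coef _ _ _]mxE ![(\col__ _) _ _]mxE /=.
have E0 r : V1 r -> D r (o 3) (o 0) = slope0 (D r) * D r (o 3) (o 3).
  by move=> /D33 d; rewrite /slope0 divfK.
have E1 r : V1 r -> D r (o 3) (o 1) = slope1 (D r) * D r (o 3) (o 3).
  by move=> /D33 d; rewrite /slope1 divfK.
case: i => [[|[|//]] ?] /=.
  by rewrite (slope_derive v V1q s0S E0); ring.
by rewrite (slope_derive v V1q s1S E1); ring.
Qed.

Let mu_unit q : lift_domain q -> mu_coef (D q) \in unitmx.
Proof. by move=> [_ H]; rewrite unitmxE unitfE. Qed.

(** The values of theta determine those of dy, and those of Omega_2, Omega_3 the
    differentials of the slopes; all of them are independent. *)
Lemma slopes_base_submersion q w : lift_domain q -> exists v, dfun f q v = w.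
Proof.
move=> Lq; have V1q := LV1 Lq; have Vq := V1V V1q.
pose dy : 'cV[R]_4 := \col_k nth 0 [:: w 0 (@Ordinal 6 3 isT); w 0 (@Ordinal 6 4 isT);
  - w 0 (@Ordinal 6 5 isT); w 0 (@Ordinal 6 2 isT)] k.
pose x := invmx (mu_coef (D q)) *m
  \col_i nth 0 [:: w 0 (@Ordinal 6 0 isT); w 0 (@Ordinal 6 1 isT)] (i : 'I_2).
have [v [vt v2 v3]] := prescribed_vector q (D q *m dy) (x (@Ordinal 2 1 isT) 0) (x (@Ordinal 2 0 isT) 0).
exists v; rewrite f_derive // vt /D mulKVmx ?Cu //.
have := slopes_derive v V1q; rewrite v2 v3.
have -> : \col_i nth 0 [:: x (@Ordinal 2 0 isT) 0; x (@Ordinal 2 1 isT) 0] (i : 'I_2) = x.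
  by apply/colP => -[[|[|//]] lt]; rewrite mxE; congr (x _ _); exact: val_inj.
rewrite /x mulKVmx ?mu_unit // => /colP S.
have S0 := S (@Ordinal 2 0 isT); have S1 := S (@Ordinal 2 1 isT).
rewrite [LHS]mxE [RHS]mxE /= in S0; rewrite [LHS]mxE [RHS]mxE /= in S1.
rewrite S0 S1; apply/rowP => -[[|[|[|[|[|[|//]]]]]] lt]; rewrite !mxE /= ?opprK;
by congr (w _ _); exact: val_inj.
Qed.

Let base_values q v : V1 q -> (sold q v = D q *m \col_k nth 0 [:: dfun f q v 0 (@Ordinal 6 3 isT);
  dfun f q v 0 (@Ordinal 6 4 isT); - dfun f q v 0 (@Ordinal 6 5 isT);
  dfun f q v 0 (@Ordinal 6 2 isT)] k).
Proof.
move=> V1q; have Vq := V1V V1q; rewrite f_derive // -[LHS](mulKmx (Cu Vq)); congr (_ *m _).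
by apply/colP; apply: ord4P; rewrite !mxE /= ?opprK.
Qed.

Let contact_value q v (w := dfun f q v) : (w *m contact (f q)) 0 0 =
  w 0 (@Ordinal 6 2 isT) + slope0 (D q) * w 0 (@Ordinal 6 3 isT) +
  slope1 (D q) * w 0 (@Ordinal 6 4 isT) + slope0 (D q) * slope1 (D q) * w 0 (@Ordinal 6 5 isT).
Proof.
have P0 (X Y : 'M[R]_1) : (X + Y) 0 0 = X 0 0 + Y 0 0 by rewrite mxE.
have Z0 a (X : 'M[R]_1) : (a *: X) 0 0 = a * X 0 0 by rewrite mxE.
have f0 : f q 0 0 = slope0 (D q) by rewrite mxE.
have f1 : f q 0 1 = slope1 (D q) by rewrite mxE.
rewrite /contact !mulmxDr -!scalemxAr !P0 !Z0 f0 f1.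
rewrite (pair_basis w (@Ordinal 6 2 isT)) (pair_basis w (@Ordinal 6 3 isT)).
by rewrite (pair_basis w (@Ordinal 6 4 isT)) (pair_basis w (@Ordinal 6 5 isT)).
Qed.

Let th_lift q v (w := dfun f q v) : V1 q -> forall i, sold q v i 0 =
  D q i (o 3) * (w *m contact (f q)) 0 0 +
  ((D q i (o 0) - slope0 (D q) * D q i (o 3)) * w 0 (@Ordinal 6 3 isT) +
   (D q i (o 1) - slope1 (D q) * D q i (o 3)) * w 0 (@Ordinal 6 4 isT) -
   (D q i (o 2) + slope0 (D q) * slope1 (D q) * D q i (o 3)) * w 0 (@Ordinal 6 5 isT)).
Proof.
move=> V1q i; rewrite contact_value base_values // mxE sum4 ![(\col__ _) _ _]mxE /= -/w.
by ring.
Qed.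

Lemma col_pairing m (a b : 'cV[R]_m) :
  (forall v : 'rV[R]_m, (v *m a) 0 0 = (v *m b) 0 0) -> a = b.
Proof.
move=> E; apply/colP => i; have := E (delta_mx 0 i).
by rewrite -!rowE !mxE.
Qed.

(** The map (x, y, a0, a1, a2, a3) of [slopes_base] is a submersion onto an open
    subset of the flat model. Its slopes have been chosen so that theta^4 is a
    multiple of lambda, and then theta = D dy is the lift of (lambda, nu), while
    Omega_2 and Omega_3 are combinations of dx and dy without lambda terms. *)
Theorem motion_frame_CR U p0 : open U -> U p0 -> U `<=` lift_domain ->
  originates_from_flat_CR_on th1 th2 th3 th4 Om2 Om3 U.
Proof.
move=> oU Up UL; have UV1 : U `<=` V1 by move=> q /UL/LV1.
have [oO [q [qF qE]]] := image_fibration oU Up (smooth_fun_sub UV1 fS)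
  (fun p w Up => slopes_base_submersion w (UL p Up)).
exists (open_sub oO), (CR_class (flat_coframe oO)), (flat_coframe oO), q; split.
- by apply: CR_class_structure; [exact: flat_coframe_dom|exact: flat_para_CR].
- exact: flat_CR_flat.
- split; last exact: flat_coframe_dom.
  by split; [exact: flat_para_CR|exact: CR_equiv_refl].
- exact: qF.
have DU i j : smooth_fun U (fun q => D q i j) by apply: smooth_fun_sub (DS1 i j).
exists (fun p => D p (o 3) (o 3)), (fun p => \row_(i < 3) D p (widen_ord (leqnSn 3) i) (o 3)),
  (fun=> 0), (fun p => nu_coef (D p)), (fun p => invmx (mu_coef (D p))).
have pull w p v : U p -> (v *m pullback q w p) 0 0 = (dfun f p v *m w (q p)) 0 0.
  by move=> Up'; have [_ qT] := qE p Up'; rewrite /pullback mulmxA qT.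
split.
  split; [exact: DU| |exact: smooth_fun_cst|exact: smooth_fun_sub nuS|].
    apply/smooth_fun_mx => // i j; under eq_fun do rewrite mxE; exact: DU.
  apply: smooth_fun_invmx => //; last exact: smooth_fun_sub muS.
  by move=> p /UL; exact: mu_unit.
move=> p Up'; have V1p := UV1 p Up'; have [qp _] := qE p Up'.
have lamP v : (v *m pullback q (lam (flat_coframe oO)) p) 0 0 = (dfun f p v *m contact (f p)) 0 0.
  by rewrite pull // flat_lamE qp.
have muP B v : (v *m pullback q (mu (flat_coframe oO) B) p) 0 0 = dfun f p v 0 (widen_ord (isT : (2 <= 6)%N) B).
  by rewrite pull // flat_muE (pair_basis _ (widen_ord (isT : (2 <= 6)%N) B)).
have nuP k v : (v *m pullback q (nu (flat_coframe oO) k) p) 0 0 = dfun f p v 0 (rshift 3 k).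
  by rewrite pull // flat_nuE (pair_basis _ (rshift 3 k)).
split.
- have [[_ n1] n2] := UL p Up'; rewrite det_inv mulf_neq0 ?invr_eq0 // mulf_neq0 //; exact: D33.
- apply: col_pairing => v; rewrite -scalemxAr [RHS]mxE lamP.
  have [s s0 E] := CX (V1V V1p).
  have Ds : D p *m eta *m (D p)^T = s^-1 *: eta.
    have DC : D p *m C p = 1%:M by rewrite /D mulVmx //; exact: Cu (V1V V1p).
    have : D p *m (C p *m eta *m (C p)^T) *m (D p)^T = eta.
      by rewrite !mulmxA DC mul1mx -mulmxA -trmx_mul DC trmx1 mulmx1.
    rewrite E -scalemxAr -scalemxAl => /(congr1 (GRing.scale s^-1)) <-.
    by rewrite scalerA mulVf ?scale1r // gt_eqF.
  have [n0 n1 n2] := null_row Ds (D33 V1p).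
  have := th_lift v V1p (o 3); rewrite [LHS]mxE /= => ->.
  by rewrite n0 n1 n2; ring.
- move=> i; apply: col_pairing => v; rewrite mulmxDr mulmx_sumr [RHS]mxE summxE.
  rewrite -scalemxAr [X in X + _]mxE lamP [(\row__ _) _ _]mxE.
  have -> : (v *m tnth [tuple th1; th2; th3] i p) 0 0 = sold p v (widen_ord (leqnSn 3) i) 0.
    by rewrite [RHS]mxE; case: i => [[|[|[|//]]] ?].
  rewrite th_lift //; congr (_ + _).
  rewrite !big_ord_recl big_ord0 -!scalemxAr ![(_ *: (_ *m _)) _ _]mxE !nuP ![nu_coef _ _ _]mxE /=.
  have R3 : rshift 3 (ord0 : 'I_3) = @Ordinal 6 3 isT by exact: val_inj.
  have R4 : rshift 3 (lift ord0 (ord0 : 'I_2)) = @Ordinal 6 4 isT by exact: val_inj.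
  have R5 : rshift 3 (lift ord0 (lift ord0 (ord0 : 'I_1))) = @Ordinal 6 5 isT by exact: val_inj.
  by rewrite R3 R4 R5; ring.
move=> i; apply: col_pairing => v; have c0 : (0 : 'rV[R]_2) 0 i = 0 by rewrite mxE.
rewrite c0 scale0r add0r mulmx_sumr summxE.
have M2 := mulKmx (mu_unit (UL p Up')) (\col_i nth 0 [:: (v *m Om3 p) 0 0; (v *m Om2 p) 0 0] (i : 'I_2)).
rewrite -slopes_derive // in M2; move/colP/(_ i) : M2.
rewrite [LHS]mxE [RHS]mxE.
have -> : [:: (v *m Om3 p) 0 0; (v *m Om2 p) 0 0]`_i = (v *m tnth [tuple Om3; Om2] i p) 0 0.
  by case: i {c0} => [[|[|//]] ?].
move=> <-; apply: eq_bigr => j _; rewrite -scalemxAr [RHS]mxE muP; congr (_ * _).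
rewrite [LHS]mxE f_derive // [RHS]mxE.
by case: j => [[|[|//]] ?].
Qed.

End LiftPart.

Theorem theorem7p4 (R : realType) (P : manifold R 11)
    (th1 th2 th3 th4 Om1 Om2 Om3 Om4 Om5 Om6 A : oneform P) :
  coframe setT
    [tuple th1; th2; th3; th4; Om1; Om2; Om3; Om4; Om5; Om6; A] ->
  structure_equations th1 th2 th3 th4 Om1 Om2 Om3 Om4 Om5 Om6 A ->
  forall p : P, exists U : set P,
    [/\ open U, U p,
        principal_CO22_bundle_on th1 th2 th3 th4 Om1 Om2 Om3 Om4 Om5 Om6 A U &
        originates_from_flat_CR_on th1 th2 th3 th4 Om2 Om3 U].
Proof.
move=> cof steq p0.
have [V [C [y [[oV Vp C1 CS yS] [CD yD CX]]]]] := motion_frame cof p0 steq.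
have CG q : V q -> CO22 R (C q).
  by move=> /CX[s s0 E]; exists s => //; exact: conformal_transpose.
pose W := lift_domain V C.
have oW : open W by exact: (lift_domain_open oV CS CX).
have WV : W `<=` V by exact: lift_domain_sub.
have Wp : W p0 by exact: lift_domain_id.
have [U [oU Up UW UB]] := motion_frame_bundle cof oW Wp
  (smooth_fun_sub WV CS) (smooth_fun_sub WV yS) (fun q Wq => CG q (WV q Wq))
  (fun q v Wq => CD q v (WV q Wq)) (fun q v Wq => yD q v (WV q Wq)).
exists U; split=> [|||]; [exact: oU|exact: Up|exact: UB|].
exact: (motion_frame_CR cof oV CS yS CD yD CX oU Up UW).
Qed.
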